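(* Let $L/k$ be an abelian extension of number fields. Let $K$ be an intermediate field such that $L/K$ is tame and $K$ is totally real. Suppose there exists a prime $\mathfrak{p}$ of $k$ such that $e_{\mathfrak{p},K/k}$ has a nontrivial odd factor and $e_{\mathfrak{p},L/K}$ has an odd prime factor $\ell$ for which the following two conditions hold: (a) $K$ is linearly disjoint from $\mathbb{Q}(\zeta_\ell)$ over $\mathbb{Q}$ (equivalently, $[K(\zeta_\ell):K]=\ell-1$); and (b) if $\ell=3$, then $e_{\mathfrak{p},K/k}$ has an odd prime divisor $q$ such that $\zeta_q\notin L(\zeta_{3^\infty})$. Then $L/K$ has no weak normal integral basis.
   Context: ''Tame'' means at most tamely ramified. $e_{\mathfrak{p},K/k}$ is the ramification index of $\mathfrak{p}$ in $K/k$, and $e_{\mathfrak{p},L/K}$ is the ramification index in $L/K$ of any prime of $K$ above $\mathfrak{p}$ (well defined as $L/k$ is Galois). $\zeta_n$ is a primitive $n$-th root of unity and $L(\zeta_{3^\infty})=\bigcup_{n\ge1}L(\zeta_{3^n})$. For a tame abelian extension $L/K$ with group $G$, $L/K$ has a weak normal integral basis if $\mathfrak{M}\mathcal{O}_L$ is a free $\mathfrak{M}$-module, where $\mathfrak{M}$ is the unique maximal $\mathcal{O}_K$-order in $K[G]$. *)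

(* Defs.v *)
From HB Require Import structures.
From mathcomp Require Import all_boot all_order all_algebra all_fingroup all_field.
From mathcomp Require Import boolp classical_sets.

Set Implicit Arguments.
Unset Strict Implicit.
Unset Printing Implicit Defensive.

Import GRing.Theory.

Local Open Scope ring_scope.
Local Open Scope classical_set_scope.

(* All finite sums of op a b with a in A and b in B. *)
Definition lincomb (S T : Type) (V : nmodType) (op : S -> T -> V)
    (A : set S) (B : set T) : set V :=
  [set v | exists n (a : 'I_n -> S) (b : 'I_n -> T),
     [/\ forall i, A (a i), forall i, B (b i) & v = \sum_(i < n) op (a i) (b i)]].

(* The pointwise product on {ffun gT -> R} is not the one we want, hence the
   alias, which carries the convolution product. *)
Definition group_algebra (R : comNzRingType) (gT : finGroupType) : Type :=
  {ffun gT -> R}.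

Section GroupAlgebra.
Variables (R : comNzRingType) (gT : finGroupType).
Local Notation A := (group_algebra R gT).
Implicit Types x y z : A.

HB.instance Definition _ := GRing.Lmodule.copy A {ffun gT -> R^o}.

Definition ga_coef (x : A) (g : gT) : R := (x : {ffun gT -> R}) g.

Definition ga_one : A := [ffun g => (g == 1%g)%:R].

Definition ga_mul x y : A :=
  [ffun g => \sum_(h : gT) ga_coef x h * ga_coef y (h^-1 * g)%g].

Fact ga_mulA : associative ga_mul.
Proof.
move=> x y z; apply/ffunP=> g; rewrite !ffunE.
under eq_bigr => h _ do rewrite /ga_coef ffunE mulr_sumr.
under [RHS]eq_bigr => h _ do rewrite /ga_coef ffunE mulr_suml.
rewrite [RHS]exchange_big /=; apply: eq_bigr => h _.
rewrite [RHS](reindex_inj (mulgI h)) /=; apply: eq_bigr => j _.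
by rewrite /ga_coef mulKg mulrA invMg mulgA.
Qed.

Fact ga_mul1 : left_id ga_one ga_mul.
Proof.
move=> x; apply/ffunP=> g; rewrite ffunE (bigD1 1%g) //= /ga_coef ffunE eqxx.
rewrite mul1r invg1 mul1g big1 ?addr0 // => h /negPf hn.
by rewrite ffunE hn mul0r.
Qed.

Fact ga_mulr1 : right_id ga_one ga_mul.
Proof.
move=> x; apply/ffunP=> g; rewrite ffunE (bigD1 g) //= /ga_coef ffunE mulVg eqxx.
rewrite mulr1 big1 ?addr0 // => h /negPf hn.
by rewrite ffunE -eq_invg_mul invgK hn mulr0.
Qed.

Fact ga_mulDl : left_distributive ga_mul +%R.
Proof.
move=> x y z; apply/ffunP=> g; rewrite !ffunE -big_split /=.
by apply: eq_bigr => h _; rewrite /ga_coef ffunE mulrDl.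
Qed.

Fact ga_mulDr : right_distributive ga_mul +%R.
Proof.
move=> x y z; apply/ffunP=> g; rewrite !ffunE -big_split /=.
by apply: eq_bigr => h _; rewrite /ga_coef ffunE mulrDr.
Qed.

Fact ga_one_neq0 : ga_one != 0 :> A.
Proof.
by apply/eqP=> /ffunP/(_ 1%g); rewrite !ffunE eqxx; apply/eqP/oner_neq0.
Qed.

HB.instance Definition _ := GRing.Zmodule_isNzRing.Build A
  ga_mulA ga_mul1 ga_mulr1 ga_mulDl ga_mulDr ga_one_neq0.

Fact ga_scaleAl (a : R) x y : a *: (x * y) = (a *: x) * y.
Proof.
apply/ffunP=> g; rewrite !ffunE /GRing.scale /= mulr_sumr.
by apply: eq_bigr => h _; rewrite /ga_coef ffunE -mulrA.
Qed.

HB.instance Definition _ := GRing.Lmodule_isLalgebra.Build R A ga_scaleAl.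

End GroupAlgebra.

(* Number fields are subfields of an ambient normal extension N of rat: 'Gal
   needs one.  N is only a container, L need not be normal over rat. *)
Section NumberFields.
Variable N : splittingFieldType rat.
Implicit Types (k K L : {subfield N}) (I J p P Q : set N) (e : nat).

Definition int_ring K : set N :=
  [set x | x \in K /\ integralOver (intr : int -> N) x].

Definition is_ideal K I : Prop :=
  [/\ I `<=` int_ring K, I 0, forall x y, I x -> I y -> I (x + y)
    & forall a x, int_ring K a -> I x -> I (a * x)].

Definition ideal_mul : set N -> set N -> set N := lincomb *%R.

Definition ideal_exp K P n : set N := iter n (ideal_mul P) (int_ring K).

Definition ideal_dvd K I J : Prop :=
  exists2 M, is_ideal K M & J = ideal_mul I M.

Definition prime_of K P : Prop :=
  [/\ is_ideal K P, P !=set0 /\ P <> [set 0], ~ P 1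
    & forall x y, int_ring K x -> int_ring K y -> P (x * y) -> P x \/ P y].

Definition lies_over k P p : Prop := P `&` [set` k] = p.

(* e is the exponent of P in the factorisation of p O_K, for P a prime of K. *)
Definition ram_exponent K p P e : Prop :=
  let pO := ideal_mul p (int_ring K) in
  ideal_dvd K (ideal_exp K P e) pO /\ ~ ideal_dvd K (ideal_exp K P e.+1) pO.

(* The next two are relations because well-definedness needs K / k (resp. L / k)
   to be Galois; then any P gives the same e. *)
Definition ramification_index k K p e : Prop :=
  exists P, [/\ prime_of K P, lies_over k P p & ram_exponent K p P e].

Definition ramification_index_above k K L p e : Prop :=
  exists P, [/\ prime_of K P, lies_over k P p & ramification_index K L P e].

(* Residue fields are finite, so tameness only constrains the exponents. *)
Definition tame K L : Prop :=
  forall P Q e, prime_of K P -> prime_of L Q -> lies_over K Q P ->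
    ram_exponent L P Q e -> forall r : nat, prime r -> P r%:R -> ~~ (r %| e)%N.

Definition abelian_ext k L : Prop :=
  galois k L /\ abelian 'Gal(L / k).

Definition totally_real K : Prop :=
  forall (f : {rmorphism subvs_of K -> algC}) x, f x \is Num.real.

Variables K L : {subfield N}.
Local Notation G := (subg_of 'Gal(L / K)).
Local Notation KG := (group_algebra (subvs_of K) G).

Definition OK : set (subvs_of K) := [set c | int_ring K (vsval c)].

Definition is_order (Lam : set KG) : Prop :=
  [/\ Lam 1, forall x y, Lam x -> Lam y -> Lam (x - y),
      forall x y, Lam x -> Lam y -> Lam (x * y),
      exists s : seq KG, Lam = lincomb *:%R OK [set` s]
    & lincomb *:%R setT Lam = setT].

Definition is_maximal_order (Lam : set KG) : Prop :=
  is_order Lam /\ forall Lam', is_order Lam' -> Lam `<=` Lam' -> Lam' = Lam.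

(* The product of 'Gal(L / K) is composition in diagrammatic order, so this is
   a left action of K[G] on L when 'Gal(L / K) is abelian, the only case used. *)
Definition ga_act (x : KG) (y : N) : N :=
  \sum_(s : G) vsval (ga_coef x s) * (sgval s : gal_of L) y.

(* X is a free M-module: B is a basis. *)
Definition is_free (M : set KG) (X : set N) : Prop :=
  exists B : set N,
    [/\ B `<=` X, X = lincomb ga_act M B
      & forall n (b : 'I_n -> N), injective b -> (forall i, B (b i)) ->
          forall m : 'I_n -> KG, (forall i, M (m i)) ->
            \sum_(i < n) ga_act (m i) (b i) = 0 -> forall i, m i = 0].

Definition weak_normal_integral_basis : Prop :=
  exists M : set KG, is_maximal_order M /\
    is_free M (lincomb ga_act M (int_ring L)).

End NumberFields.

(* L(zeta_3^oo) is an infinite extension, so it is formed inside algC and not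
   inside some N. *)
Definition is_subfield (F : set algC) : Prop :=
  [/\ F 1, forall x y, F x -> F y -> F (x - y)
    & forall x y, F x -> F y -> F (x / y)].

Definition field_gen (A : set algC) : set algC := smallest is_subfield A.

Definition rat_field : set algC := range (ratr : rat -> algC).

Definition lin_indep (F : set algC) n (x : 'I_n -> algC) : Prop :=
  forall c : 'I_n -> algC, (forall i, F (c i)) ->
    \sum_(i < n) c i * x i = 0 -> forall i, c i = 0.

Definition lin_disjoint (F E1 E2 : set algC) : Prop :=
  forall n (x : 'I_n -> algC), (forall i, E1 (x i)) ->
    lin_indep F x -> lin_indep E2 x.

(* Main.v *)
(* Suppose that al generates M O_L over M.  Every h in Gal(L / k) maps al to m al
   with m a unit of M, so it multiplies the resolvent
   a(chi) = sum_s chi(s)^-1 s(al) of a character chi of Gal(L / K) by the unit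
   chi(m).  Put d(chi) = c(chi) / c(chi^-1) with c(chi) = a(chi)^2 / a(chi^2);
   it lies in K(z), for z a root of unity of l-power order.  An automorphism over
   k(z) multiplies d(chi) by u / u^* for a unit u, because K is totally real, and
   this is a root of unity by Kronecker's theorem.

   Let v be a valuation above p, normalised on K.  By tameness, chi can be chosen
   such that v(a(chi^i)) is the fractional part of i / l; then v(d(chi^i)) is 1 or
   -1 according to whether this is more or less than 1 / 2.  Let q be an odd prime
   dividing the ramification index of K / k, so that q divides the valuations of
   k(z), which is unramified over k.  Choose n0 prime to q such that the roots of
   unity above have order dividing n0 q^s.

   If l = 3, then L(z) has no root of unity of order q, so d(chi)^n0 lies in k(z)
   and q divides n0, a contradiction.  If l > 3, take an automorphism nu over K
   squaring the l-th roots of unity, and let it raise the roots of unity of order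
   q^s to the power w.  Then nu(d)^n0 / d^(n0 w) lies in k(z), hence
   v(nu(d)) = w v(d) modulo q.  For d(chi) this gives w = 1, and for
   d(chi^((l - 1) / 2)) it gives w = -1, so that q divides 2. *)
Require Import Defs.
From HB Require Import structures.
From mathcomp Require Import all_boot all_order all_algebra all_fingroup all_solvable.
From mathcomp Require Import all_field all_character.
From mathcomp Require Import boolp classical_sets.
From mathcomp Require Import ring lra zify.

Set Implicit Arguments.
Unset Strict Implicit.
Unset Printing Implicit Defensive.
Import Order.TTheory GRing.Theory Num.Theory.
Local Open Scope ring_scope.
Local Open Scope classical_set_scope.

(** * Algebraic integers *)

(** The valuation is extended to all of [algC], with rational values: L, K(z) and their conjugates
    are then compared inside one field, and an unramified extension is one that adds no new values.
    That v(a(chi)) is a fractional part has three sources. M O_L contains O_L, so the resolvents of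
    integers are integral multiples of a(chi), and tameness makes one of them less divisible than a
    uniformiser of K. The quotient a(chi) a(psi) / a(chi psi) lies in K(z), so the values add up
    modulo those of K. A chi nontrivial on inertia has a positive value. The shape of d answers two
    demands: in c the values of chi brought in by Gal(L / K) cancel, and dividing by c at chi^-1
    pairs each unit with its complex conjugate. The price is that v(d(chi^i)) only tells on which
    side of l / 2 the index i lies. Doubling carries (l - 1) / 2 across this threshold and keeps 1
    below it, provided that l > 3; for l = 3 both indices coincide, which is why that case relies on
    condition (b). *)

Definition algint (F : fieldType) : {pred F} :=
  fun x => `[< integralOver (intr : int -> F) x >].
Arguments algint {F}.

Lemma algintP (F : fieldType) (x : F) :
  reflect (integralOver (intr : int -> F) x) (x \in algint).
Proof. exact: asboolP. Qed.

Fact algint_subring (F : fieldType) : subring_closed (@algint F).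
Proof.
split=> [|x y /algintP Ax /algintP Ay|x y /algintP Ax /algintP Ay];
  apply/algintP; [exact: integral1 | exact: integral_sub | exact: integral_mul].
Qed.

HB.instance Definition _ (F : fieldType) :=
  GRing.isSubringClosed.Build F (@algint F) (@algint_subring F).

Lemma algint_int (F : fieldType) (a : int) : (a%:~R : F) \in algint.
Proof. exact: rpred_int. Qed.

Lemma algint_rmorph (F E : fieldType) (f : {rmorphism F -> E}) x :
  (f x \in algint) = (x \in algint).
Proof.
apply/algintP/algintP => [[p pm]|[p pm px]]; last first.
  exists p => //; rewrite -(eq_map_poly (fun a => rmorph_int f a)) map_poly_comp.
  by rewrite fmorph_root.
rewrite -(eq_map_poly (fun a => rmorph_int f a)) map_poly_comp fmorph_root.
by exists p.
Qed.

Lemma algint_root_monic (F : fieldType) (p : {poly F}) x :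
  p \is monic -> root p x -> p \is a polyOver algint -> x \in algint.
Proof.
move=> pm px /polyOverP Ap; apply/algintP; apply: (integral_root_monic pm px).
by move=> _ /(nthP 0)[i _ <-]; apply/algintP/Ap.
Qed.

Lemma algint_Aint (x : algC) : x \in algint -> x \in Aint.
Proof.
move=> /algintP[p pm px]; apply: (root_monic_Aint px).
  by rewrite monic_map.
by apply/polyOverP => i; rewrite coef_map /=.
Qed.

Lemma algint_rat (F : fieldType) (f : {rmorphism rat -> F}) (c : rat) :
  f c \in algint -> exists a : int, c = a%:~R.
Proof.
rewrite algint_rmorph -(algint_rmorph (ratr : rat -> algC)) => /algint_Aint Ac.
have /intrP[a Da] := Cint_rat_Aint (Crat_rat c) Ac.
exists a; apply: (fmorph_inj (ratr : {rmorphism rat -> algC})).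
by rewrite /= Da rmorph_int.
Qed.

(* The determinant trick. *)
Lemma algint_eigen (F : fieldType) n (s : 'I_n -> F) (a : 'M[F]_n) b :
    (exists i, s i != 0) -> (forall i j, a i j \in algint) ->
    (forall i, b * s i = \sum_j a i j * s j) ->
  b \in algint.
Proof.
move=> [i0 nz] Aa Db; apply: (@algint_root_monic _ (char_poly a^T)).
- exact: char_poly_monic.
- rewrite -eigenvalue_root_char; apply/eigenvalueP.
  exists (\row_i s i); last by apply/eqP=> /rowP/(_ i0); rewrite !mxE; apply/eqP.
  apply/rowP=> i; rewrite !mxE Db; apply: eq_bigr => j _.
  by rewrite !mxE mulrC.
- rewrite /char_poly /determinant rpred_sum // => u _.
  rewrite rpredM ?rpredX ?rpredN ?rpred1 //; apply: rpred_prod => i _.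
  rewrite !mxE rpredB ?polyOverC ?Aa // rpredMn // polyOverX //.
Qed.

(** The equation is primitive rather than monic: for every prime r some coefficient is then prime to
    r, which is what [exists_denominator] exploits. *)
Lemma ratpoly_primitive (F : fieldType) (f : {rmorphism rat -> F}) p x :
    p != 0 -> root (map_poly f p) x ->
  exists q : {poly int},
    [/\ zcontents q = 1, size q = size p & root (map_poly intr q) x].
Proof.
move=> nzp px; have [q [a nza Dp]] := rat_poly_scale p.
have nzq : q != 0.
  by apply: contraNneq nzp => q0; rewrite Dp q0 rmorph0 scaler0.
exists (zprimitive q); split.
- by rewrite zcontents_primitive nzq.
- rewrite size_zprimitive Dp size_scale ?invr_eq0 ?intr_eq0 //.
  by rewrite size_map_inj_poly //; apply: intr_inj.
- have D (c : int) : f c%:~R = c%:~R by rewrite rmorph_int.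
  have Df : injective (intr : int -> F).
    by move=> c d; rewrite -!D => /fmorph_inj/intr_inj.
  move: px; rewrite Dp map_polyZ rootZ ?fmorph_eq0 ?invr_eq0 ?intr_eq0 //.
  rewrite -map_poly_comp (eq_map_poly (D : f \o intr =1 intr)).
  rewrite {1}[q]zpolyEprim map_polyZ /= rootZ //.
  by apply: contra_neq (nzq) => h; apply/eqP; rewrite -zcontents_eq0; apply/eqP/Df.
Qed.

Lemma algC_primitive (x : algC) :
  exists q : {poly int}, zcontents q = 1 /\ root (map_poly intr q) x.
Proof.
have [p [Dp pm _]] := minCpolyP x.
have px : root (map_poly ratr p) x by rewrite -Dp root_minCpoly.
by have [q [? _ ?]] := ratpoly_primitive (monic_neq0 pm) px; exists q.
Qed.

(** The degree bound is uniform in x; it is what makes the values of a number field discrete in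
    [val_discrete]. *)
Lemma numfield_primitive (N : fieldExtType rat) (x : N) :
  exists q : {poly int},
    [/\ zcontents q = 1, (size q <= (\dim {:N}).+1)%N & root (map_poly intr q) x].
Proof.
have /polyOver1P[p Dp] := minPolyOver 1 x.
have nzp : p != 0.
  apply/eqP=> p0; have := monic_neq0 (monic_minPoly 1 x).
  by rewrite Dp p0 rmorph0 eqxx.
have px := etrans (congr1 (root^~ x) (esym Dp)) (root_minPoly 1 x).
have [q [? sq ?]] := ratpoly_primitive nzp px.
exists q; split=> //; rewrite sq -(size_map_poly (in_alg N)) -Dp size_minPoly.
rewrite ltnS /adjoin_degree /= dimv1 divn1 -ltnS (leq_trans _ (leqnn _)) //.
by rewrite prednK ?adim_gt0 // ltnS; apply/dimvS/subvf.
Qed.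

(* Each tail of an integral equation of x is an algebraic integer: it maps the
   lattice spanned by the 1, x, ..., x ^ (n - 1) into itself. *)
Lemma algint_drop_poly (F : fieldType) (q : {poly int}) (x : F) i :
  root (map_poly intr q) x -> (map_poly intr (drop_poly i q)).[x] \in algint.
Proof.
move=> qx; have [sq|lt_i] := leqP (size q) i.
  by rewrite drop_poly_eq0 // rmorph0 horner0 rpred0.
have [-> | i_gt0] := posnP i; first by rewrite drop_poly0l (rootP qx) rpred0.
pose n := (size q).-1; pose ev p := (map_poly intr p : {poly F}).[x].
(* As q vanishes at x, the tail times x^i is minus the part of q of degree below i. For j >= i this
   replaces a product of too large a degree. *)
pose R j := if (j < i)%N then drop_poly i q * 'X^j
  else - ('X^(j - i) * take_poly i q).
have sR (j : 'I_n) : (size (R j) <= n)%N.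
  rewrite /R; case: ltnP => ji.
    rewrite (leq_trans (size_polyMleq _ _)) // size_polyXn size_drop_poly /n.
    have bnd m l : (i < m -> l < i -> (m - i + l.+1).-1 <= m.-1)%N by lia.
    exact: bnd.
  rewrite size_polyN (leq_trans (size_polyMleq _ _)) // size_polyXn.
  have bnd m t l : (t <= i -> i <= l -> l < m -> ((l - i).+1 + t).-1 <= m)%N by lia.
  exact: bnd (size_take_poly i q) ji (ltn_ord j).
have evR (j : 'I_n) : ev (drop_poly i q) * x ^+ j = ev (R j).
  have evM p r : ev (p * r) = ev p * ev r by rewrite /ev rmorphM hornerM.
  have evX l : ev 'X^l = x ^+ l by rewrite /ev map_polyXn hornerXn.
  rewrite /R; case: ltnP => ji; first by rewrite evM evX.
  have Dq : ev (take_poly i q) = - (ev (drop_poly i q) * x ^+ i).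
    apply/eqP; rewrite -addr_eq0 -evX -evM /ev -hornerD -rmorphD /=.
    by rewrite poly_take_drop (rootP qx).
  rewrite {2}/ev rmorphN hornerN -/(ev _) evM evX Dq mulrN opprK.
  by rewrite mulrCA -exprD subnK.
have n_gt0 : (0 < n)%N by rewrite /n; lia.
apply: (@algint_eigen _ n (fun j => x ^+ j)
  (\matrix_(j, k) ((R j)`_k)%:~R)) => [|j k|j].
- by exists (Ordinal n_gt0); rewrite /= expr0 oner_neq0.
- by rewrite mxE algint_int.
rewrite -/(ev _) evR /ev (@horner_coef_wide _ n); last first.
  by rewrite (leq_trans (size_poly _ _)).
by apply: eq_bigr => k _; rewrite mxE coef_map.
Qed.

(** * Prime ideals *)

Lemma int_ringP (N : splittingFieldType rat) (K : {subfield N}) x :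
  int_ring K x <-> x \in K /\ x \in algint.
Proof. by split=> -[Kx /algintP Ax]. Qed.

Lemma nat_pigeonhole (T : finType) (f : nat -> T) :
  exists i j, (i < j)%N /\ f i = f j.
Proof.
case: (pickP [pred u : 'I_#|T|.+1 * 'I_#|T|.+1 | (u.1 < u.2)%N && (f u.1 == f u.2)]).
  by case=> i j /andP[/= lt_ij /eqP fij]; exists i, j.
move=> no; suff inj : injective (fun i : 'I_#|T|.+1 => f i).
  by have := leq_card _ inj; rewrite card_ord ltnn.
have neq (i j : 'I_#|T|.+1) : f i = f j -> (i < j)%N = false.
  by move=> fij; have /negbT := no (i, j); rewrite negb_and fij eqxx orbF => /negPf.
move=> i j fij; apply/ord_inj/eqP; rewrite eqn_leq.
by apply/andP; split; rewrite leqNgt neq.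
Qed.

(* Z[x] modulo r is finite, so the iterates of Frobenius repeat. *)
Lemma frobenius_recurrence (F : fieldType) r (x : F) :
    prime r -> x \in algint ->
  exists i j (R : {poly int}),
    (i < j)%N /\ x ^+ (r ^ i) - x ^+ (r ^ j) = r%:R * (map_poly intr R).[x].
Proof.
move=> pr_r /algintP[q mq qx].
pose S i := Pdiv.Ring.rmodp 'X^(r ^ i) q; pose d := size q.
have sS i : (size (S i) < d)%N by rewrite Pdiv.Ring.ltn_rmodpN0 ?monic_neq0.
have Sx i : (map_poly intr (S i)).[x] = x ^+ (r ^ i).
  rewrite -hornerXn -(map_polyXn intr) (Pdiv.RingMonic.rdivp_eq mq 'X^(r ^ i)).
  by rewrite rmorphD rmorphM hornerD hornerM (rootP qx) mulr0 add0r.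
have r_gt0 := prime_gt0 pr_r.
pose f i := [ffun l : 'I_d => Ordinal (ltn_pmod `|((S i)`_l %% r%:Z)%Z|%N r_gt0)].
have [i [j [lt_ij fij]]] := nat_pigeonhole f.
pose R : {poly int} := map_poly (divz^~ r%:Z) (S i - S j).
exists i, j, R; split=> //.
rewrite -!Sx -hornerN -hornerD -rmorphN -rmorphD /=.
have -> : S i - S j = r%:Z *: R.
  apply/polyP=> l; rewrite coefZ /R coef_map_id0 ?div0z //.
  suff: (r%:Z %| (S i - S j)`_l)%Z by move/divzK => {1}<-; rewrite mulrC.
  have [ld|dl] := ltnP l d; last first.
    rewrite coefB !nth_default ?subr0 ?dvdz0 //.
      exact: leq_trans (ltnW (sS _)) dl.
    exact: leq_trans (ltnW (sS _)) dl.
  move/ffunP: fij => /(_ (Ordinal ld)); rewrite !ffunE /= => /(congr1 val) /=.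
  have small (a : int) : (`|(a %% r%:Z)%Z| %% r)%N%:Z = (a %% r%:Z)%Z.
    have a_ge0 : 0 <= (a %% r%:Z)%Z by rewrite modz_ge0 //; lia.
    have lt_ar : (a %% r%:Z)%Z < r%:Z by rewrite ltz_pmod //; lia.
    rewrite modn_small ?gez0_abs //.
    by rewrite -ltz_nat gez0_abs.
  move/(congr1 Posz); rewrite !small coefB => h.
  by rewrite -eqz_mod_dvd; apply/eqP.
by rewrite map_polyZ hornerZ.
Qed.

Lemma prime_bezout r (c : int) : prime r -> ~~ (r%:Z %| c)%Z ->
  exists u v, u * c + v * r%:Z = 1.
Proof.
move=> pr_r nrc; have : coprimez c r by rewrite coprimez_sym coprimezE prime_coprime.
by case/coprimezP=> -[u v] /= <-; exists u, v.
Qed.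

Lemma numfield_natr_eq0 (N : fieldExtType rat) n : (n%:R == 0 :> N) = (n == 0)%N.
Proof. by rewrite -(rmorph_nat (in_alg N)) fmorph_eq0 pnatr_eq0. Qed.

(* A local ring of algebraic integers at a prime P is a valuation ring: the
   denominator b of x can be chosen so that b and b x are not both in P. *)
Lemma exists_denominator (F : fieldType) (P : set F) r (q : {poly int}) x :
    prime r -> P 0 -> (forall y z, P y -> P z -> P (y - z)) ->
    (forall c : int, P c%:~R -> (r%:Z %| c)%Z) ->
    zcontents q = 1 -> root (map_poly intr q) x ->
  exists p1 p2 : {poly int}, let b := (map_poly intr p1).[x] in
    [/\ b \in algint, b * x \in algint, b * x = (map_poly intr p2).[x]
      & ~ (P b /\ P (b * x))].
Proof.
move=> pr_r P0 PB Pint cq qx.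
have tailE i : (map_poly intr (drop_poly i.+1 q)).[x] * x =
    (map_poly intr (drop_poly i q - (q`_i)%:P)).[x].
  rewrite -hornerMX -{1}(map_polyX intr) -rmorphM; congr (map_poly _ _).[_].
  apply/polyP=> -[|l]; rewrite coefMX coefB coefC !coef_drop_poly /= ?subrr //.
  by rewrite addnS subr0.
suff [i ni] : exists i, let b := (map_poly intr (drop_poly i.+1 q)).[x] in
    ~ (P b /\ P (b * x)).
  exists (drop_poly i.+1 q), (drop_poly i q - (q`_i)%:P); split=> //.
    exact: algint_drop_poly.
  rewrite tailE rmorphB hornerD hornerN /= map_polyC hornerC.
  by rewrite rpredB ?algint_int //; apply: algint_drop_poly.
(* If every tail and its product with x were in P, so would be each coefficient of q, a difference
   of two such terms, and r would divide the content of q. *)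
apply: contrapT => no.
have Ptail i : P (map_poly intr (drop_poly i q)).[x].
  case: i => [|i]; first by rewrite drop_poly0l (rootP qx).
  by apply: contrapT => nP; apply: no; exists i => /= -[].
suff : (r%:Z %| zcontents q)%Z.
  by rewrite cq dvdzE /= dvdn1 => /eqP r1; rewrite r1 in pr_r.
rewrite dvdz_contents; apply/polyOverP => i; apply: Pint.
have -> : (q`_i)%:~R = (map_poly intr (drop_poly i q)).[x]
    - (map_poly intr (drop_poly i.+1 q)).[x] * x.
  rewrite tailE rmorphB hornerD hornerN /= map_polyC hornerC opprB addrC.
  by rewrite subrK.
apply: PB => //; apply: contrapT => nP; apply: no; exists i => /= -[_].
exact: nP.
Qed.

Section PrimeIdeal.
Variables (N : splittingFieldType rat) (K : {subfield N}) (P : set N).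
Hypothesis hP : prime_of K P.

Let P_sub x : P x -> int_ring K x. Proof. by case: hP => -[h _ _ _] _ _ _; exact: h. Qed.
Let P0 : P 0. Proof. by case: hP => -[]. Qed.
Let PD x y : P x -> P y -> P (x + y). Proof. by case: hP => -[_ _ h _] _ _ _; exact: h. Qed.
Let PM a x : int_ring K a -> P x -> P (a * x).
Proof. by case: hP => -[_ _ _ h] _ _ _; exact: h. Qed.
Let P1 : ~ P 1. Proof. by case: hP. Qed.
Let Pprime x y : int_ring K x -> int_ring K y -> P (x * y) -> P x \/ P y.
Proof. by case: hP => _ _ _ h; exact: h. Qed.

Lemma int_ring_int (a : int) : int_ring K a%:~R.
Proof. by apply/int_ringP; rewrite rpred_int algint_int. Qed.

Lemma int_ringB x y : int_ring K x -> int_ring K y -> int_ring K (x - y).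
Proof.
by move=> /int_ringP[Kx Ax] /int_ringP[Ky Ay]; apply/int_ringP; rewrite !rpredB.
Qed.

Lemma int_ringD x y : int_ring K x -> int_ring K y -> int_ring K (x + y).
Proof.
by move=> /int_ringP[Kx Ax] /int_ringP[Ky Ay]; apply/int_ringP; rewrite !rpredD.
Qed.

Lemma int_ringM x y : int_ring K x -> int_ring K y -> int_ring K (x * y).
Proof.
by move=> /int_ringP[Kx Ax] /int_ringP[Ky Ay]; apply/int_ringP; rewrite !rpredM.
Qed.

Lemma int_ring_poly (q : {poly int}) x :
  int_ring K x -> int_ring K (map_poly intr q).[x].
Proof.
move=> Ox; rewrite horner_coef.
elim/big_ind: _ => [|y z|i _]; [exact: int_ring_int 0 | exact: int_ringD |].
rewrite coef_map; apply: int_ringM; first exact: int_ring_int.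
elim: (nat_of_ord i) => [|n IHn]; first exact: int_ring_int 1.
by rewrite exprS; apply: int_ringM.
Qed.

Lemma prime_idealN x : P x -> P (- x).
Proof. by move=> Px; rewrite -mulN1r; apply: PM => //; apply: int_ring_int (-1). Qed.

(** A nonzero element of P divides the constant term of its integral equation, once the factors X
    have been removed. *)
Lemma prime_ideal_int_gt0 : exists n, (0 < n)%N /\ P n%:R.
Proof.
have [x [Px nzx]] : exists x, P x /\ x != 0.
  apply: contrapT => no; case: hP => _ [_ nP0] _ _; apply: nP0.
  apply/seteqP; split=> [x Px|_ -> //]; apply: contrapT => nx.
  by apply: no; exists x; split=> //; apply/eqP.
have /int_ringP[Kx /algintP[q mq qx]] := P_sub Px.
suff [c [nzc Pc]] : exists c : int, c != 0 /\ P c%:~R.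
  exists `|c|%N; rewrite absz_gt0; split=> //.
  case: c Pc {nzc} => n //= /prime_idealN.
  by rewrite NegzE mulrNz opprK -pmulrn.
have [m] := ubnP (size q); elim: m => // m IHm in q mq qx *; move=> sq.
have Dq : q = drop_poly 1 q * 'X + (q`_0)%:P.
  apply/polyP=> -[|i]; rewrite coefD coefMX coefC /= ?add0r //.
  by rewrite coef_drop_poly addn1 addr0.
have [q0|nzq0] := eqVneq q`_0 0; last first.
  exists q`_0; split=> //.
  have -> : (q`_0)%:~R = - ((map_poly intr (drop_poly 1 q)).[x] * x).
    apply/eqP; rewrite -subr_eq0 opprK addrC; move: qx; rewrite {1}Dq /root.
    by rewrite rmorphD rmorphM /= map_polyX map_polyC hornerMXaddC.
  by apply/prime_idealN/PM => //; apply/int_ring_poly/P_sub.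
move: Dq; rewrite q0 addr0 => Dq.
have mq' : drop_poly 1 q \is monic by rewrite -(monicMr _ (monicX _)) -Dq.
move: (drop_poly 1 q) Dq mq' => q' Dq mq'; apply: (IHm _ mq').
  by move: qx; rewrite Dq rmorphM /= map_polyX rootM rootX (negPf nzx) orbF.
by move: sq; rewrite Dq size_mulX ?monic_neq0.
Qed.

Lemma prime_ideal_char : exists r, prime r /\ P r%:R.
Proof.
have [n [n_gt0 Pn]] := prime_ideal_int_gt0.
have [m] := ubnP n; elim: m => // m IHm in n n_gt0 Pn *; rewrite ltnS => le_nm.
have n_gt1 : (1 < n)%N by rewrite ltn_neqAle n_gt0 andbT; apply: contraPneq Pn => <-.
have [pr_n|np_n] := boolP (prime n); first by exists n.
have Dn := divnK (pdiv_dvd n).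
have := Pn; rewrite -Dn natrM => /Pprime[].
- exact: int_ring_int (_ %/ _)%N.
- exact: int_ring_int (pdiv n).
- move=> Pd; apply: (IHm _ _ Pd).
    by rewrite divn_gt0 ?pdiv_gt0 // dvdn_leq ?pdiv_dvd.
  by rewrite (leq_trans _ le_nm) // ltn_Pdiv // prime_gt1 ?pdiv_prime.
- by exists (pdiv n); rewrite pdiv_prime.
Qed.

Variable r : nat.
Hypotheses (pr_r : prime r) (Pr : P r%:R).

Lemma prime_ideal_int (c : int) : P c%:~R -> (r%:Z %| c)%Z.
Proof.
move=> Pc; apply: contrapT => /negP /(prime_bezout pr_r)[u [v Duv]]; apply: P1.
rewrite -[1]/(1%:~R) -Duv rmorphD !rmorphM /=; apply: PD; apply: PM => //;
  exact: int_ring_int.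
Qed.

(** The recurrence of Frobenius puts x^(r^i) (1 - x^(r^j - r^i)) in P, so x is inverted modulo P by
    one of its own powers. *)
Lemma prime_ideal_max x :
  int_ring K x -> ~ P x -> exists2 y, int_ring K y & P (1 - y * x).
Proof.
move=> Ox nPx; have [_ Ax] := (int_ringP K x).1 Ox.
have [i [j [R [lt_ij DR]]]] := frobenius_recurrence pr_r Ax.
have lt_r : (r ^ i < r ^ j)%N by rewrite ltn_exp2l ?prime_gt1.
have OX n : int_ring K (x ^+ n).
  by rewrite -hornerXn -(map_polyXn intr); apply: int_ring_poly.
have nPX n : ~ P (x ^+ n).
  by elim: n => [|n IHn] //; rewrite exprS => /Pprime[].
exists (x ^+ (r ^ j - r ^ i).-1) => //.
have := PM (int_ring_poly R Ox) Pr; rewrite mulrC -DR -exprSr prednK ?subn_gt0 //.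
rewrite -{1}(subnKC (ltnW lt_r)) exprD -{1}[x ^+ (r ^ i)]mulr1 -mulrBr.
case/Pprime => //; last by move/nPX.
by apply: int_ringB => //; apply: int_ring_int 1.
Qed.

(* The prime is generated by r and lifts of a basis of its image in the space
   of algebraic integers modulo r, whose dimension is at most that of N. *)
Lemma prime_ideal_fg : exists n (s : 'I_n -> N), (forall i, P (s i)) /\
  forall x, P x -> exists2 a : 'I_n -> N,
    forall i, int_ring K (a i) & x = \sum_i a i * s i.
Proof.
pose indep n (s : 'I_n -> N) := (forall i, P (s i)) /\ forall c : 'I_n -> int,
  (exists2 y, y \in algint & \sum_i (c i)%:~R * s i = r%:R * y) ->
  forall i, (r%:Z %| c i)%Z.
have ex0 : exists n, `[< exists s : 'I_n -> N, indep n s >].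
  by exists 0%N; apply/asboolP; exists (fun=> 0); split=> [[]|? _ []].
(* A linear relation over the rationals can be scaled to integral coefficients of content 1, and is
   then a nontrivial relation modulo r. *)
have bnd n : `[< exists s : 'I_n -> N, indep n s >] -> (n <= \dim {:N})%N.
  move=> /asboolP[s [_ si]]; rewrite leqNgt; apply/negP => lt_dn.
  have : ~~ free [tuple s i | i < n].
    apply: contraTN lt_dn => fs; rewrite -leqNgt.
    by move: fs; rewrite /free size_tuple => /eqP <-; apply/dimvS/subvf.
  case/negP; apply/freeP => k Dk.
  pose p := \poly_(i < n) (if insub i is Some j then k j else 0).
  have pE (i : 'I_n) : p`_i = k i by rewrite coef_poly ltn_ord valK.
  have [p0|nzp] := eqVneq p 0; first by move=> i; rewrite -pE p0 coef0.
  have [q [a nza Dp]] := rat_poly_scale p.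
  have nzq : q != 0.
    by apply: contraNneq nzp => q0; rewrite Dp q0 rmorph0 scaler0.
  have nzc : (zcontents q)%:~R != 0 :> rat by rewrite intr_eq0 zcontents_eq0.
  pose c (i : 'I_n) := (zprimitive q)`_i.
  have /si rc : exists2 y, y \in algint & \sum_i (c i)%:~R * s i = r%:R * y.
    exists 0; rewrite ?rpred0 // mulr0.
    have : (zcontents q)%:~R / a%:~R *: \sum_i (c i)%:~R * s i = 0.
      rewrite -[RHS]Dk scaler_sumr; apply: eq_bigr => i _.
      rewrite (nth_map i) ?size_enum_ord // nth_ord_enum -pE Dp coefZ coef_map.
      rewrite {2}[q]zpolyEprim coefZ -/(c i) /= (intrM _ (zcontents q)).
       rewrite [_ * s i]mulrzl -[s i *~ _]scaler_int scalerA.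
      by congr (_ *: _); ring.
    by move/eqP; rewrite scaler_eq0 mulf_eq0 (negPf nzc) invr_eq0 intr_eq0 (negPf nza) => /eqP.
  suff : (r%:Z %| zcontents (zprimitive q))%Z.
    rewrite zcontents_primitive nzq dvdzE /= dvdn1 => /eqP r1.
    by move: (pr_r); rewrite r1.
  rewrite dvdz_contents; apply/polyOverP => i; have [lt_in|le_ni] := ltnP i n.
    exact: rc (Ordinal lt_in).
  rewrite nth_default ?dvdz0 // size_zprimitive (leq_trans _ le_ni) //.
  rewrite (leq_trans _ (size_poly n (fun i => if insub i is Some j then k j else 0))) //.
  rewrite -/p Dp size_scale ?invr_eq0 ?intr_eq0 //.
  by rewrite size_map_inj_poly //; apply: intr_inj.
case: (ex_maxnP ex0 bnd) => n /asboolP[s [Ps si]] max_n.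
exists n.+1, (fun i => oapp s r%:R (unlift ord0 i)); split=> [i|x Px].
  by case: unliftP => [j _|_]; [apply: Ps | apply: Pr].
have : ~ indep n.+1 (fun i => oapp s x (unlift ord0 i)).
  move=> h; have := max_n n.+1; rewrite ltnn => /(_ _)/negP; case=> //.
  by apply/asboolP; exists (fun i => oapp s x (unlift ord0 i)).
move=> ndep; have [c [[y Ay Dy] [i nri]]] : exists c : 'I_n.+1 -> int,
    (exists2 y, y \in algint &
      \sum_i (c i)%:~R * oapp s x (unlift ord0 i) = r%:R * y)
    /\ exists i, ~~ (r%:Z %| c i)%Z.
  apply: contrapT => no; apply: ndep; split=> [i|c hc i].
      by case: unliftP => [j _|_]; [apply: Ps | apply: Px].
  by apply: contrapT => /negP ni; apply: no; exists c; split=> //; exists i.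
move: Dy; rewrite big_ord_recl unlift_none /=.
under eq_bigr => j _ do rewrite liftK /=.
move=> Dy.
have nr0 : ~~ (r%:Z %| c ord0)%Z.
  apply/negP=> /dvdzP[c' Dc']; move: nri; case: (unliftP ord0 i) => [j ->|->];
    last by rewrite Dc' dvdz_mull.
  apply/negP; rewrite negbK; apply: (si (fun j => c (lift ord0 j))).
  exists (y - c'%:~R * x).
    have [_ Ax] := (int_ringP K x).1 (P_sub Px).
    by rewrite rpredB ?rpredM ?algint_int.
  rewrite mulrBr -Dy Dc' rmorphM /= -pmulrn mulrA [r%:R * _]mulrC.
  by rewrite addrC addKr.
(* The coefficient of x is invertible modulo r, so x is a combination of the s plus z r, where z is
   an algebraic integer; z lies in K because z r does. *)
have [u [v Duv]] := prime_bezout pr_r nr0.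
pose z := u%:~R * y + v%:~R * x.
have Dx : x = z * r%:R + \sum_j (- (u * c (lift ord0 j))%:~R) * s j.
  have -> : \sum_j (- (u * c (lift ord0 j))%:~R) * s j
      = - (u%:~R * (r%:R * y - (c ord0)%:~R * x)).
    rewrite -Dy addrC addKr mulr_sumr -sumrN; apply: eq_bigr => j _.
    by rewrite intrM mulNr mulrA.
  have : (u * c ord0 + v * r%:Z)%:~R * x = x by rewrite Duv mul1r.
  by rewrite intrD !intrM -pmulrn /z => {1}<-; ring.
exists (fun i => oapp (fun j => - (u * c (lift ord0 j))%:~R) z (unlift ord0 i)).
  move=> j; case: unliftP => [j' _|_] /=.
    by rewrite -rmorphN; apply: int_ring_int.
  have [Kx Ax] := (int_ringP K x).1 (P_sub Px).
  apply/int_ringP; split; last by rewrite rpredD // rpredM ?algint_int.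
  have nzr : r%:R != 0 :> N by rewrite numfield_natr_eq0 -lt0n prime_gt0.
  rewrite -[z](mulfK nzr) rpred_div ?rpred_nat //.
  have -> : z * r%:R = x - \sum_j (- (u * c (lift ord0 j))%:~R) * s j.
    by rewrite {1}Dx addrK.
  rewrite rpredB // rpred_sum // => j' _; rewrite rpredM ?rpredN ?rpred_int //.
  by have [] := (int_ringP K _).1 (P_sub (Ps j')).
rewrite big_ord_recl unlift_none /= [LHS]Dx; congr (_ + _).
by apply: eq_bigr => j _; rewrite liftK.
Qed.

End PrimeIdeal.

Section LinComb.
Variables (S T : Type) (V : nmodType) (op : S -> T -> V).
Implicit Types (A : set S) (B : set T) (C : set V).

Lemma lincomb_mem A B a b : A a -> B b -> lincomb op A B (op a b).
Proof.
by move=> Aa Bb; exists 1%N, (fun=> a), (fun=> b); split=> //; rewrite big_ord1.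
Qed.

Lemma lincomb0 A B : lincomb op A B 0.
Proof.
have no (U : Type) (i : 'I_0) : U by case: i.
by exists 0%N, (no S), (no T); split=> [[]|[]|] //; rewrite big_ord0.
Qed.

Lemma lincombD A B x y :
  lincomb op A B x -> lincomb op A B y -> lincomb op A B (x + y).
Proof.
move=> [n [a [b [Aa Bb ->]]]] [m [c [d [Ac Bd ->]]]].
exists (n + m)%N, (fun i => match split i with inl j => a j | inr j => c j end).
exists (fun i => match split i with inl j => b j | inr j => d j end).
split=> [i|i|]; [by case: split | by case: split |].
rewrite big_split_ord; congr (_ + _); apply: eq_bigr => i _.
  by rewrite (unsplitK (inl i)).
by rewrite (unsplitK (inr i)).
Qed.

Lemma lincomb_ind A B C : C 0 -> (forall x y, C x -> C y -> C (x + y)) ->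
  (forall a b, A a -> B b -> C (op a b)) -> lincomb op A B `<=` C.
Proof. by move=> C0 CD Cop _ [n [a [b [Aa Bb ->]]]]; elim/big_ind: _ => // i _; apply: Cop. Qed.

End LinComb.

Lemma lincombP_sum (S T : Type) (V : nmodType) (op : S -> T -> V) A B
    n (a : 'I_n -> S) (b : 'I_n -> T) :
  (forall i, A (a i)) -> (forall i, B (b i)) ->
  lincomb op A B (\sum_i op (a i) (b i)).
Proof. by exists n, a, b. Qed.

Lemma ideal_mulA (N : splittingFieldType rat) (I J M : set N) :
  ideal_mul I (ideal_mul J M) = ideal_mul (ideal_mul I J) M.
Proof.
apply/seteqP; split; apply: lincomb_ind; do ?[exact: lincomb0 | exact: lincombD].
  move=> a b Ia [n [c [d [Jc Md ->]]]]; rewrite mulr_sumr.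
  elim/big_ind: _ => [||i _]; [exact: lincomb0 | by move=> *; apply: lincombD |].
  by rewrite mulrA; apply: lincomb_mem => //; apply: lincomb_mem.
move=> a b [n [c [d [Jc Md ->]]]] Mb; rewrite mulr_suml.
elim/big_ind: _ => [||i _]; [exact: lincomb0 | by move=> *; apply: lincombD |].
by rewrite -mulrA; apply: lincomb_mem => //; apply: lincomb_mem.
Qed.

(** * Invertibility of the prime ideals of a number field *)

Section PrimeIdealInverse.
Variables (N : splittingFieldType rat) (K : {subfield N}) (P : set N).
Hypothesis hP : prime_of K P.

Let P_sub x : P x -> int_ring K x.
Proof. by case: hP => -[h _ _ _] _ _ _; exact: h. Qed.
Let P0 : P 0. Proof. by case: hP => -[]. Qed.
Let PD x y : P x -> P y -> P (x + y).
Proof. by case: hP => -[_ _ h _] _ _ _; exact: h. Qed.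
Let PM a x : int_ring K a -> P x -> P (a * x).
Proof. by case: hP => -[_ _ _ h] _ _ _; exact: h. Qed.
Let P1 : ~ P 1. Proof. by case: hP. Qed.
Let Pprime x y : int_ring K x -> int_ring K y -> P (x * y) -> P x \/ P y.
Proof. by case: hP => _ _ _ h; exact: h. Qed.

(** The local ring at P is a valuation ring; the statement speaks of denominators b outside P, so
    that no localisation is constructed. *)
Lemma local_ring_total x : x \in K -> exists b,
  [/\ int_ring K b, ~ P b &
    int_ring K (b * x) \/ x != 0 /\ int_ring K (b / x)].
Proof.
move=> Kx; have [r [pr_r Pr]] := prime_ideal_char hP.
have [q [cq _ qx]] := numfield_primitive x.
have PB y z : P y -> P z -> P (y - z) by move=> Py /(prime_idealN hP); apply: PD.
have [p1 [p2 /= [Ab Abx Dbx nb]]] :=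
  exists_denominator pr_r P0 PB (prime_ideal_int hP pr_r Pr) cq qx.
set b := _.[x] in Ab Abx Dbx nb.
have KZ p : (map_poly intr p).[x] \in K.
  by rewrite rpred_horner //; apply/polyOverP=> i; rewrite coef_map rpred_int.
have Ob : int_ring K b by apply/int_ringP; rewrite KZ.
have Obx : int_ring K (b * x) by apply/int_ringP; rewrite Abx rpredM ?KZ.
have [Pb|nPb] := pselect (P b); last by exists b; split=> //; left.
have nPbx : ~ P (b * x) by move=> Pbx; apply: nb.
have nzx : x != 0 by apply: contra_notN nPbx => /eqP ->; rewrite mulr0.
by exists (b * x); split=> //; right; rewrite mulfK.
Qed.

Definition ideal_inv : set N :=
  [set y | y \in K /\ forall x, P x -> int_ring K (y * x)].

(* P becomes principal in the local ring at P, which is a valuation ring, since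
   P is finitely generated. *)
Lemma exists_ideal_inv : exists y, ideal_inv y /\ exists2 x, P x & ~ P (y * x).
Proof.
have [r [pr_r Pr]] := prime_ideal_char hP.
have nzr : r%:R != 0 :> N by rewrite numfield_natr_eq0 -lt0n prime_gt0.
have [n [s [Ps Pfg]]] := prime_ideal_fg hP pr_r Pr.
(* p is a local generator of P, an element of least value among the given generators, and b is a
   common denominator of their quotients by p. *)
suff [p [b [nzp Pp Ob nPb bs]]] : exists p b, [/\ p != 0, P p, int_ring K b,
    ~ P b & forall x, x \in codom s -> int_ring K (b * x / p)].
  exists (b / p); split; last by exists p => //; rewrite divfK.
  split=> [|x /Pfg[a Oa ->]].
    by rewrite rpred_div //; [case: Ob | case: (P_sub Pp)].
  rewrite mulr_sumr; elim/big_ind: _ => [|y z|i _].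
  - exact: (int_ring_int K 0).
  - exact: int_ringD.
  - by rewrite mulrCA mulrAC; apply: int_ringM => //; apply/bs/codom_f.
have Pcodom x : x \in codom s -> P x by move=> /codomP[i ->].
elim: (codom s) Pcodom => [_|x t IHt Pt].
  by exists r%:R, 1; split=> //; apply: int_ring_int K 1.
have [|p [b [nzp Pp Ob nPb bt]]] := IHt.
  by move=> y ty; apply: Pt; rewrite inE ty orbT.
have Px : P x by apply: Pt; rewrite inE eqxx.
have Kxp : x / p \in K by rewrite rpred_div //; [case: (P_sub Px) | case: (P_sub Pp)].
have [c [Oc nPc [Ocx|[nzxp Ocx]]]] := local_ring_total Kxp.
  exists p, (c * b); split=> // [||y]; first exact: int_ringM.
    by case/Pprime.
  rewrite inE => /predU1P[->|ty].
    by rewrite -mulrA mulrAC; apply: int_ringM.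
  by rewrite -!mulrA; apply: int_ringM; rewrite // mulrA; apply: bt.
have nzx : x != 0 by apply: contraNneq nzxp => ->; rewrite mul0r.
exists x, (c * b); split=> // [||y]; first exact: int_ringM.
  by case/Pprime.
rewrite inE => /predU1P[->|ty]; first by rewrite mulfK //; apply: int_ringM.
have -> : c * b * y / x = c / (x / p) * (b * y / p) by field; rewrite nzx nzp.
by apply: int_ringM => //; apply: bt.
Qed.

(** P times its inverse contains 1: the integer y x0 is outside P, hence has an inverse z modulo P,
    and 1 is the sum of 1 - z y x0 and x0 (y z). So to be contained in P is to be divisible by P. *)
Lemma ideal_divE (I : set N) : is_ideal K I -> I `<=` P ->
  let J := ideal_mul ideal_inv I in is_ideal K J /\ I = ideal_mul P J.
Proof.
move=> [IO I0 ID IM] IP J.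
have [y [[Ky yP] [x0 Px0 nPyx]]] := exists_ideal_inv.
have [r [pr_r Pr]] := prime_ideal_char hP.
have [z Oz Pz] := prime_ideal_max hP pr_r Pr (yP _ Px0) nPyx.
split.
  split; [|exact: lincomb0|exact: lincombD|].
  - apply: lincomb_ind; [exact: (int_ring_int K 0)|exact: int_ringD|].
    by move=> a b [_ aP] /IP; apply: aP.
  - move=> a _ Oa [n [c [d [Jc Id ->]]]]; rewrite mulr_sumr.
    elim/big_ind: _ => [||i _]; [exact: lincomb0 | by move=> *; apply: lincombD |].
    by rewrite mulrCA; apply: lincomb_mem => //; apply: IM.
have inv1 : ideal_inv 1 by split=> [|u /P_sub]; rewrite ?rpred1 ?mul1r.
apply/seteqP; split=> [x Ix|].
  have -> : x = (1 - z * (y * x0)) * (1 * x) + x0 * (y * (z * x)) by ring.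
  apply: lincombD; apply: lincomb_mem => //; apply: lincomb_mem => //.
  exact: IM.
apply: lincomb_ind => // a _ Pa [n [c [d [Jc Id ->]]]]; rewrite mulr_sumr.
elim/big_ind: _ => // i _; rewrite mulrA [a * _]mulrC; apply: IM => //.
by case: (Jc i) => _; apply.
Qed.

End PrimeIdealInverse.

(** * Primes of the ring of all algebraic integers *)

Section PrimeAbove.
Variables (N : splittingFieldType rat) (K : {subfield N}) (P : set N).
Variable iota : {rmorphism N -> algC}.
Hypothesis hP : prime_of K P.

Let P_sub x : P x -> int_ring K x.
Proof. by case: hP => -[h _ _ _] _ _ _; exact: h. Qed.
Let P0 : P 0. Proof. by case: hP => -[]. Qed.
Let PM a x : int_ring K a -> P x -> P (a * x).
Proof. by case: hP => -[_ _ _ h] _ _ _; exact: h. Qed.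
Let P1 : ~ P 1. Proof. by case: hP. Qed.
Let Pprime x y : int_ring K x -> int_ring K y -> P (x * y) -> P x \/ P y.
Proof. by case: hP => _ _ _ h; exact: h. Qed.

Lemma int_ring_algint x : int_ring K x -> iota x \in algint.
Proof. by move=> /int_ringP[_]; rewrite algint_rmorph. Qed.

Let above (X : set algC) : Prop :=
  [/\ X `<=` algint, forall x y, X x -> X y -> X (x + y),
      forall a x, a \in algint -> X x -> X (a * x),
      iota @` P `<=` X & forall x, int_ring K x -> X (iota x) -> P x].

(** If x in O_K were in the extended ideal but not in P, then y x would be integral for y in the
    inverse of P; so x (y x0) = (y x) x0 would lie in P, although neither x nor y x0 does. *)
Let above_ext : above (lincomb *%R (iota @` P) algint).
Proof.
have [y [[Ky yP] [x0 Px0 nPyx]]] := exists_ideal_inv hP.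
split.
- apply: lincomb_ind => [|x z|_ a [x Px <-] Aa]; [exact: rpred0 | exact: rpredD |].
  by apply: rpredM => //; apply/int_ring_algint/P_sub.
- exact: lincombD.
- move=> a _ Aa [n [c [d [Jc Id ->]]]]; rewrite mulr_sumr.
  elim/big_ind: _ => [||i _]; [exact: lincomb0 | by move=> *; apply: lincombD |].
  by rewrite mulrCA; apply: lincomb_mem => //; apply: rpredM => //; apply: Id.
- move=> _ [x Px <-]; rewrite -[iota x]mulr1; apply: lincomb_mem; last exact: rpred1.
  by exists x.
move=> x Ox Jx; apply: contrapT => nPx.
have Oyx : int_ring K (y * x).
  apply/int_ringP; split; first by rewrite rpredM //; case: Ox.
  rewrite -(algint_rmorph iota) rmorphM /=.
  case: Jx => [n [c [d [Jc Id ->]]]]; rewrite mulr_sumr.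
  apply: rpred_sum => i _; rewrite mulrA; apply: rpredM; last exact: Id.
  by have [u Pu <-] := Jc i; rewrite -rmorphM; apply/int_ring_algint/yP.
suff [] : P x \/ P (y * x0) by [].
apply: Pprime => //; first exact: yP.
by rewrite mulrCA mulrA; apply: PM.
Qed.

(** An ideal maximal among those that meet O_K in P is prime: adding x or y from outside produces
    elements s and t of O_K outside P, and s t would be in the ideal if x y were. *)
Lemma exists_prime_above : exists J : set algC, above J /\
  forall x y, x \in algint -> y \in algint -> J (x * y) -> J x \/ J y.
Proof.
have [F Fsub Ftot|A [A_ok Amax]] :=
  @Zorn_bigcup _ [set X : set algC | X = set0 \/ above X].
  have [F0|nF0] := pselect (forall X, F X -> X = set0).
    by left; apply/seteqP; split=> // x [X /F0->].
  have [X0 [FX0 aX0]] : exists X, F X /\ above X.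
    apply: contrapT => no; apply: nF0 => X FX.
    by have [//|aX] := Fsub _ FX; case: no; exists X.
  have aF X x : F X -> X x -> above X.
    by move=> FX Xx; have [X_0|//] := Fsub _ FX; rewrite X_0 in Xx.
  right; split.
  - by move=> x [X FX Xx]; have [h _ _ _ _] := aF _ _ FX Xx; apply: h.
  - move=> x y [X FX Xx] [Y FY Yy].
    have [_ XD _ _ _] := aF _ _ FX Xx; have [_ YD _ _ _] := aF _ _ FY Yy.
    have [XY|YX] := Ftot _ _ FX FY; first by exists Y => //; apply: YD => //; apply: XY.
    by exists X => //; apply: XD => //; apply: YX.
  - move=> a x Aa [X FX Xx]; have [_ _ h _ _] := aF _ _ FX Xx.
    by exists X => //; apply: h.
  - by move=> x Px; exists X0 => //; case: aX0 => _ _ _ h _; apply: h.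
  - by move=> x Ox [X FX Xx]; have [_ _ _ _ h] := aF _ _ FX Xx; apply: h.
have aA : above A.
  case: A_ok Amax => // -> Amax; have := above_ext.
  set B := lincomb _ _ _ => aB; case: (Amax B); last by right.
  split=> // B0; have /B0 : B 0 by apply: lincomb0.
  by [].
exists A; split=> // x y Ax Ay Axy; apply: contrapT => nxy.
have [A_int AD AM AP A_inter] := aA.
have A0 : A 0 by apply: AP; exists 0; rewrite ?rmorph0.
have ext z : z \in algint -> ~ A z -> exists s a b,
    [/\ int_ring K s, ~ P s, A a, b \in algint & iota s = a + b * z].
  move=> Az nAz; apply: contrapT => no.
  pose B := [set w | exists a b, [/\ A a, b \in algint & w = a + b * z]].
  have AB : A `<=` B by move=> w Aw; exists w, 0; rewrite mul0r addr0 rpred0.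
  apply: (Amax B); first split=> // BA.
    by apply: nAz; apply: BA; exists 0, 1; rewrite mul1r add0r rpred1.
  right; split.
  - move=> _ [a [b [/A_int Aa Ab ->]]].
    by apply: rpredD => //; apply: rpredM.
  - move=> _ _ [a [b [Aa Ab ->]]] [c [d [Ac Ad ->]]].
    exists (a + c), (b + d); split; [exact: AD | exact: rpredD | ring].
  - move=> e _ Ae [a [b [Aa Ab ->]]].
    by exists (e * a), (e * b); split; [exact: AM | exact: rpredM | ring].
  - by move=> w /AP /AB.
  - move=> s Os [a [b [Aa Ab Ds]]]; apply: contrapT => nPs.
    by apply: no; exists s, a, b.
have [s [a [b [Os nPs Aa Ab Ds]]]] := ext x Ax (fun h => nxy (or_introl h)).
have [t [c [d [Ot nPt Ac Ad Dt]]]] := ext y Ay (fun h => nxy (or_intror h)).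
suff [] : P s \/ P t by [].
apply: Pprime => //; apply: A_inter; first exact: int_ringM.
have -> : iota (s * t) = (a + b * x) * c + (d * y) * a + (b * d) * (x * y).
  by rewrite rmorphM Ds Dt; ring.
apply: (AD); [apply: (AD)|]; apply: AM => //; do ?exact: rpredM.
by rewrite -Ds; apply: int_ring_algint.
Qed.

End PrimeAbove.

(** * Valuations of the algebraic numbers *)

Definition vge (v : algC -> rat) (c : rat) (x : algC) := (x == 0) || (c <= v x).
Definition vgt (v : algC -> rat) (c : rat) (x : algC) := (x == 0) || (c < v x).

(* The value of v at 0 is junk: vge and vgt treat 0 as infinitely divisible. *)
Record valuation (v : algC -> rat) (r : nat) : Prop := Valuation {
  valM : forall x y, x != 0 -> y != 0 -> v (x * y) = v x + v y;
  vgeD : forall c x y, vge v c x -> vge v c y -> vge v c (x + y);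
  val_algint : forall x, x \in algint -> vge v 0 x;
  val_prime : prime r;
  val_char : v r%:R = 1;
  val_denom : forall (q : {poly int}) x, q != 0 -> x != 0 ->
    root (map_poly intr q) x ->
    exists (n : nat) (m : int), [/\ (0 < n)%N, (n < size q)%N & v x * n%:R = m%:~R]
}.

Section ValuationRing.
Variables (r : nat) (J : set algC).
Hypotheses (pr_r : prime r) (Jr : J r%:R) (J1 : ~ J 1).
Hypotheses (J_int : J `<=` algint) (J0 : J 0).
Hypothesis JD : forall x y, J x -> J y -> J (x + y).
Hypothesis JM : forall a x, a \in algint -> J x -> J (a * x).
Hypothesis Jprime :
  forall x y, x \in algint -> y \in algint -> J (x * y) -> J x \/ J y.

(** The local ring at J; M is its maximal ideal and U its group of units. *)
Let V : set algC := [set x | exists b, [/\ b \in algint, ~ J b & b * x \in algint]].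
Let M : set algC := [set x | exists b, [/\ b \in algint, ~ J b & J (b * x)]].
Let U : set algC := [set x | [/\ x != 0, V x & V x^-1]].

Let JB x y : J x -> J y -> J (x - y).
Proof. by move=> Jx Jy; rewrite -mulN1r; apply: JD => //; apply: JM => //; apply: rpredN1. Qed.

Let nJM x y : x \in algint -> y \in algint -> ~ J x -> ~ J y -> ~ J (x * y).
Proof. by move=> Ax Ay nx ny /(Jprime Ax Ay)[]. Qed.

Let J_dvd (c : int) : J c%:~R -> (r%:Z %| c)%Z.
Proof.
move=> Jc; apply: contrapT => /negP /(prime_bezout pr_r)[u [w Duw]]; apply: J1.
by rewrite -[1]/(1%:~R) -Duw intrD !intrM; apply: JD; apply: JM => //; apply: algint_int.
Qed.

Let V_algint x : x \in algint -> V x.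
Proof. by exists 1; rewrite mul1r rpred1. Qed.

Let VM x y : V x -> V y -> V (x * y).
Proof.
move=> [b [Ab nb Abx]] [c [Ac nc Acy]]; exists (b * c).
by split; [exact: rpredM | exact: nJM | rewrite mulrACA; exact: rpredM].
Qed.

Let VD x y : V x -> V y -> V (x + y).
Proof.
move=> [b [Ab nb Abx]] [c [Ac nc Acy]]; exists (b * c).
split; [exact: rpredM | exact: nJM |].
have -> : b * c * (x + y) = c * (b * x) + b * (c * y) by ring.
by apply: rpredD; apply: rpredM.
Qed.

Let MD x y : M x -> M y -> M (x + y).
Proof.
move=> [b [Ab nb Abx]] [c [Ac nc Acy]]; exists (b * c).
split; [exact: rpredM | exact: nJM |].
have -> : b * c * (x + y) = c * (b * x) + b * (c * y) by ring.
by apply: JD; apply: JM.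
Qed.

Let V_total x : V x \/ V x^-1.
Proof.
have [q [cq qx]] := algC_primitive x.
have [p1 [_ [Ab Abx _ nb]]] := exists_denominator pr_r J0 JB J_dvd cq qx.
set b := _.[x] in Ab Abx nb.
have [Jb|nJb] := pselect (J b); last by left; exists b.
have nJbx : ~ J (b * x) by move=> ?; apply: nb.
have nzx : x != 0 by apply: contra_notN nJbx => /eqP ->; rewrite mulr0.
by right; exists (b * x); split=> //; rewrite mulfK.
Qed.

Let V_M x : V x -> M x \/ U x.
Proof.
move=> [b [Ab nb Abx]]; have [Jbx|nJbx] := pselect (J (b * x)).
  by left; exists b.
have nzx : x != 0 by apply: contra_notN nJbx => /eqP ->; rewrite mulr0.
by right; split=> //; [exists b | exists (b * x); split=> //; rewrite mulfK].
Qed.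

Let nM1 : ~ M 1.
Proof. by move=> [b [_ nb]]; rewrite mulr1. Qed.

Let UM x y : U x -> U y -> U (x * y).
Proof.
move=> [nzx Vx Vx'] [nzy Vy Vy']; split; [by rewrite mulf_neq0 | exact: VM |].
by rewrite invfM; apply: VM.
Qed.

Let U1 : U 1.
Proof. by split; rewrite ?oner_neq0 ?invr1 //; apply/V_algint/rpred1. Qed.

Let UV x : U x -> U x^-1.
Proof. by move=> [nzx Vx Vx']; split; rewrite ?invr_eq0 ?invrK. Qed.

Let UX x n : U x -> U (x ^+ n).
Proof. by move=> Ux; elim: n => [|n IHn]; rewrite ?expr0 // exprS; apply: UM. Qed.

Let VX x n : V x -> V (x ^+ n).
Proof.
by move=> Vx; elim: n => [|n IHn]; [apply/V_algint/rpred1 | rewrite exprS; apply: VM].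
Qed.

Let nzr : (r%:R : algC) != 0.
Proof. by rewrite pnatr_eq0 -lt0n prime_gt0. Qed.

Let nVr : ~ V (r%:R^-1).
Proof.
move=> [b [Ab nb Abr]]; apply: nb.
by rewrite -(divfK nzr b); apply: JM.
Qed.

Let U_r (e : int) : V (r%:R ^ e) -> 0 <= e.
Proof.
case: e => [//|n]; rewrite NegzE -invr_expz /= => Vn; exfalso; apply: nVr.
have -> : (r%:R : algC)^-1 = r%:R ^+ n * (r%:R ^ n.+1%:Z)^-1.
  by rewrite -exprnP exprS invfM mulrC mulfVK ?expf_neq0 //.
by apply: VM => //; apply: VX; apply/V_algint/rpred_nat.
Qed.

Let U_int (c : int) : c != 0 -> exists a : nat, U (c%:~R / r%:R ^+ a).
Proof.
move=> nzc; have c_gt0 : (0 < `|c|)%N by rewrite absz_gt0.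
exists (logn r `|c|); have [d cod Dc] := pfactor_coprime pr_r c_gt0.
have Ud : U d%:R.
  have nJd : ~ J d%:R.
    rewrite pmulrn => /J_dvd; rewrite dvdzE /=; apply/negP.
    by rewrite -prime_coprime.
  have nzd : d%:R != 0 :> algC by apply: contra_notN nJd => /eqP ->.
  split; rewrite // ?inE; first exact/V_algint/rpred_nat.
  by exists d%:R; split; rewrite ?rpred_nat ?mulfV ?rpred1.
have -> : c%:~R / r%:R ^+ logn r `|c| = (sgz c)%:~R * d%:R :> algC.
  rewrite {1}[c]intEsg intrM -mulrA; congr (_ * _).
  rewrite -pmulrn.
  by rewrite [X in X%:R / _]Dc natrM natrX mulfK ?expf_neq0.
apply: UM => //; rewrite /sgz (negPf nzc).
case: (c < 0) => //; split; first by rewrite oppr_eq0 oner_eq0.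
  exact/V_algint/rpredN1.
by rewrite invrN1; apply/V_algint/rpredN1.
Qed.

Let V_min (s : seq algC) : s != [::] -> (forall x, x \in s -> x != 0) ->
  exists2 x, x \in s & forall y, y \in s -> V (y / x).
Proof.
elim: s => // x s IHs _ nzs; have nzx : x != 0 by apply: nzs; rewrite inE eqxx.
have [s0|nz] := eqVneq s [::].
  exists x; rewrite ?inE ?eqxx // => y; rewrite s0 inE => /eqP->.
  by rewrite mulfV //; apply/V_algint/rpred1.
have [|y sy miny] := IHs nz; first by move=> y sy; apply: nzs; rewrite inE sy orbT.
have nzy : y != 0 by apply: nzs; rewrite inE sy orbT.
have [Vxy|Vyx] := V_total (x / y).
  exists y; first by rewrite inE sy orbT.
  by move=> z; rewrite inE => /predU1P[->|/miny].
exists x; rewrite ?inE ?eqxx // => z; rewrite inE => /predU1P[->|sz].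
  by rewrite mulfV //; apply/V_algint/rpred1.
have -> : z / x = z / y * (x / y)^-1 by field; rewrite nzx nzy.
by apply: VM => //; apply: miny.
Qed.

(** In a sum equal to 0 the least divisible term cannot be alone, so two terms of the equation of x
    have a unit as their ratio. Their integral coefficients are powers of r up to units, hence so is
    a power of x. In particular the value group is rational. *)
Let rel_r (q : {poly int}) x : q != 0 -> x != 0 -> root (map_poly intr q) x ->
  exists (n : nat) (m : int),
    [/\ (0 < n)%N, (n < size q)%N & U (x ^+ n / r%:R ^ m)].
Proof.
move=> nzq nzx qx; pose c (i : 'I_(size q)) : algC := (q`_i)%:~R.
pose y i := c i * x ^+ i.
have sum_y : \sum_i y i = 0.
  move/rootP: qx; rewrite horner_coef size_map_inj_poly //; last exact: intr_inj.
  by move=> q0; rewrite -[RHS]q0; apply: eq_bigr => i _; rewrite coef_map.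
have y_eq0 i : (y i == 0) = (q`_i == 0).
  by rewrite mulf_eq0 expf_eq0 (negPf nzx) andbF orbF intr_eq0.
pose s := [seq y i | i <- enum 'I_(size q) & y i != 0].
have sP i : y i != 0 -> y i \in s.
  by move=> nzy; apply: map_f; rewrite mem_filter nzy mem_enum.
have [||_ /mapP[i + ->] min_i] := V_min (_ : s != [::]) _.
- have lt_q : ((size q).-1 < size q)%N by rewrite ltn_predL size_poly_gt0.
  have : y (Ordinal lt_q) \in s by apply: sP; rewrite y_eq0 /= -lead_coefE lead_coef_eq0.
  by case: (s).
- by move=> _ /mapP[i + ->]; rewrite mem_filter => /andP[].
rewrite mem_filter => /andP[nzyi _].
have [j [neq_ji nzyj Uji]] : exists j, [/\ j != i, y j != 0 & U (y j / y i)].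
  apply: contrapT => no; apply: nM1.
  have -> : 1 = - \sum_(j | j != i) y j / y i.
    move: sum_y; rewrite (bigD1 i) //= => /eqP; rewrite addr_eq0 => /eqP Dyi.
    by rewrite -mulr_suml -mulNr -Dyi mulfV.
  have M0 : M 0 by exists 1; rewrite mulr0 rpred1.
  rewrite -sumrN; elim/big_ind: _ => // j neq_ji.
  have [->|nzyj] := eqVneq (y j) 0; first by rewrite mul0r oppr0.
  have [|[b [Ab nb Jb]]|Uji] := V_M (_ : V (y j / y i)).
  - by apply: min_i; apply: sP.
  - by exists b; rewrite mulrN -sub0r; split=> //; apply: JB.
  - by case: no; exists j.
have nzc l : y l != 0 -> (q`_l)%R != 0 by rewrite y_eq0.
have [a Ua] := U_int (nzc _ nzyi); have [b Ub] := U_int (nzc _ nzyj).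
have nzra k : (r%:R : algC) ^+ k != 0 by rewrite expf_neq0.
have key (i1 j1 : 'I_(size q)) (a1 b1 : nat) : (i1 < j1)%N ->
    U (c i1 / r%:R ^+ a1) -> U (c j1 / r%:R ^+ b1) -> U (y j1 / y i1) ->
    U (x ^+ (j1 - i1) / r%:R ^ (a1%:Z - b1%:Z)).
  move=> lt_ij Ui Uj Uy.
  have nzci : c i1 != 0 by case: Ui => + _ _; rewrite mulf_eq0 => /norP[].
  have nzcj : c j1 != 0 by case: Uj => + _ _; rewrite mulf_eq0 => /norP[].
  have -> : x ^+ (j1 - i1) / r%:R ^ (a1%:Z - b1%:Z)
      = (y j1 / y i1) * (c i1 / r%:R ^+ a1) * (c j1 / r%:R ^+ b1)^-1.
    rewrite expfzDr // -!exprnP -invr_expz -exprnP /y -{2}(subnK (ltnW lt_ij)) exprD.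
    by field; rewrite nzci nzcj !expf_neq0.
  by apply: UM; [apply: UM | apply: UV].
have [lt_ij|lt_ji|eq_ij] := ltngtP i j.
- exists (j - i)%N, (a%:Z - b%:Z); rewrite subn_gt0 lt_ij; split=> //; last exact: key.
  exact: leq_ltn_trans (leq_subr _ _) (ltn_ord j).
- exists (i - j)%N, (b%:Z - a%:Z); rewrite subn_gt0 lt_ji; split=> //.
    exact: leq_ltn_trans (leq_subr _ _) (ltn_ord i).
  by apply: key => //; rewrite -[_ / _]invrK invf_div; apply: UV.
- by rewrite (ord_inj eq_ij) eqxx in neq_ji.
Qed.

(** The value m / n is read off from x^n, a unit times r^m. At x = 0 every c qualifies, which leaves
    v 0 arbitrary. *)
Let spec x (c : rat) := x != 0 -> exists (n : nat) (m : int),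
  [/\ (0 < n)%N, c * n%:R = m%:~R & U (x ^+ n / r%:R ^ m)].

Let spec_V x c : x != 0 -> spec x c -> V x <-> 0 <= c.
Proof.
move=> nzx /(_ nzx)[n [m [n_gt0 Dc [_ Vx Vx']]]].
have Vr (e : nat) : V (r%:R ^+ e) by apply/VX/V_algint/rpred_nat.
have nzrm : (r%:R : algC) ^ m != 0 by rewrite expfz_neq0.
have -> : (0 <= c) = (0 <= m).
  by rewrite -(ler0z rat) -Dc pmulr_lge0 // ltr0n.
split=> [Vx1|m_ge0].
  apply: U_r; have -> : r%:R ^ m = (x ^+ n / r%:R ^ m)^-1 * x ^+ n :> algC.
    by rewrite invf_div divfK ?expf_neq0.
  by apply: VM => //; apply: VX.
have Vn : V (x ^+ n).
  rewrite -[x ^+ n](divfK nzrm); apply: VM => //.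
  by case: m m_ge0 {Dc Vx Vx' nzrm} => // m _; rewrite -exprnP.
have [//|VVx] := V_total x.
have -> : x = x ^+ n * x^-1 ^+ n.-1.
  by rewrite -{1}(prednK n_gt0) exprS -mulrA -exprMn mulfV // expr1n mulr1.
by apply: VM => //; apply: VX.
Qed.

Let spec_ex x : exists c, spec x c.
Proof.
have [->|nzx] := eqVneq x 0; first by exists 0; rewrite /spec eqxx.
have [q [cq qx]] := algC_primitive x.
have nzq : q != 0 by rewrite -zcontents_eq0 cq.
have [n [m [n_gt0 _ Un]]] := rel_r nzq nzx qx.
exists (m%:~R / n%:R) => _; exists n, m; split=> //.
by rewrite divfK // pnatr_eq0 -lt0n.
Qed.

Let specM x y c d : x != 0 -> y != 0 -> spec x c -> spec y d -> spec (x * y) (c + d).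
Proof.
move=> nzx nzy /(_ nzx)[n [m [n_gt0 Dc Ux]]] /(_ nzy)[n' [m' [n'_gt0 Dd Uy]]] _.
exists (n * n')%N, (m * n'%:Z + m' * n%:Z).
rewrite muln_gt0 n_gt0 n'_gt0; split=> //.
  by rewrite intrD !intrM -Dc -Dd natrM -!pmulrn; ring.
have -> : (x * y) ^+ (n * n') / r%:R ^ (m * n'%:Z + m' * n%:Z) =
    (x ^+ n / r%:R ^ m) ^+ n' * (y ^+ n' / r%:R ^ m') ^+ n.
  rewrite expfzDr // !expr_div_n -!exprM [(n' * n)%N]mulnC exprMn.
  by rewrite [(_ ^ m) ^+ _]exprnP [(_ ^ m') ^+ _]exprnP !exprz_exp mulf_div.
by apply: UM; apply: UX.
Qed.

Let specV x c : x != 0 -> spec x c -> spec x^-1 (- c).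
Proof.
move=> nzx /(_ nzx)[n [m [n_gt0 Dc Ux]]] _; exists n, (- m).
split=> //; first by rewrite mulNr Dc rmorphN.
by rewrite -invr_expz exprVn -invfM; apply: UV.
Qed.

Let spec_uniq x c d : x != 0 -> spec x c -> spec x d -> c = d.
Proof.
move=> nzx.
suff le e f : spec x e -> spec x f -> f <= e.
  by move=> Sc Sd; apply/le_anti/andP; split; apply: le.
move=> Se Sf; rewrite -subr_ge0.
have /spec_V <- : spec (x * x^-1) (e - f).
  by apply: specM; rewrite ?invr_eq0 //; apply: specV.
  by rewrite mulfV //; apply/V_algint/rpred1.
by rewrite mulfV ?oner_eq0.
Qed.

Lemma exists_valuation : exists v, valuation v r /\
  forall x, x \in algint -> J x <-> vgt v 0 x.
Proof.
have [v vP] := choice spec_ex; exists v.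
have vM x y : x != 0 -> y != 0 -> v (x * y) = v x + v y.
  move=> nzx nzy; apply: (@spec_uniq (x * y)); rewrite ?mulf_neq0 //.
  exact: specM.
have vV x : x != 0 -> v x^-1 = - v x.
  by move=> nzx; apply: (@spec_uniq x^-1); rewrite ?invr_eq0 //; apply: specV.
have VP x : x != 0 -> V x <-> 0 <= v x by move=> nzx; apply: spec_V.
split; first split=> //.
- move=> c x y; rewrite /vge.
  have [->|nzx] := eqVneq x 0; first by rewrite add0r.
  have [->|nzy] := eqVneq y 0; first by rewrite addr0 (negPf nzx).
  have [//|nzxy] /= := eqVneq (x + y) 0.
  wlog le_xy : x y nzx nzy nzxy / v x <= v y.
    have /orP[le|le] := le_total (v x) (v y); first by apply.
    by move=> H cx cy; rewrite addrC; apply: H => //; rewrite addrC.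
  move=> cx _; apply: le_trans cx _.
  have Dxy : x + y = x * (1 + y / x) by field.
  have nz1 : 1 + y / x != 0 by move: nzxy; rewrite Dxy mulf_eq0 => /norP[].
  rewrite Dxy vM // lerDl; apply/VP => //; apply: VD; first exact/V_algint/rpred1.
  by apply/VP; rewrite ?mulf_neq0 ?invr_eq0 // vM ?invr_eq0 // vV // subr_ge0.
- by move=> x Ax; rewrite /vge; case: eqVneq => //= nzx; apply/VP/V_algint.
- apply: (@spec_uniq r%:R) => // _; exists 1%N, 1; split=> //.
  by rewrite expr1 expr1z mulfV.
- move=> q x nzq nzx /(rel_r nzq nzx)[n [m [n_gt0 lt_n Un]]].
  exists n, m; split=> //.
  have -> : v x = m%:~R / n%:R.
    apply: (@spec_uniq x) => // _; exists n, m; split=> //.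
    by rewrite divfK // pnatr_eq0 -lt0n.
  by rewrite divfK // pnatr_eq0 -lt0n.
move=> x Ax; rewrite /vgt; have [->|nzx] /= := eqVneq x 0; first by split.
have Vx : 0 <= v x by apply/VP/V_algint.
split=> [Jx|vx].
  rewrite lt_def Vx andbT; apply: contraPneq Jx => vx Jx.
  have /VP : 0 <= v x^-1 by rewrite vV // vx oppr0.
  rewrite invr_eq0 nzx => /(_ isT)[b [Ab nb Abx]]; apply: nb.
  by rewrite -(divfK nzx b); apply: JM.
have [[b [Ab nb Jb]]|[_ _ /VP]] := V_M (V_algint Ax).
  by case: (Jprime Ab Ax Jb).
by rewrite invr_eq0 nzx => /(_ isT); rewrite vV // oppr_ge0 leNgt vx.
Qed.

End ValuationRing.

Section ValuationTheory.
Variables (v : algC -> rat) (r : nat).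
Hypothesis hv : valuation v r.
Implicit Types (x y : algC) (c : rat).

Lemma vge0 c : vge v c 0. Proof. by rewrite /vge eqxx. Qed.

Lemma vgt0 c : vgt v c 0. Proof. by rewrite /vgt eqxx. Qed.

Lemma vge_trans c d x : d <= c -> vge v c x -> vge v d x.
Proof. by move=> le_dc /orP[/eqP->|h]; rewrite /vge ?eqxx // (le_trans le_dc) ?orbT. Qed.

Lemma vge_gt c d x : d < c -> vge v c x -> vgt v d x.
Proof. by move=> lt_dc /orP[/eqP->|h]; rewrite /vgt ?eqxx // (lt_le_trans lt_dc) ?orbT. Qed.

Lemma val1 : v 1 = 0.
Proof.
have /eqP := valM hv (oner_neq0 _) (oner_neq0 _).
by rewrite mulr1 -subr_eq0 opprD addrA subrr add0r oppr_eq0 => /eqP.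
Qed.

Lemma valV x : x != 0 -> v x^-1 = - v x.
Proof.
move=> nzx; apply/eqP; rewrite -addr_eq0 addrC -(valM hv) ?invr_eq0 //.
by rewrite mulfV // val1.
Qed.

Lemma valX x n : x != 0 -> v (x ^+ n) = v x * n%:R.
Proof.
move=> nzx; elim: n => [|n IHn]; first by rewrite expr0 val1 mulr0.
by rewrite exprS (valM hv) ?expf_neq0 // IHn mulrS mulrDr mulr1.
Qed.

Lemma valXz x (m : int) : x != 0 -> v (x ^ m) = v x * m%:~R.
Proof.
move=> nzx; case: m => n; first by rewrite -exprnP valX.
by rewrite NegzE -invr_expz valV ?expf_neq0 // -exprnP valX // rmorphN mulrN.
Qed.

Lemma valN x : v (- x) = v x.
Proof.
have vN1 : v (-1) = 0.
  have /eqP : v ((-1) ^+ 2) = 0 by rewrite sqrrN expr1n val1.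
  by rewrite valX ?oppr_eq0 ?oner_eq0 // mulf_eq0 pnatr_eq0 orbF => /eqP.
have [->|nzx] := eqVneq x 0; first by rewrite oppr0.
by rewrite -mulN1r (valM hv) ?oppr_eq0 ?oner_eq0 // vN1 add0r.
Qed.

Lemma vgeN c x : vge v c (- x) = vge v c x.
Proof. by rewrite /vge oppr_eq0 valN. Qed.

Lemma vgtN c x : vgt v c (- x) = vgt v c x.
Proof. by rewrite /vgt oppr_eq0 valN. Qed.

Lemma vgeB c x y : vge v c x -> vge v c y -> vge v c (x - y).
Proof. by move=> cx cy; apply: (vgeD hv); rewrite ?vgeN. Qed.

Lemma vgtD c x y : vgt v c x -> vgt v c y -> vgt v c (x + y).
Proof.
have [->|nzx] := eqVneq x 0; first by rewrite add0r.
have [->|nzy] := eqVneq y 0; first by rewrite addr0.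
rewrite {1 2}/vgt (negPf nzx) (negPf nzy) /= => cx cy.
apply: (@vge_gt (Num.min (v x) (v y))); first by rewrite lt_min cx cy.
by apply: (vgeD hv); rewrite /vge ge_min lexx ?orbT.
Qed.

Lemma vgtB c x y : vgt v c x -> vgt v c y -> vgt v c (x - y).
Proof. by move=> cx cy; apply: vgtD; rewrite ?vgtN. Qed.

Lemma vge_sum c (I : Type) (s : seq I) (Q : pred I) (F : I -> algC) :
  (forall i, Q i -> vge v c (F i)) -> vge v c (\sum_(i <- s | Q i) F i).
Proof. by move=> cF; elim/big_ind: _ => [|x y|i /cF//]; [exact: vge0 | apply: (vgeD hv)]. Qed.

Lemma vgt_sum c (I : Type) (s : seq I) (Q : pred I) (F : I -> algC) :
  (forall i, Q i -> vgt v c (F i)) -> vgt v c (\sum_(i <- s | Q i) F i).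
Proof. by move=> cF; elim/big_ind: _ => [|x y|i /cF//]; [exact: vgt0 | apply: vgtD]. Qed.

Lemma vgeM c d x y : vge v c x -> vge v d y -> vge v (c + d) (x * y).
Proof.
rewrite /vge; have [->|nzx] := eqVneq x 0; first by rewrite mul0r eqxx.
have [->|nzy] /= := eqVneq y 0; first by rewrite mulr0 eqxx.
by move=> cx dy; rewrite (valM hv) // lerD ?orbT.
Qed.

Lemma vgtM c d x y : vgt v c x -> vge v d y -> vgt v (c + d) (x * y).
Proof.
rewrite /vge /vgt; have [->|nzx] := eqVneq x 0; first by rewrite mul0r eqxx.
have [->|nzy] /= := eqVneq y 0; first by rewrite mulr0 eqxx.
by move=> cx dy; rewrite (valM hv) // ltr_leD ?orbT.
Qed.

Lemma vint_M x y : vge v 0 x -> vge v 0 y -> vge v 0 (x * y).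
Proof. by move=> cx cy; rewrite -[0]addr0; apply: vgeM. Qed.

Lemma vint_X x n : vge v 0 x -> vge v 0 (x ^+ n).
Proof.
move=> cx; elim: n => [|n IHn]; first by rewrite expr0 /vge val1 lexx orbT.
by rewrite exprS; apply: vint_M.
Qed.

Lemma vmax_Mr x y : vgt v 0 x -> vge v 0 y -> vgt v 0 (x * y).
Proof. by move=> cx cy; rewrite -[0]addr0; apply: vgtM. Qed.

Lemma vmax_Ml x y : vge v 0 x -> vgt v 0 y -> vgt v 0 (x * y).
Proof. by move=> cx cy; rewrite mulrC; apply: vmax_Mr. Qed.

Lemma vmax_1 : vgt v 0 1 = false.
Proof. by rewrite /vgt oner_eq0 val1 ltxx. Qed.

Lemma vint_1 : vge v 0 1. Proof. by rewrite /vge val1 lexx orbT. Qed.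

Lemma vunitP x : vge v 0 x -> ~~ vgt v 0 x -> x != 0 /\ v x = 0.
Proof.
rewrite /vge /vgt; case: eqVneq => //= nzx; rewrite -leNgt => ge le.
by split=> //; apply/le_anti/andP.
Qed.

Lemma vmax_unit x : x != 0 -> v x = 0 -> vgt v 0 x = false.
Proof. by rewrite /vgt => /negPf -> ->; rewrite ltxx. Qed.

Lemma vint_unit x : v x = 0 -> vge v 0 x.
Proof. by rewrite /vge => ->; rewrite lexx orbT. Qed.

Lemma vmax_M_unit u x : u != 0 -> v u = 0 -> vgt v 0 (u * x) = vgt v 0 x.
Proof.
move=> nzu vu; rewrite /vgt mulf_eq0 (negPf nzu); case: eqVneq => //= nzx.
by rewrite (valM hv) // vu add0r.
Qed.

Lemma vmax_prod x y :
  vge v 0 x -> vge v 0 y -> vgt v 0 (x * y) -> vgt v 0 x \/ vgt v 0 y.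
Proof.
move=> ox oy mxy; have [mx|nmx] := boolP (vgt v 0 x); first by left.
by right; have [nzx vx] := vunitP ox nmx; rewrite vmax_M_unit in mxy.
Qed.

Lemma vmax_exp x n : vge v 0 x -> vgt v 0 (x ^+ n) -> vgt v 0 x.
Proof.
move=> ox; elim: n => [|n IHn]; first by rewrite expr0 vmax_1.
by rewrite exprS => /(vmax_prod ox (vint_X _ ox))[].
Qed.

Lemma vint_algint x : x \in algint -> vge v 0 x.
Proof. exact: val_algint hv x. Qed.

Lemma vmax_char : vgt v 0 r%:R.
Proof. by rewrite /vgt (val_char hv) ltr01 orbT. Qed.

Lemma vmax_int (c : int) : vgt v 0 c%:~R = (r%:Z %| c)%Z.
Proof.
apply/idP/idP => [mc|/dvdzP[a ->]].
  apply: contrapT => /negP /(prime_bezout (val_prime hv))[u [w Duw]].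
  suff : vgt v 0 1 by rewrite vmax_1.
  rewrite -[1]/(1%:~R) -Duw intrD !intrM; apply: vgtD; apply: vmax_Ml => //.
  - by apply/vint_algint/algint_int.
  - by apply/vint_algint/algint_int.
  - exact: vmax_char.
by rewrite intrM; apply: vmax_Ml; [apply/vint_algint/algint_int | exact: vmax_char].
Qed.

Lemma vmax_nat n : vgt v 0 n%:R = (r %| n)%N.
Proof. by rewrite pmulrn vmax_int. Qed.

(** The powers of x sum to 0, so n is the sum of the 1 - x^i; if x were congruent to 1, the maximal
    ideal would contain n. *)
Lemma unity_root_neq1 x n : ~~ (r %| n)%N -> x ^+ n = 1 -> x != 1 ->
  vgt v 0 (x - 1) = false.
Proof.
move=> rn xn nx1; have n_gt0 : (0 < n)%N by rewrite lt0n; apply: contraNneq rn => ->.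
apply/negP => m1; move: rn; rewrite -vmax_nat; case/negP.
have ox : vge v 0 x.
  apply: vint_algint; apply: (@algint_root_monic _ ('X^n - 1)).
  - by rewrite monicXnsubC.
  - by rewrite /root !hornerE xn subrr.
  - by rewrite rpredB ?rpredX ?polyOverX ?rpred1.
have /eqP : (x - 1) * \sum_(i < n) x ^+ i = 0 by rewrite -subrX1 xn subrr.
rewrite mulf_eq0 subr_eq0 (negPf nx1) => /eqP sum0.
have -> : n%:R = \sum_(i < n) (1 - x ^+ i).
  by rewrite sumrB sum0 subr0 sumr_const card_ord.
apply: vgt_sum => i _; rewrite -opprB vgtN; elim: (nat_of_ord i) => [|k IHk].
  by rewrite expr0 subrr vgt0.
have -> : x ^+ k.+1 - 1 = x * (x ^+ k - 1) + (x - 1) by rewrite exprS; ring.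
by apply: vgtD => //; apply: vmax_Ml.
Qed.

Lemma val_fraction x : vge v 0 x -> exists p1 p2 : {poly int},
  let b := (map_poly intr p1).[x] in
  [/\ b \in algint, b * x \in algint, b * x = (map_poly intr p2).[x], b != 0
    & v b = 0].
Proof.
move=> ox; have [q [cq qx]] := algC_primitive x.
have PB y z : vgt v 0 y -> vgt v 0 z -> vgt v 0 (y - z) by apply: vgtB.
have Pint (c : int) : vgt v 0 c%:~R -> (r%:Z %| c)%Z by rewrite vmax_int.
have [p1 [p2 [Ab Abx Dbx nb]]] :=
  exists_denominator (val_prime hv) (vgt0 0) PB Pint cq qx.
have nmb : ~~ vgt v 0 (map_poly intr p1).[x].
  by apply/negP=> mb; apply: nb; split=> //; apply: vmax_Mr.
by have [nzb vb] := vunitP (vint_algint Ab) nmb; exists p1, p2.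
Qed.

Lemma val_discrete (N : fieldExtType rat) (iota : {rmorphism N -> algC}) :
  exists2 D, (0 < D)%N &
    forall x : N, x != 0 -> exists m : int, v (iota x) * D%:R = m%:~R.
Proof.
(* By [val_denom] each value has a denominator at most the degree of N, so the factorial is a common
   one. *)
exists (\dim {:N})`!; first exact: fact_gt0.
move=> x nzx; have [q [cq sq qx]] := numfield_primitive x.
have nzq : q != 0 by rewrite -zcontents_eq0 cq.
have [||n [m [n_gt0 lt_n Dm]]] := @val_denom _ _ hv q (iota x) nzq.
- by rewrite fmorph_eq0.
- rewrite -(eq_map_poly (fun a => rmorph_int iota a)) map_poly_comp.
  by rewrite fmorph_root.
have /dvdnP[k ->] : (n %| (\dim {:N})`!)%N.
  by rewrite dvdn_fact // n_gt0 -ltnS (leq_trans lt_n).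
by exists (m * k%:Z); rewrite natrM mulrCA mulrC [v _ * _]Dm intrM.
Qed.

Lemma val_uniformizer (N : fieldExtType rat) (iota : {rmorphism N -> algC})
    (K : {subfield N}) :
  exists p : N, [/\ p \in K, p != 0, 0 < v (iota p) &
    forall x : N, x \in K -> x != 0 -> exists i : int, v (iota x) = v (iota p) * i%:~R].
Proof.
have [D D_gt0 Dv] := val_discrete iota.
have D0 : 0 < D%:R :> rat by rewrite ltr0n.
pose Q n := `[< exists x : N, [/\ x \in K, x != 0, v (iota x) * D%:R = n%:R & (0 < n)%N] >].
have exQ : exists n, Q n.
  exists D; apply/asboolP; exists r%:R; rewrite rpred_nat rmorph_nat (val_char hv).
  by rewrite mul1r numfield_natr_eq0 -lt0n prime_gt0 ?(val_prime hv).
have [n /asboolP[p [Kp nzp Dp n_gt0]] min_n] := ex_minnP exQ.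
have vp_gt0 : 0 < v (iota p) by rewrite -(pmulr_lgt0 _ D0) Dp ltr0n.
exists p; split=> // x Kx nzx; have [m Dm] := Dv x nzx.
exists (m %/ n%:Z)%Z.
pose y := x / p ^ (m %/ n%:Z)%Z.
have nzpe : p ^ (m %/ n%:Z)%Z != 0 by rewrite expfz_neq0.
have nzy : y != 0 by rewrite mulf_neq0 ?invr_eq0.
have Ky : y \in K by rewrite rpred_div // rpredXz.
have vy : v (iota y) = v (iota x) - v (iota p) * (m %/ n%:Z)%Z%:~R.
  rewrite fmorph_div fmorphXz /= (valM hv) ?fmorph_eq0 ?invr_eq0 ?expfz_neq0 ?fmorph_eq0 //.
  by rewrite valV ?expfz_neq0 ?fmorph_eq0 // valXz ?fmorph_eq0.
have vyD : v (iota y) * D%:R = (m %% n%:Z)%Z%:~R.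
  by rewrite vy mulrBl Dm mulrAC Dp {1}(divz_eq m n%:Z) intrD intrM -pmulrn; ring.
have nz_n : n%:Z != 0 by rewrite eqz_nat -lt0n.
have m_ge0 := modz_ge0 m nz_n.
case: (posnP `|(m %% n%:Z)%Z|%N) => [/eqP|m_gt0].
  rewrite absz_eq0 => /eqP m0; move: vyD; rewrite m0 => /eqP.
  by rewrite mulf_eq0 (gt_eqF D0) orbF vy subr_eq0 => /eqP.
have /min_n : Q `|(m %% n%:Z)%Z|%N.
  by apply/asboolP; exists y; split=> //; rewrite vyD pmulrn gez0_abs.
rewrite leqNgt => /negP[]; rewrite -ltz_nat gez0_abs // ltz_pmod //.
Qed.

End ValuationTheory.

Section SubfieldSet.
Variable F : set algC.
Hypothesis hF : is_subfield F.

Lemma subfield1 : F 1. Proof. by case: hF. Qed.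

Lemma subfieldB x y : F x -> F y -> F (x - y). Proof. by case: hF => _ h _; apply: h. Qed.

Lemma subfield_div x y : F x -> F y -> F (x / y).
Proof. by case: hF => _ _ h; apply: h. Qed.

Lemma subfield0 : F 0. Proof. by rewrite -(subrr 1); apply: subfieldB; apply: subfield1. Qed.

Lemma subfieldN x : F x -> F (- x).
Proof. by move=> Fx; rewrite -sub0r; apply: subfieldB => //; apply: subfield0. Qed.

Lemma subfieldD x y : F x -> F y -> F (x + y).
Proof. by move=> Fx /subfieldN; rewrite -{2}[y]opprK; apply: subfieldB. Qed.

Lemma subfieldV x : F x -> F x^-1.
Proof. by move=> Fx; rewrite -div1r; apply: subfield_div => //; apply: subfield1. Qed.

Lemma subfieldM x y : F x -> F y -> F (x * y).
Proof. by move=> Fx /subfieldV; rewrite -{2}[y]invrK; apply: subfield_div. Qed.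

Lemma subfieldX x n : F x -> F (x ^+ n).
Proof.
move=> Fx; elim: n => [|n IHn]; first exact: subfield1.
by rewrite exprS; apply: subfieldM.
Qed.

Lemma subfieldXz x (n : int) : F x -> F (x ^ n).
Proof.
move=> Fx; case: n => n; first by rewrite -exprnP; apply: subfieldX.
by rewrite NegzE -invr_expz -exprnP; apply/subfieldV/subfieldX.
Qed.

Lemma subfield_sum (I : Type) (s : seq I) (Q : pred I) (G : I -> algC) :
  (forall i, Q i -> F (G i)) -> F (\sum_(i <- s | Q i) G i).
Proof. by move=> FG; elim/big_ind: _ => // [|x y]; [exact: subfield0 | exact: subfieldD]. Qed.

Lemma subfield_nat n : F n%:R.
Proof.
by elim: n => [|n IHn]; rewrite ?mulrS;
  [exact: subfield0 | apply: subfieldD => //; apply: subfield1].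
Qed.

Lemma subfield_int (c : int) : F c%:~R.
Proof.
case: c => n; first exact: subfield_nat.
by rewrite NegzE rmorphN; apply/subfieldN/subfield_nat.
Qed.

Lemma subfield_poly (p : {poly int}) x : F x -> F (map_poly intr p).[x].
Proof.
move=> Fx; rewrite horner_coef; apply: subfield_sum => i _; rewrite coef_map.
by apply: subfieldM; [apply: subfield_int | apply: subfieldX].
Qed.

Lemma subfield_prod (I : Type) (s : seq I) (Q : pred I) (G : I -> algC) :
  (forall i, Q i -> F (G i)) -> F (\prod_(i <- s | Q i) G i).
Proof. by move=> FG; elim/big_ind: _ => // [|x y]; [exact: subfield1 | exact: subfieldM]. Qed.

End SubfieldSet.

(** * Conjugate valuations and independence of automorphisms on residues *)

Section Residues.
Variables (v : algC -> rat) (r : nat).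
Hypothesis hv : valuation v r.
Variable F : set algC.
Hypothesis hF : is_subfield F.
Local Notation O := (F `&` [set` algint]).

(** An inclusion between the centers of v o nu and of v suffices: nu maps denominators prime to v to
    units, hence integral elements to integral elements and units to units, and every x has a power
    that is a unit times a power of r, which nu fixes. *)
Lemma rmorph_place_eq (nu : {rmorphism algC -> algC}) :
    (forall y, O y -> vgt v 0 (nu y) -> vgt v 0 y) ->
  forall x, F x -> x != 0 -> v (nu x) = v x.
Proof.
move=> down.
have up_int x : F x -> vge v 0 x -> vge v 0 (nu x).
  move=> Fx ox; have [p1 [p2 /= [Ab Abx _ nzb vb]]] := val_fraction hv ox.
  set b := _.[x] in Ab Abx nzb vb; have Fb : F b by apply: subfield_poly.
  have nmb : ~~ vgt v 0 (nu b).
    by apply/negP => /down; rewrite vmax_unit // => /(_ (conj Fb Ab)).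
  have Anub : nu b \in algint by rewrite algint_rmorph.
  have [nznub vnub] := vunitP (vint_algint hv Anub) nmb.
  have -> : nu x = nu (b * x) / nu b by rewrite -fmorph_div mulrC mulKf.
  apply: (vint_M hv); first by apply/(vint_algint hv); rewrite algint_rmorph.
  by apply: vint_unit; rewrite (valV hv) // vnub oppr0.
have unit_eq x : F x -> x != 0 -> v x = 0 -> v (nu x) = 0.
  move=> Fx nzx vx.
  have := up_int x Fx (vint_unit vx).
  have := up_int x^-1 (subfieldV hF Fx) (vint_unit _).
  rewrite (valV hv) // vx oppr0 => /(_ erefl).
  rewrite /vge fmorphV invr_eq0 fmorph_eq0 (negPf nzx) /= (valV hv) ?fmorph_eq0 //.
  by rewrite oppr_ge0 => le ge; apply/le_anti/andP.
move=> x Fx nzx; have [q [cq qx]] := algC_primitive x.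
have nzq : q != 0 by rewrite -zcontents_eq0 cq.
have [k [m [k_gt0 _ Dm]]] := val_denom hv nzq nzx qx.
have nzr : (r%:R : algC) != 0 by rewrite pnatr_eq0 -lt0n prime_gt0 ?(val_prime hv).
pose y := x ^+ k / r%:R ^ m.
have nzrm : (r%:R : algC) ^ m != 0 by rewrite expfz_neq0.
have Fy : F y.
  by apply: (subfield_div hF); [exact: subfieldX | exact: (subfieldXz hF _ (subfield_nat hF r))].
have nzk : k%:R != 0 :> rat by rewrite pnatr_eq0 -lt0n.
apply: (mulIf nzk); apply/eqP; rewrite Dm -subr_eq0 -(valX hv) ?fmorph_eq0 //.
have := unit_eq y Fy; rewrite /y mulf_neq0 ?expf_neq0 ?invr_eq0 // => /(_ isT).
rewrite fmorph_div rmorphXn fmorphXz rmorph_nat /=.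
rewrite !(valM hv) ?invr_eq0 ?expf_neq0 ?fmorph_eq0 // !(valV hv) //.
rewrite (valX hv) // Dm (valXz hv) // (val_char hv) mul1r subrr => /(_ erefl) ->.
by [].
Qed.

Section Family.
Variables (I : finType) (nu : I -> {rmorphism algC -> algC}).
Hypothesis nuF : forall i x, F x -> F (nu i x).

Let separator i : exists y, [/\ O y, y != 0, v y = 0 &
  (forall x, F x -> x != 0 -> v (nu i x) = v x) \/ vgt v 0 (nu i y)].
Proof.
have [down|ndown] := pselect (forall y, O y -> vgt v 0 (nu i y) -> vgt v 0 y).
  exists 1; split; rewrite ?oner_neq0 ?(val1 hv) //.
    by split; [apply: subfield1 | exact: rpred1].
  by left; apply: rmorph_place_eq.
have [y [Oy my nmy]] : exists y, [/\ O y, vgt v 0 (nu i y) & ~ vgt v 0 y].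
  by apply: contrapT => no; apply: ndown => y Oy my; apply: contrapT => nmy; apply: no; exists y.
have [nzy vy] := vunitP (vint_algint hv Oy.2) (introN idP nmy).
by exists y; split=> //; right.
Qed.

(* Multiplying x by a suitable unit at v makes all its conjugates at least as
   divisible as x itself. *)
Lemma exists_dominated_multiple x : F x -> x != 0 -> exists y, [/\ O y, y != 0,
  v y = 0 & forall i, vge v (v x) (nu i (x * y))].
Proof.
move=> Fx nzx; have [Y YP] := choice separator.
pose y := \prod_i Y i.
have OY i : O (Y i) by case: (YP i).
have nzy : y != 0 by apply/prodf_neq0 => i _; case: (YP i).
have vy : v y = 0.
  rewrite /y; elim: (index_enum I) => [|i s IHs]; first by rewrite big_nil (val1 hv).
  have nzs : \prod_(j <- s) Y j != 0.
    by rewrite prodf_seq_neq0; apply/allP => j _; case: (YP j).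
  by rewrite big_cons (valM hv) //; case: (YP i) => // _ _ -> _; rewrite add0r.
have Fy : F y by apply: (subfield_prod hF) => i _; case: (OY i).
have Ay : y \in algint by apply: rpred_prod => i _; case: (OY i).
have Py i : (forall z, F z -> z != 0 -> v (nu i z) = v z) \/ 0 < v (nu i y).
  case: (YP i) => _ _ _ [?|mY]; [by left | right].
  have : vgt v 0 (nu i y).
    rewrite /y (bigD1 i) //= rmorphM; apply: (vmax_Mr hv) => //.
    apply/(vint_algint hv); rewrite algint_rmorph; apply: rpred_prod => j _.
    by case: (OY j).
  by rewrite /vgt fmorph_eq0 (negPf nzy).
have archi i : exists k : nat, (0 < v (nu i y)) ==> (v x - v (nu i x) <= v (nu i y) * k%:R).
  have [v_gt0|] := boolP (0 < v (nu i y)); last by exists 0%N.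
  exists (Num.bound `|(v x - v (nu i x)) / v (nu i y)|) => /=.
  rewrite mulrC -ler_pdivrMr //; apply: le_trans (ler_norm _) _.
  exact/ltW/archi_boundP/normr_ge0.
have [k kP] := choice archi.
(* The exponent is at least every [k i]. The automorphisms that preserve v gain nothing from y, but
   already give x its own value. *)
exists (y ^+ (\sum_i k i)); split.
- by split; [apply: subfieldX | apply: rpredX].
- by rewrite expf_neq0.
- by rewrite (valX hv) // vy mul0r.
move=> i; have vY_ge0 : 0 <= v (nu i y).
  have : vge v 0 (nu i y) by apply/(vint_algint hv); rewrite algint_rmorph.
  by rewrite /vge fmorph_eq0 (negPf nzy).
rewrite /vge rmorphM rmorphXn (valM hv) ?expf_neq0 ?fmorph_eq0 // (valX hv) ?fmorph_eq0 //.
apply/orP; right; case: (Py i) => [eq_v|v_gt0].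
  by rewrite !eq_v // vy mul0r addr0.
rewrite -lerBlDl; have := kP i; rewrite v_gt0 /= => /le_trans; apply.
by rewrite ler_wpM2l // ler_nat (bigD1 i) //= leq_addr.
Qed.

(** Dedekind's argument modulo the maximal ideal. Combining the relations at y x and at x removes a
    term g outside T and multiplies the terms in T, which act trivially on residues, by the common
    unit y - nu_g(y). The relation that remains is evaluated at 1. *)
Lemma residue_independence (T : pred I) (c : I -> algC) :
    (forall i x, T i -> O x -> vgt v 0 (nu i x - x)) ->
    (forall i, ~~ T i -> exists2 y, O y & ~~ vgt v 0 (nu i y - y)) ->
    (forall i, vge v 0 (c i)) ->
    (forall x, O x -> vgt v 0 (\sum_i c i * nu i x)) ->
  vgt v 0 (\sum_(i | T i) c i).
Proof.
move=> TP nTP oc0 Sc0.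
have OM x y : O x -> O y -> O (x * y).
  by move=> [Fx Ax] [Fy Ay]; split; [apply: subfieldM | apply: rpredM].
have Onu i x : O x -> O (nu i x).
  by move=> [Fx Ax]; split; [apply: nuF | rewrite /= algint_rmorph].
have oO x : O x -> vge v 0 x by move=> [_ Ax]; apply: (vint_algint hv).
suff clear_list (s : seq I) : {subset s <= [predC T]} -> exists u c',
   [/\ u != 0, v u = 0, forall i, vge v 0 (c' i), forall i, i \in s -> c' i = 0 &
     (forall i, T i -> vgt v 0 (c' i - u * c i)) /\
     forall x, O x -> vgt v 0 (\sum_i c' i * nu i x)].
  have [|u [c' [nzu vu oc' c'0 [c'T Sc']]]] := clear_list (enum [predC T]).
    by move=> i; rewrite mem_enum.
  rewrite -(vmax_M_unit hv _ nzu vu) mulr_sumr.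
  have -> : \sum_(i | T i) u * c i =
      \sum_i c' i * nu i 1 - \sum_(i | T i) (c' i - u * c i).
    rewrite (bigID T predT) /= [X in _ + X - _]big1 => [|i nTi]; last first.
      by rewrite c'0 ?mul0r // mem_enum.
    by rewrite addr0 -sumrB; apply: eq_bigr => i _; rewrite rmorph1 mulr1 subKr.
  apply: (vgtB hv); last by apply: (vgt_sum hv).
  by apply: Sc'; split; [apply: subfield1 | exact: rpred1].
elim: s => [_|g s IHs sT].
  exists 1, c; rewrite oner_neq0 (val1 hv); split=> //.
  by split=> // i _; rewrite mul1r subrr vgt0.
have [i si|u [c' [nzu vu oc' c'0 [c'T Sc']]]] := IHs.
  by apply: sT; rewrite inE si orbT.
have nTg : ~~ T g by apply: (sT g); rewrite inE eqxx.
have [y Oy nmy] := nTP g nTg.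
have [nzw vw] : y - nu g y != 0 /\ v (y - nu g y) = 0.
  apply: vunitP; last by rewrite -opprB (vgtN hv).
  by apply: (vgeB hv); apply: oO => //; apply: Onu.
exists (u * (y - nu g y)), (fun i => c' i * (nu i y - nu g y)); split.
- by rewrite mulf_neq0.
- by rewrite (valM hv) // vu vw addr0.
- by move=> i; apply: (vint_M hv) => //; apply: (vgeB hv); apply/oO/Onu.
- by move=> i; rewrite inE => /predU1P[->|/c'0->]; rewrite ?subrr ?mulr0 ?mul0r.
split=> [t Tt|x Ox].
  have -> : c' t * (nu t y - nu g y) - u * (y - nu g y) * c t =
      (c' t - u * c t) * (nu t y - nu g y) + u * c t * (nu t y - y) by ring.
  apply: (vgtD hv).
    by apply: (vmax_Mr hv); [apply: c'T | apply: (vgeB hv); apply/oO/Onu].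
  apply: (vmax_Ml hv); last exact: TP.
  by apply: (vint_M hv) => //; apply: vint_unit.
have -> : \sum_i c' i * (nu i y - nu g y) * nu i x =
    \sum_i c' i * nu i (y * x) - nu g y * \sum_i c' i * nu i x.
  rewrite mulr_sumr -sumrB; apply: eq_bigr => i _; rewrite rmorphM; ring.
apply: (vgtB hv); first by apply/Sc'/OM.
by apply: (vmax_Ml hv); [apply/oO/Onu | apply: Sc'].
Qed.

End Family.
End Residues.

(** * Automorphisms of the algebraic numbers *)

Lemma galois_subfield_rat (N : splittingFieldType rat) (k : {subfield N}) :
  galois k {:N}.
Proof.
apply/and3P; split; [exact: subvf | | exact: normalFieldf].
apply/separableP => x _; apply: contrapT => /negP /separablePn_pchar[p + _].
rewrite inE => /andP[pr_p /eqP p0].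
have : p%:R == 0 :> rat by rewrite -(fmorph_eq0 (in_alg N)) rmorph_nat p0.
by rewrite pnatr_eq0 => /eqP Dp; rewrite Dp in pr_p.
Qed.

(** Galois theory needs a finite normal container: here the splitting field of a product of
    equations of the given numbers. *)
Lemma exists_splitting_container (s : seq algC) :
  exists (M : splittingFieldType rat) (f : {rmorphism M -> algC}),
    forall x, x \in s -> exists y, f y = x.
Proof.
have /choice[P PP] : forall x : algC, exists p : {poly rat},
    p != 0 /\ root (map_poly ratr p) x.
  move=> x; have [p [Dp pm _]] := minCpolyP x; exists p.
  by rewrite monic_neq0 // -Dp root_minCpoly.
pose p := \prod_(x <- s) P x.
have nzp : p != 0 by rewrite prodf_seq_neq0; apply/allP => x _; case: (PP x).
have [rs Drs] := closed_field_poly_normal (map_poly (ratr : rat -> algC) p).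
have [Q [f [s1 Ds1 genQ]]] := num_field_exists rs.
have splitP : SplittingField.axiom Q.
  exists (map_poly (in_alg Q) p).
    by apply/polyOver1P; exists p.
  exists s1 => //.
  have -> : map_poly (in_alg Q) p =
      (lead_coef p)%:A *: \prod_(z <- s1) ('X - z%:P).
    apply: (map_poly_inj f); rewrite -map_poly_comp.
    rewrite (eq_map_poly (_ : f \o in_alg Q =1 ratr)); last first.
      by move=> a /=; rewrite -in_algE fmorph_eq_rat fmorph_rat.
    rewrite Drs map_polyZ lead_coef_map /= -in_algE fmorph_eq_rat fmorph_rat.
    congr (_ *: _); rewrite -Ds1 big_map rmorph_prod; apply: eq_bigr => z _.
    by rewrite /= map_polyXsubC.
  by rewrite eqp_scale // -in_algE fmorph_eq0 lead_coef_eq0.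
have Q_ax : FieldExt_isSplittingField _ Q by constructor.
exists (HB.pack_for (splittingFieldType rat) Q Q_ax), f => x sx.
have : x \in rs.
  rewrite -root_prod_XsubC -(@rootZ _ _ (lead_coef (map_poly (ratr : rat -> algC) p)))
    ?lead_coef_eq0 ?map_poly_eq0 //.
  rewrite -Drs /p rmorph_prod /= (big_rem x) //= rootM.
  by have [_ ->] := PP x.
by rewrite -Ds1 => /mapP[y _ ->]; exists y.
Qed.

Lemma rmorph_lift (N M : fieldExtType rat) (f : {rmorphism N -> algC})
    (g : {rmorphism M -> algC}) : (forall x, exists y, g y = f x) ->
  {h : {lrmorphism N -> M} | forall x, g (h x) = f x}.
Proof.
move=> gf; pose h x := sval (cid (gf x)).
have hE x : g (h x) = f x by rewrite /h; case: (cid _).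
have ha : zmod_morphism h.
  by move=> x y; apply: (fmorph_inj g); rewrite !(hE, rmorphB).
have hm : monoid_morphism h.
  split=> [|x y]; apply: (fmorph_inj g); rewrite ?hE ?rmorph1 //.
  by rewrite !rmorphM /= !hE.
pose haM := GRing.isZmodMorphism.Build N M h ha.
pose hmM := GRing.isMonoidMorphism.Build N M h hm.
pose hRM : {rmorphism _ -> _} := HB.pack h haM hmM.
pose hlM := GRing.isScalable.Build rat N M *:%R h (fmorph_numZ hRM).
pose hLRM : {lrmorphism _ -> _} := HB.pack h haM hmM hlM.
by exists hLRM.
Qed.

Section Fixed.
Variables (N : splittingFieldType rat) (iota : {rmorphism N -> algC}).
Implicit Types (k L : {subfield N}) (nu : {rmorphism algC -> algC}).

Definition fixes k nu := forall x, x \in k -> nu (iota x) = iota x.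

Lemma exists_extension (z : algC) :
  exists (M : splittingFieldType rat) (f : {rmorphism M -> algC})
    (h : {lrmorphism N -> M}),
    (forall x, f (h x) = iota x) /\ exists y, f y = z.
Proof.
have [M [f fP]] := exists_splitting_container (z :: map iota (vbasis {:N})).
have fi x : exists y, f y = iota x.
  have /choice[b Db] : forall i : 'I_(\dim {:N}), exists y, f y = iota (vbasis {:N})`_i.
    move=> i; apply: fP; rewrite inE map_f ?orbT //.
    by rewrite mem_nth // size_tuple.
  exists (\sum_i coord (vbasis {:N}) i x *: b i).
  rewrite {2}(coord_vbasis (memvf x)) !rmorph_sum; apply: eq_bigr => i _ /=.
  by rewrite !rmorphZ_num Db.
have [h hE] := rmorph_lift fi.
by exists M, f, h; split=> //; apply: fP; rewrite inE eqxx.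
Qed.

(** Automorphisms of a finite normal container of z over k extend to [algC], so the Galois
    correspondence applies there. *)
Lemma fixed_in_subfield k z :
  (forall nu, fixes k nu -> nu z = z) -> exists2 y, y \in k & iota y = z.
Proof.
move=> fix_z; have [M [f [h [hE [y Dy]]]]] := exists_extension z.
pose k' := [aspace of (linfun h @: k)%VS].
have /galois_fixedField Dk' := galois_subfield_rat k'.
have : y \in k'.
  rewrite -Dk'; apply/fixedFieldP; first exact: memvf.
  move=> g galg; have [nu nuE] := extend_algC_subfield_aut f g.
  apply: (fmorph_inj f); rewrite nuE Dy; apply: fix_z => x kx.
  rewrite -hE -nuE; congr (f _); apply: (fixed_gal (subvf k') galg).
  by rewrite -[h x](lfunE h) memv_img.
case/memv_imgP => x kx Dyx; exists x => //.
by rewrite -hE -Dy Dyx lfunE.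
Qed.

Lemma restrict_aut k L nu : (k <= L)%VS -> normalField k L -> fixes k nu ->
  exists2 g, g \in 'Gal(L / k)%g & forall x, x \in L -> nu (iota x) = iota (g x).
Proof.
move=> kL nkL fix_nu; have [nu0 nu0E] := restrict_aut_to_normal_num_field iota nu.
have hom0 : kHom k L (linfun nu0).
  by apply/kAHomP => x kx; rewrite /= lfunE; apply: (fmorph_inj iota); rewrite nu0E fix_nu.
have [|g galg Dg] := @kHom_to_gal _ _ k L L _ _ nkL hom0.
  by rewrite kL subvv.
by exists g => // x Lx; rewrite -nu0E -(Dg x Lx) lfunE.
Qed.

Lemma extend_gal L (g : gal_of L) :
  exists nu, forall x, nu (iota x) = iota (g x).
Proof. by have [nu nuE] := extend_algC_subfield_aut iota g; exists nu => x; rewrite -nuE. Qed.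

End Fixed.

(** * Extensions generated by roots of unity of order prime to r *)

Section Cyclotomic.
Variables (N : splittingFieldType rat) (iota : {rmorphism N -> algC}).
Variables (k : {subfield N}) (n : nat) (z : algC).
Hypothesis prim_z : n.-primitive_root z.
Implicit Type nu : {rmorphism algC -> algC}.

(* The field k(z), seen as a fixed field. *)
Definition adjoin_root : set algC :=
  [set x | forall nu, fixes iota k nu -> nu z = z -> nu x = x].

Lemma adjoin_root_subfield : is_subfield adjoin_root.
Proof.
split=> [nu _ _|x y Fx Fy nu fix_nu nuz|x y Fx Fy nu fix_nu nuz].
- exact: rmorph1.
- by rewrite rmorphB Fx ?Fy.
- by rewrite fmorph_div Fx ?Fy.
Qed.

Lemma rmorph_prim_root nu : exists j : 'I_n, nu z = z ^+ j.
Proof.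
have [|j Dj] := prim_rootP prim_z (_ : nu z ^+ n = 1); last by exists j.
by rewrite -rmorphXn prim_expr_order // rmorph1.
Qed.

Lemma adjoin_root_eq nu1 nu2 x : adjoin_root x -> fixes iota k nu1 ->
  fixes iota k nu2 -> nu1 z = nu2 z -> nu1 x = nu2 x.
Proof.
move=> Fx fix1 fix2 eq_z.
rewrite -[nu1 x](algC_invautK nu2); congr (nu2 _).
apply: (Fx (algC_invaut nu2 \o nu1)) => [y ky /=|/=].
  by rewrite fix1 // -{1}(fix2 y) // algC_autK.
by rewrite eq_z algC_autK.
Qed.

Lemma adjoin_root_stable nu x : fixes iota k nu -> adjoin_root x -> adjoin_root (nu x).
Proof.
move=> fix_nu Fx mu fix_mu mu_z.
apply: (@adjoin_root_eq (mu \o nu) nu) => // [y ky|] /=.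
  by rewrite fix_nu // fix_mu.
by have [j ->] := rmorph_prim_root nu; rewrite rmorphXn /= mu_z.
Qed.

Variables (v : algC -> rat) (r : nat).
Hypotheses (hv : valuation v r) (r_n : ~~ (r %| n)%N).

(* An extension generated by roots of unity of order prime to r is unramified:
   its inertia group is trivial, so some trace from k(z) to k has the same
   valuation as x. *)
Lemma val_adjoin_root x : adjoin_root x -> x != 0 ->
  exists y, [/\ y \in k, y != 0 & v (iota y) = v x].
Proof.
move=> Fx nzx; have hF := adjoin_root_subfield.
pose H (j : 'I_n) := `[< exists2 nu, fixes iota k nu & nu z = z ^+ j >].
pose I := {j : 'I_n | H j}.
have /choice[nu nuP] : forall j : I, exists nu,
    fixes iota k nu /\ nu z = z ^+ (val j : 'I_n).
  by case=> j /= /asboolP[nu ? ?]; exists nu.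
have nuF (i : I) y : adjoin_root y -> adjoin_root (nu i y).
  by apply: adjoin_root_stable; case: (nuP i).
(* x is replaced by w, of the same value but no less divisible at its conjugates, so that the
   quotients [c i] are integral. *)
have [y [[Fy Ay] nzy vy dom]] := exists_dominated_multiple hv hF nu Fx nzx.
pose w := x * y; have nzw : w != 0 by rewrite mulf_neq0.
have vw : v w = v x by rewrite (valM hv) // vy addr0.
have Fw : adjoin_root w by apply: (subfieldM hF).
pose T : pred I := fun j => z ^+ (val j : 'I_n) == z.
pose c i := nu i w / w.
have n_gt0 := prim_order_gt0 prim_z.
pose j1 := Ordinal (ltn_pmod 1 n_gt0).
have z_j1 : z ^+ j1 = z by rewrite /= (prim_expr_mod prim_z).
have H1 : H j1 by apply/asboolP; exists idfun => //=; rewrite z_j1.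
have T1 : T =1 pred1 (exist _ j1 H1).
  move=> j; rewrite /T /= -val_eqE /= -{2}[z]z_j1 (eq_prim_root_expr prim_z) /=.
  by rewrite !modn_mod modn_small.
(* Otherwise independence puts the sum of the [c i] over T in the maximal ideal. T consists of the
   identity alone, whose coefficient is 1; the other automorphisms move z by a unit. *)
have [t [[Ft At] mt]] : exists t,
    (adjoin_root t /\ t \in algint) /\ ~~ vgt v 0 (\sum_i c i * nu i t).
  apply: contrapT => no.
  have [fix1 nu1z] := nuP (exist _ j1 H1).
  have c1 : c (exist _ j1 H1) = 1.
    by rewrite /c (Fw _ fix1) ?mulfV // nu1z z_j1.
  suff : vgt v 0 (\sum_(i | T i) c i) by rewrite (big_pred1 _ T1) c1 (vmax_1 hv).
  apply: (residue_independence hv hF nuF).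
  - move=> i u /eqP zi [Fu _].
    by have [fixi nuiz] := nuP i; rewrite Fu ?subrr ?vgt0 // nuiz.
  - move=> i zi; exists z.
      split=> //=; apply: (@algint_root_monic _ ('X^n - 1)).
      + by rewrite monicXnsubC.
      + by rewrite /root !hornerE prim_expr_order // subrr.
      + by rewrite rpredB ?rpredX ?polyOverX ?rpred1.
    have [_ ->] := nuP i.
    have nzz : z != 0 by rewrite (prim_root_eq0 prim_z) -lt0n.
    have unit_z : v z = 0.
      have : v (z ^+ n) = 0 by rewrite prim_expr_order // (val1 hv).
      rewrite (valX hv) // => /eqP; rewrite mulf_eq0 pnatr_eq0 (gtn_eqF n_gt0) orbF.
      by move/eqP.
    have -> : z ^+ (val i : 'I_n) - z = z * (z ^+ (val i : 'I_n) / z - 1) by field.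
    rewrite (vmax_M_unit hv) // (unity_root_neq1 hv r_n) //.
      by rewrite expr_div_n -exprM mulnC exprM !(prim_expr_order prim_z) expr1n divr1.
    by apply: contra_neq zi => /divr1_eq.
  - move=> i; have := dom i; rewrite -/w -vw /c => dwi.
    rewrite -(subrr (v w)) -(valV hv) //.
    by apply: (vgeM hv) => //; rewrite /vge lexx orbT.
  - move=> u Ou; apply: contrapT => /negP mu; apply: no; exists u.
    by split.
pose tr := \sum_i nu i (w * t).
have Dtr : tr = w * \sum_i c i * nu i t.
  rewrite mulr_sumr; apply: eq_bigr => i _; rewrite rmorphM /c.
  by field.
have ge_c : vge v 0 (\sum_i c i * nu i t).
  apply: (vge_sum hv) => i _; apply: (vint_M hv); last first.
    by apply/(vint_algint hv); rewrite algint_rmorph.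
  have := dom i; rewrite -/w -vw /c => dwi.
  rewrite -(subrr (v w)) -(valV hv) //.
  by apply: (vgeM hv) => //; rewrite /vge lexx orbT.
have [nzc vc] := vunitP ge_c mt.
have [y' ky' Dy'] : exists2 y, y \in k & iota y = tr.
  apply: fixed_in_subfield => mu fix_mu.
  have hP (i : I) : exists j : I, mu (z ^+ (val i : 'I_n)) = z ^+ (val j : 'I_n).
    have [fixi nuiz] := nuP i; have [j Dj] := rmorph_prim_root (mu \o nu i).
    have Hj : H j.
      by apply/asboolP; exists (mu \o nu i) => // u ku; rewrite /= fixi // fix_mu.
    by exists (exist _ j Hj); rewrite /= -Dj /= nuiz.
  have [h hE] := choice hP.
  have inj_h : injective h.
    move=> i j eq_h; have := hE i; rewrite eq_h -hE => /fmorph_inj /eqP.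
    rewrite (eq_prim_root_expr prim_z) !modn_small // => /eqP eq_ij.
    by apply/val_inj/val_inj.
  rewrite [RHS](reindex_inj inj_h) /= rmorph_sum; apply: eq_bigr => i _.
  have [fixi nuiz] := nuP i; have [fixj nujz] := nuP (h i).
  apply: (@adjoin_root_eq (mu \o nu i)) => //=.
  - by apply: (subfieldM hF).
  - by move=> u ku; rewrite /= fixi // fix_mu.
  - by rewrite nuiz nujz -hE.
exists y'; split=> //.
  by rewrite -(fmorph_eq0 iota) Dy' Dtr mulf_neq0.
by rewrite Dy' Dtr (valM hv) // vc addr0.
Qed.

End Cyclotomic.

(** * Kronecker's theorem on algebraic integers of absolute value 1 *)

Lemma coef_prod_XsubC_le (s : seq algC) i :
  (forall x, x \in s -> `|x| <= 1) ->
  `|(\prod_(x <- s) ('X - x%:P))`_i| <= 2 ^+ size s.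
Proof.
elim: s i => [|x s IHs] i le1.
  by rewrite big_nil expr0 coefC; case: (i == 0%N); rewrite ?normr1 ?normr0 ?ler01 //.
have le1s y : y \in s -> `|y| <= 1 by move=> sy; apply: le1; rewrite inE sy orbT.
rewrite big_cons mulrBl coefB coefXM coefCM exprS mulr_natl mulr2n.
apply: le_trans (ler_normB _ _) _; apply: lerD.
  by case: (i == 0%N); [rewrite normr0 exprn_ge0 | apply: IHs].
rewrite normrM; apply: le_trans (ler_pM _ _ (le1 x _) (IHs i le1s)) _ => //.
  by rewrite inE eqxx.
by rewrite mul1r.
Qed.

(* Kronecker: the powers of x are roots of finitely many integer polynomials. *)
Lemma kronecker_unity_root (x : algC) : x \in algint ->
    (forall mu : {rmorphism algC -> algC}, `|mu x| = 1) ->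
  exists2 m, (0 < m)%N & x ^+ m = 1.
Proof.
move=> Ax norm1.
have [M [f fP]] := exists_splitting_container [:: x].
have [|y Dy] := fP x; first by rewrite inE.
have /galois_fixedField fixQ := galois_subfield_rat (1%AS : {subfield M}).
pose Gal := enum ('Gal({:M} / 1))%g.
pose conj i := [seq f (g (y ^+ i)) | g : gal_of {:M} <- Gal].
pose P i := \prod_(z <- conj i) ('X - z%:P).
have conjP i z : z \in conj i -> exists mu : {rmorphism algC -> algC}, z = mu (x ^+ i).
  case/mapP => g _ ->; have [mu muE] := extend_gal f g.
  by exists mu; rewrite -Dy -rmorphXn muE.
have Pint i j : exists c : int, (P i)`_j = c%:~R.
  have Pf : P i = map_poly f (\prod_(g in 'Gal({:M} / 1)%g) ('X - (g (y ^+ i))%:P)).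
    rewrite /P /conj big_map -big_enum rmorph_prod; apply: eq_bigr => g _.
    by rewrite /= map_polyXsubC.
  have : (\prod_(g in 'Gal({:M} / 1)%g) ('X - (g (y ^+ i))%:P))`_j
      \in fixedField ('Gal({:M} / 1))%g.
    apply/fixedFieldP; first exact: memvf.
    move=> h galh; rewrite -coef_map rmorph_prod /=; congr (polyseq _)`_j.
    rewrite [RHS](reindex_inj (mulIg h)) /=; apply: eq_big => [g|g galg].
      by rewrite groupMr.
    by rewrite map_polyXsubC /= galM ?memvf.
  rewrite fixQ.
  case/vlineP => c Dc; have PE : (P i)`_j = ratr c.
    by rewrite Pf coef_map /= Dc -in_algE fmorph_eq_rat fmorph_rat.
  rewrite PE; have [|a ->] := @algint_rat _ (ratr : {rmorphism rat -> algC}) c.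
    rewrite /= -PE; have : P i \is a polyOver algint.
      rewrite /P big_seq; apply: rpred_prod => z /conjP[mu ->].
      by rewrite rpredB ?polyOverX ?polyOverC ?algint_rmorph ?rpredX.
    by move/polyOverP.
  by exists a; rewrite rmorph_int.
pose d := size Gal; have szP i : size (P i) = d.+1.
  by rewrite size_prod_XsubC size_map.
have /choice[c cP] : forall ij : nat * nat, exists c : int, (P ij.1)`_ij.2 = c%:~R.
  by case=> i j; apply: Pint.
have cB i j : (`|c (i, j)| <= 2 ^ d)%N.
  rewrite -(ler_nat algC) natrX natr_absz intr_norm -(cP (i, j)) /=.
  rewrite -[d](size_map (fun g : gal_of {:M} => f (g (y ^+ i)))).
  apply: coef_prod_XsubC_le => z /conjP[mu ->].
  by rewrite rmorphXn normrX norm1 expr1n.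
pose roots (p : {poly algC}) := sval (closed_field_poly_normal p).
have rootsP i : x ^+ i \in roots (P i) /\ size (roots (P i)) = d.
  rewrite /roots; case: closed_field_poly_normal => s /= Ds.
  have lcP : lead_coef (P i) = 1 by apply/monicP/monic_prod_XsubC.
  rewrite lcP scale1r in Ds; split.
    rewrite -root_prod_XsubC -Ds root_prod_XsubC.
    apply/mapP; exists (1%g : gal_of {:M}); first by rewrite mem_enum group1.
    by rewrite gal_id rmorphXn /= Dy.
  by have := szP i; rewrite Ds size_prod_XsubC => -[].
(* The power x^i is recovered from the polynomial of its conjugates and from its index among the
   roots. The coefficients are integers bounded by 2^d, so there are finitely many codes. *)
pose code i : {ffun 'I_d.+1 -> bool * 'I_(2 ^ d).+1} * 'I_d.+1 :=
  ([ffun j : 'I_d.+1 => (c (i, val j) < 0, inord `|c (i, val j)|%N)],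
   inord (index (x ^+ i) (roots (P i)))).
have [i [j [lt_ij]]] := nat_pigeonhole code.
case=> /ffunP eq_c eq_idx.
have eqP : P i = P j.
  apply/polyP => l; have [lt_l|le_l] := ltnP l d.+1; last first.
    by rewrite !nth_default // szP.
  rewrite (cP (i, l)) (cP (j, l)); congr _%:~R.
  have := eq_c (Ordinal lt_l); rewrite !ffunE /= => -[sg /(congr1 val) /=].
  rewrite !inordK ?ltnS // => ab.
  by rewrite (intEsign (c (i, l))) (intEsign (c (j, l))) sg ab.
have lt_d m : (index (x ^+ m) (roots (P m)) < d.+1)%N.
  by have [xm sm] := rootsP m; rewrite -sm ltnS ltnW // index_mem.
have {}eq_idx : index (x ^+ i) (roots (P i)) = index (x ^+ j) (roots (P j)).
  by move/(congr1 val): eq_idx; rewrite /= !inordK.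
have eq_x : x ^+ i = x ^+ j.
  have [mi _] := rootsP i; have [mj _] := rootsP j.
  by rewrite -(nth_index 0 mi) -(nth_index 0 mj) -eq_idx eqP.
have nzx : x != 0.
  by rewrite -normr_eq0 (norm1 idfun) oner_neq0.
exists (j - i)%N; rewrite ?subn_gt0 //.
apply: (mulfI (expf_neq0 i nzx)).
by rewrite -exprD subnKC ?mulr1 // ltnW.
Qed.

(** * Conjugates of a root of unity over a linearly disjoint field *)

Section LinearDisjointness.
Variables (N : splittingFieldType rat) (iota : {rmorphism N -> algC}).
Variables (K : {subfield N}) (l : nat) (z : algC).
Hypothesis prim_z : l.-primitive_root z.
Hypothesis disj : lin_disjoint rat_field (iota @` [set` K]) (field_gen [set z]).

Lemma field_gen_sub (A : set algC) : A `<=` field_gen A.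
Proof. by move=> x Ax F [_]; apply. Qed.

Lemma field_gen_subfield (A : set algC) : is_subfield (field_gen A).
Proof.
split=> [F [[F1 _ _] _] //|x y Gx Gy F FA|x y Gx Gy F FA].
  by case: (FA) => -[_ h _] _; apply: h; [apply: Gx | apply: Gy].
by case: (FA) => -[_ _ h] _; apply: h; [apply: Gx | apply: Gy].
Qed.

(** If y is irrational, 1 and y are independent over the rationals, yet y * 1 - 1 * y = 0 is a
    relation over Q(z). *)
Lemma lin_disjoint_rat y : y \in K -> field_gen [set z] (iota y) ->
  exists c : rat, iota y = ratr c.
Proof.
move=> Ky Gy; apply: contrapT => nrat.
pose x (i : 'I_2) : algC := if i == ord0 then 1 else iota y.
have Kx i : (iota @` [set` K]) (x i).
  rewrite /x; case: ifP => _; last by exists y.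
  by exists 1; rewrite /= ?rpred1 ?rmorph1.
have ind : lin_indep rat_field x.
  move=> c Qc; rewrite !big_ord_recl big_ord0 addr0 /x /= mulr1.
  set c0 := c ord0; set c1 := c _ => c01.
  have [a _ Da] := Qc ord0; have [b _ Db] := Qc (lift ord0 ord0).
  have [c1_0|nz1] := eqVneq c1 0.
    move: c01; rewrite c1_0 mul0r addr0 => c0_0 i.
    case: (unliftP ord0 i) => [j ->|-> //]; rewrite (ord1 j); exact: c1_0.
  case: nrat; exists (- a / b).
  rewrite fmorph_div rmorphN /= Da Db -/c0 -/c1.
  apply: (mulIf nz1); rewrite divfK // mulrC; apply/eqP.
  by rewrite -addr_eq0 addrC c01.
pose c (i : 'I_2) : algC := if i == ord0 then iota y else -1.
have hG := field_gen_subfield [set z].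
have Gc i : field_gen [set z] (c i).
  rewrite /c; case: ifP => _ //.
  by exact: (subfieldN hG (subfield1 hG)).
have := @disj 2 x Kx ind c Gc.
rewrite !big_ord_recl big_ord0 addr0 /x /c /= mulr1 mulN1r subrr => /(_ erefl).
move/(_ (lift ord0 ord0)) => /eqP; rewrite /= oppr_eq0 oner_eq0 //.
Qed.

(* The conjugates of z over K are roots of a polynomial with coefficients in K
   and Q(z), hence in Q. *)
Lemma lin_disjoint_conjugate a : coprime a l ->
  exists2 nu, fixes iota K nu & nu z = z ^+ a.
Proof.
move=> co_al.
pose H (y : algC) := `[< exists2 nu, fixes iota K nu & nu z = y >].
pose s := [seq y <- [seq z ^+ j | j <- index_iota 0 l] | H y].
have Us : uniq s.
  rewrite filter_uniq // map_inj_in_uniq ?iota_uniq // => i j.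
  rewrite !mem_index_iota /= => lt_i lt_j /eqP.
  by rewrite (eq_prim_root_expr prim_z) !modn_small // => /eqP.
have sP y : y \in s <-> exists2 nu, fixes iota K nu & nu z = y.
  rewrite mem_filter; split=> [/andP[/asboolP]//|[nu fix_nu Dy]].
  apply/andP; split; first by apply/asboolP; exists nu.
  have [j Dj] := rmorph_prim_root prim_z nu.
  by rewrite -Dy Dj; apply: map_f; rewrite mem_index_iota /=.
pose f := \prod_(y <- s) ('X - y%:P).
have fK i : exists2 y, y \in K & iota y = f`_i.
  apply: fixed_in_subfield => mu fix_mu; rewrite -coef_map rmorph_prod /=.
  congr (polyseq _)`_i; under eq_bigr do rewrite map_polyXsubC /=.
  rewrite -(big_map mu predT (fun y => 'X - y%:P)); apply: perm_big.
  have Ums : uniq [seq mu y | y <- s] by rewrite map_inj_uniq //; apply: fmorph_inj.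
  apply: uniq_perm => //; apply: (uniq_min_size Ums _ _).2; last by rewrite size_map.
  move=> _ /mapP[y /sP[nu fix_nu <-] ->]; apply/sP.
  by exists (mu \o nu) => // x Kx; rewrite /= fix_nu // fix_mu.
have hG := field_gen_subfield [set z].
have Gf i : field_gen [set z] f`_i.
  rewrite /f; have : {subset s <= [pred y | `[< field_gen [set z] y >]]}.
    move=> y /sP[nu _ <-]; have [j ->] := rmorph_prim_root prim_z nu.
    by apply/asboolP; apply: (subfieldX hG); apply: field_gen_sub.
  elim: (s) i => [|y t IHt] i st.
    by rewrite big_nil coef1; apply: (subfield_nat hG).
  have Gt j : field_gen [set z] (\prod_(y <- t) ('X - y%:P))`_j.
    by apply: IHt => u tu; apply: st; rewrite inE tu orbT.
  rewrite big_cons mulrBl coefB coefXM coefCM; apply: (subfieldB hG).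
    by case: ifP => _ //; apply: (subfield0 hG).
  apply: (subfieldM hG) => //; apply/asboolP/st; by rewrite inE eqxx.
have fQ i : exists c : rat, f`_i = ratr c.
  by have [y Ky Dy] := fK i; rewrite -Dy; apply: lin_disjoint_rat; rewrite ?Dy.
have [u uE] := Qn_aut_exists co_al.
have uz : u z = z ^+ a by apply/uE/prim_expr_order.
have uf : map_poly u f = f.
  by apply/polyP => i; rewrite coef_map; have [c ->] := fQ i; rewrite /= fmorph_rat.
have : z ^+ a \in s.
  rewrite -root_prod_XsubC -/f -uf -uz fmorph_root root_prod_XsubC.
  by apply/sP; exists idfun.
by move/sP.
Qed.

End LinearDisjointness.

(** * Ramification exponents and valuations *)

Section Ramification.
Variables (v : algC -> rat) (r : nat).
Hypothesis hv : valuation v r.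
Variable N : splittingFieldType rat.
Implicit Types (iota : {rmorphism N -> algC}) (k K : {subfield N}).

Definition center iota K : set N :=
  [set x | int_ring K x /\ vgt v 0 (iota x)].

Lemma int_ring_vint iota K x : int_ring K x -> vge v 0 (iota x).
Proof. by move=> /(int_ring_algint iota) Ax; apply: (vint_algint hv). Qed.

Lemma center_char iota K : center iota K r%:R.
Proof. by split; [exact: (int_ring_int K r) | rewrite rmorph_nat (vmax_char hv)]. Qed.

Lemma center_prime iota K : prime_of K (center iota K).
Proof.
split.
- split=> [x []//||x y [Ox mx] [Oy my]|a x Oa [Ox mx]].
  + by split; [exact: (int_ring_int K 0) | rewrite rmorph0 vgt0].
  + by split; [exact: int_ringD | rewrite rmorphD (vgtD hv)].
  + by split; [exact: int_ringM | rewrite rmorphM (vmax_Ml hv (int_ring_vint iota Oa))].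
- split; first by exists r%:R; apply: center_char.
  move=> C0; have := center_char iota K; rewrite C0 => /eqP.
  by rewrite numfield_natr_eq0 => /eqP r0; have := val_prime hv; rewrite r0.
- by move=> [_]; rewrite rmorph1 (vmax_1 hv).
move=> x y Ox Oy [_]; rewrite rmorphM.
by case/(vmax_prod hv (int_ring_vint iota Ox) (int_ring_vint iota Oy)); [left | right].
Qed.

Lemma val_fraction_subfield iota K x : x \in K -> vge v 0 (iota x) ->
  exists b, [/\ int_ring K b, int_ring K (b * x), b != 0 & v (iota b) = 0].
Proof.
move=> Kx ox; have [p1 [p2 /= [Ab Abx Dbx nzb vb]]] := val_fraction hv ox.
have KZ p : (map_poly intr p).[x] \in K.
  by rewrite rpred_horner //; apply/polyOverP=> i; rewrite coef_map rpred_int.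
have iZ p : (map_poly intr p).[iota x] = iota (map_poly intr p).[x].
  rewrite -horner_map -map_poly_comp; congr _.[_]; apply: eq_map_poly => a /=.
  by rewrite rmorph_int.
rewrite !iZ in Ab Abx Dbx nzb vb; exists (map_poly intr p1).[x]; split=> //.
- by apply/int_ringP; rewrite KZ -(algint_rmorph iota).
- by apply/int_ringP; rewrite rpredM ?KZ // -(algint_rmorph iota) rmorphM.
- by rewrite -(fmorph_eq0 iota).
Qed.

Lemma integral_representative iota K x : x \in K -> x != 0 -> 0 <= v (iota x) ->
  exists y, [/\ int_ring K y, y != 0 & v (iota y) = v (iota x)].
Proof.
move=> Kx nzx vx.
have [|b [Ob Obx nzb vb]] := @val_fraction_subfield iota K x Kx.
  by rewrite /vge vx orbT.
exists (b * x); split=> //; first by rewrite mulf_neq0.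
by rewrite rmorphM (valM hv) ?fmorph_eq0 // vb add0r.
Qed.

Section Exponent.
Variables (iota : {rmorphism N -> algC}) (K : {subfield N}) (t : N).
Hypotheses (Kt : t \in K) (nzt : t != 0) (vt : 0 < v (iota t)).
Hypothesis t_gen :
  forall x, x \in K -> x != 0 -> exists i : int, v (iota x) = v (iota t) * i%:~R.
Local Notation P := (center iota K).
Let g := v (iota t).

Let vge_center x : P x -> vge v g (iota x).
Proof.
move=> [Ox]; rewrite /vgt /vge fmorph_eq0; have [//|nzx] /= := eqVneq x 0.
have [|i ->] := t_gen _ nzx; first by case: Ox.
by rewrite pmulr_rgt0 // ltr0z => i_gt0; apply: ler_peMr; rewrite ?(ltW vt) // ler1z -gtz0_ge1.
Qed.

Let vge_exp n x : ideal_exp K P n x -> vge v (g * n%:R) (iota x).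
Proof.
elim: n x => [|n IHn] x; first by rewrite mulr0; apply: int_ring_vint.
case=> m [a [b [Pa Pb ->]]]; rewrite rmorph_sum; apply: (vge_sum hv) => i _.
rewrite rmorphM mulrS mulrDr mulr1; apply: (vgeM hv); first exact: vge_center.
exact: IHn (Pb i).
Qed.

(** Induction on n, dividing by P through [ideal_divE]. The quotient loses at most g in value: P has
    an element y of value g, and multiplying it by any element of the inverse of P gives an
    integer. *)
Let dvd_exp n I : is_ideal K I -> (forall x, I x -> vge v (g * n%:R) (iota x)) ->
  ideal_dvd K (ideal_exp K P n) I.
Proof.
elim: n I => [|n IHn] I hI vI.
  exists I => //=; case: (hI) => IO I0 ID IM; apply/seteqP; split=> [x Ix|].
    rewrite -[x]mul1r; apply: lincomb_mem => //.
    exact: (int_ring_int K 1).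
  exact: lincomb_ind.
have IP : I `<=` P.
  move=> x Ix; split; first by case: hI => h _ _ _; apply: h.
  apply: (vge_gt (c := g * n.+1%:R)); last exact: vI.
  by rewrite mulr_gt0 // ltr0n.
have [hJ DI] := ideal_divE (center_prime iota K) hI IP.
have [y [Oy nzy vy]] := integral_representative Kt nzt (ltW vt).
have Py : P y by split=> //; rewrite /vgt vy vt orbT.
have [|M hM DJ] := IHn _ hJ.
  apply: lincomb_ind => [|x z|u x [Ku uP] Ix].
  - by rewrite rmorph0 vge0.
  - by rewrite rmorphD; apply: (vgeD hv).
  have [->|nzu] := eqVneq u 0; first by rewrite mul0r rmorph0 vge0.
  have [->|nzx] := eqVneq x 0; first by rewrite mulr0 rmorph0 vge0.
  have /(int_ring_vint iota) := uP y Py; have := vI x Ix.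
  rewrite /vge !rmorphM !mulf_eq0 !fmorph_eq0 (negPf nzx) (negPf nzy) (negPf nzu) /=.
  rewrite !(valM hv) ?fmorph_eq0 // vy mulrS mulrDr mulr1 -/g.
  by move=> h1 h2; lra.
by exists M => //; rewrite [LHS]DI [X in ideal_mul P X = _]DJ ideal_mulA.
Qed.

(** The index i of the value group of k in that of K is compared with e: the divisibility by P^e is
    tested on an element of p of least value, and the failure at the next power bounds i because all
    of p O_K is at least that divisible. *)
Lemma ram_exponent_val k p e : (k <= K)%VS -> lies_over k P p ->
    ram_exponent K p P e ->
  (exists a, [/\ a \in k, a != 0 & v (iota a) = g * e%:R]) /\
  forall x, x \in k -> x != 0 -> exists i : int, v (iota x) = g * e%:R * i%:~R.
Proof.
move=> /subvP kK Dp [dvd_e ndvd_e].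
have [a0 [ka0 nza0 va0 gen_k]] := val_uniformizer hv iota k.
have [i Di] := t_gen (kK _ ka0) nza0.
have i_gt0 : 0 < i by move: va0; rewrite Di pmulr_rgt0 // ltr0z.
have [a [Oa nza va]] := integral_representative ka0 nza0 (ltW va0).
have OK x : int_ring k x -> int_ring K x.
  by move=> /int_ringP[kx Ax]; apply/int_ringP; rewrite kK.
have pa : p a.
  rewrite -Dp; split; last by case: Oa.
  by split; [exact: OK | rewrite /vgt va va0 orbT].
suff Dei : i = e%:Z.
  rewrite Dei -pmulrn in Di; split; first by exists a0.
  by move=> x kx nzx; have [j ->] := gen_k x kx nzx; exists j; rewrite Di.
have pO x : ideal_mul p (int_ring K) x -> vge v (v (iota a0)) (iota x).
  move=> px; have : [set y | vge v (v (iota a0)) (iota y)] x; last by [].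
  apply: lincomb_ind px => [|y z|y z py Oz] /=.
  - by rewrite rmorph0 vge0.
  - by rewrite rmorphD; apply: (vgeD hv).
  rewrite rmorphM -[v (iota a0)]addr0; apply: (vgeM hv); last exact: int_ring_vint Oz.
  move: py; rewrite -Dp => -[[Oy my] ky].
  move: my; rewrite /vgt /vge fmorph_eq0; have [//|nzy] /= := eqVneq y 0.
  have [j ->] := gen_k y ky nzy.
  by rewrite pmulr_rgt0 // ltr0z => j_gt0; apply: ler_peMr; rewrite ?(ltW va0) // ler1z -gtz0_ge1.
apply/eqP; rewrite eq_le; apply/andP; split.
  rewrite leNgt; apply/negP => lt_ei; apply: ndvd_e; apply: dvd_exp => [|x /pO].
    split=> [|||].
    - apply: lincomb_ind => [|x y|x y]; [exact: (int_ring_int K 0) | exact: int_ringD |].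
      by rewrite -Dp => -[[Ox _] _]; apply: int_ringM.
    - exact: lincomb0.
    - by move=> x y; apply: lincombD.
    - move=> x _ Ox [n [b [c [pb Oc ->]]]]; rewrite mulr_sumr.
      elim/big_ind: _ => [||j _]; [exact: lincomb0 | by move=> *; apply: lincombD |].
      by rewrite mulrCA; apply: lincomb_mem => //; apply: int_ringM.
  apply: vge_trans; rewrite Di; apply: ler_wpM2l; first exact: ltW.
  by rewrite pmulrn ler_int -addn1 PoszD lezD1.
have [M [MO _ _ _] DM] := dvd_e.
have : ideal_mul p (int_ring K) a.
  by rewrite -[a]mulr1; apply: lincomb_mem => //; exact: (int_ring_int K 1).
rewrite DM => -[n [x [y [ex My Da]]]].
have : vge v (g * e%:R) (iota a).
  rewrite Da rmorph_sum; apply: (vge_sum hv) => j _; rewrite rmorphM -[g * _]addr0.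
  by apply: (vgeM hv); [exact: vge_exp | apply: int_ring_vint; apply: MO].
rewrite /vge fmorph_eq0 (negPf nza) /= va Di ler_pM2l // pmulrn.
by rewrite ler_int.
Qed.

End Exponent.

(** Otherwise prime avoidance gives x in P1 outside every conjugate of the center. Its norm to k
    lies in p, hence in the center, although no factor of the norm does. *)
Lemma prime_conjugate iota k K p P1 : galois k K -> prime_of K P1 ->
    lies_over k P1 p -> lies_over k (center iota K) p ->
  exists2 s, s \in 'Gal(K / k)%g & P1 = center (iota \o s) K.
Proof.
move=> galK hP1 over1 over2; apply: contrapT => no.
have [r1 [pr_r1 P1r1]] := prime_ideal_char hP1.
have Og (s : gal_of K) x : int_ring K x -> int_ring K (s x).
  move=> /int_ringP[Kx Ax]; apply/int_ringP; split; first by rewrite memv_gal.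
  by rewrite algint_rmorph.
have sep s : s \in 'Gal(K / k)%g -> exists2 x, P1 x & ~ center (iota \o s) K x.
  move=> gals; apply: contrapT => nsep; apply: no; exists s => //.
  have sub x : P1 x -> center (iota \o s) K x.
    by move=> P1x; apply: contrapT => nx; apply: nsep; exists x.
  apply/seteqP; split=> // x Cx; apply: contrapT => nP1x.
  have [y Oy /sub C1] := prime_ideal_max hP1 pr_r1 P1r1 Cx.1 nP1x.
  have [[_ _ CD CM] _ C_1 _] := center_prime (iota \o s) K.
  by apply: C_1; rewrite -[1](subrK (y * x)); apply: CD => //; apply: CM.
have avoid (t : seq (gal_of K)) : {subset t <= 'Gal(K / k)%g} -> exists2 x, P1 x &
    forall s, s \in t -> ~ center (iota \o s) K x.
  have [[P1O P10 P1D P1M] _ _ _] := hP1.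
  elim: t => [_|s t IHt st]; first by exists 0.
  have [|x P1x nx] := IHt; first by move=> u tu; apply: st; rewrite inE tu orbT.
  have [Cx|nCx] := pselect (center (iota \o s) K x); last first.
    by exists x => // u; rewrite inE => /predU1P[->|/nx].
  have [|xs P1xs nxs] := sep s; first by apply: st; rewrite inE eqxx.
  (* Such z exist because one center cannot contain the other: the one at u is maximal, and x lies
     in the one at s only. *)
  have /choice[z zP] : forall u, exists z, u \in t ->
      center (iota \o u) K z /\ ~ center (iota \o s) K z.
    move=> u; have [tu|] := boolP (u \in t); last by exists 0.
    apply: contrapT => nz.
    have sub z : center (iota \o u) K z -> center (iota \o s) K z.
      by move=> Cz; apply: contrapT => nCz; apply: nz; exists z.
    have [y Oy /sub C1] := prime_ideal_max (center_prime (iota \o u) K)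
      (val_prime hv) (center_char _ K) Cx.1 (nx u tu).
    have [[_ _ CD CM] _ C_1 _] := center_prime (iota \o s) K.
    by apply: C_1; rewrite -[1](subrK (y * x)); apply: CD => //; apply: CM.
  pose w := \prod_(u <- t) z u.
  have Oz u : u \in t -> int_ring K (z u) by move=> /zP[[]].
  have Ow : int_ring K w.
    rewrite /w big_seq; elim/big_ind: _ => [|a b|u /Oz//]; last exact: int_ringM.
    exact: (int_ring_int K 1).
  have Cw u : u \in t -> center (iota \o u) K w.
    move=> tu; rewrite /w (big_rem u) //= mulrC.
    have [[_ _ _ CM] _ _ _] := center_prime (iota \o u) K.
    apply: CM; last by case: (zP u tu).
    rewrite big_seq; elim/big_ind: _ => [|a b|u' /mem_rem/Oz//]; last exact: int_ringM.
    exact: (int_ring_int K 1).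
  have nCw : ~ center (iota \o s) K w.
    have [_ _ C_1 Cpr] := center_prime (iota \o s) K.
    rewrite /w; elim: (t) zP Oz => [_ _|u t' IHt' zP' Oz']; first by rewrite big_nil.
    have Ou : int_ring K (z u) by apply: Oz'; rewrite inE eqxx.
    have Ot' : int_ring K (\prod_(j <- t') z j).
      rewrite big_seq; elim/big_ind: _ => [|a b|u' tu'].
      - exact: (int_ring_int K 1).
      - exact: int_ringM.
      - by apply: Oz'; rewrite inE tu' orbT.
    rewrite big_cons => /(Cpr _ _ Ou Ot')[].
      by have [|_] := zP' u; rewrite ?inE ?eqxx.
    by apply: IHt' => u' tu'; [apply: zP' | apply: Oz']; rewrite inE tu' orbT.
  exists (x + w * xs); first by apply: P1D => //; apply: P1M.
  move=> u; rewrite inE => /predU1P[->|tu] Cu.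
    have [[_ _ CD CM] _ _ Cpr] := center_prime (iota \o s) K.
    have : center (iota \o s) K (w * xs).
      have -> : w * xs = x + w * xs + (-1) * x by ring.
      by apply: CD => //; apply: CM => //; exact: (int_ring_int K (-1)).
    by case/(Cpr _ _ Ow (P1O _ P1xs)).
  apply: (nx u tu); have [[_ _ CD CM] _ _ _] := center_prime (iota \o u) K.
  have -> : x = x + w * xs + (- xs) * w by ring.
  apply: CD => //; apply: CM; last exact: Cw.
  have -> : - xs = 0 - xs by rewrite sub0r.
  by apply: int_ringB; [exact: (int_ring_int K 0) | exact: P1O].
have [|x P1x nx] := avoid (enum 'Gal(K / k)%g); first by move=> s; rewrite mem_enum.
have [[P1O _ _ P1M] _ _ _] := hP1.
have Ox := P1O x P1x.
have P1N : P1 (galNorm k K x).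
  rewrite /galNorm (bigD1 1%g) ?group1 //= gal_id mulrC; apply: P1M => //.
  elim/big_ind: _ => [|a b|s _]; [exact: (int_ring_int K 1) | exact: int_ringM | exact: Og].
have : p (galNorm k K x).
  by rewrite -over1; split=> //; apply: mem_galNorm => //; case: Ox.
rewrite -over2 => -[[_ mN] _]; move: mN; apply/negP.
rewrite /galNorm rmorph_prod -big_enum /=.
have : {in enum 'Gal(K / k)%g, forall s : gal_of K, vgt v 0 (iota (s x)) = false}.
  move=> s /nx nCs; apply/negP => ms; apply: nCs; split=> //.
elim: (enum _) => [_|s t IHt nt]; first by rewrite big_nil (vmax_1 hv).
rewrite big_cons; have ns := nt s (mem_head _ _).
have [|nzs vs] := vunitP (x := iota (s x)) _ (negbT ns).
  by apply: int_ring_vint; apply: Og Ox.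
rewrite (vmax_M_unit hv) //; apply: IHt => u tu; apply: nt; rewrite inE tu orbT //.
Qed.

End Ramification.

(** * Tame inertia and resolvents *)

Section FrobeniusCongruence.
Variables (v : algC -> rat) (r : nat).
Hypothesis hv : valuation v r.
Local Notation mx x := (vgt v 0 x).
Local Notation ox x := (vge v 0 x).

Lemma frobenius_add a b : ox a -> ox b -> mx ((a + b) ^+ r - (a ^+ r + b ^+ r)).
Proof.
move=> oa ob; have pr_r := val_prime hv.
have [r' Dr] : exists r', r = r'.+1 by case: (r) pr_r => // m; exists m.
rewrite Dr in pr_r *; rewrite exprDn big_ord_recl big_ord_recr /=.
rewrite subn0 expr0 mulr1 bin0 mulr1n /bump /= add1n subnn expr0 mul1r binn mulr1n.
set S := \sum_(i < r') _.
have -> : a ^+ r'.+1 + (S + b ^+ r'.+1) - (a ^+ r'.+1 + b ^+ r'.+1) = S by ring.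
apply: (vgt_sum hv) => i _; rewrite -mulr_natr; apply: (vmax_Ml hv).
  by apply: (vint_M hv); apply: (vint_X hv).
by rewrite (vmax_nat hv) Dr prime_dvd_bin //= add1n ltnS ltn_ord.
Qed.

Lemma frobenius_sub a b : ox a -> ox b -> mx (a ^+ r - b ^+ r) -> mx (a - b).
Proof.
move=> oa ob mab; have oab : ox (a - b) by apply: (vgeB hv).
apply: (vmax_exp hv (n := r)) => //.
have := frobenius_add oab ob; rewrite subrK => h.
have -> : (a - b) ^+ r = (a ^+ r - b ^+ r) - (a ^+ r - ((a - b) ^+ r + b ^+ r)) by ring.
exact: (vgtB hv).
Qed.

Lemma frobenius_sub_iter a b i :
  ox a -> ox b -> mx (a ^+ (r ^ i) - b ^+ (r ^ i)) -> mx (a - b).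
Proof.
move=> oa ob; elim: i => [|i IHi]; first by rewrite expn0 !expr1.
by rewrite expnSr !exprM => /frobenius_sub h; apply/IHi/h; apply: (vint_X hv).
Qed.

Lemma vmax_congrM a b c d :
  ox a -> ox d -> mx (a - b) -> mx (c - d) -> mx (a * c - b * d).
Proof.
move=> oa od mab mcd.
have -> : a * c - b * d = a * (c - d) + (a - b) * d by ring.
by apply: (vgtD hv); [apply: (vmax_Ml hv) | apply: (vmax_Mr hv)].
Qed.

Lemma vmax_congrX a b n : ox a -> ox b -> mx (a - b) -> mx (a ^+ n - b ^+ n).
Proof.
move=> oa ob mab; elim: n => [|n IHn]; first by rewrite !expr0 subrr vgt0.
by rewrite !exprS; apply: vmax_congrM => //; apply: (vint_X hv).
Qed.

Lemma vmax_congr_trans a b c : mx (a - b) -> mx (b - c) -> mx (a - c).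
Proof. by move=> mab mbc; rewrite -(subrK b a) -addrA; apply: (vgtD hv). Qed.

Lemma vmax_congr_sym a b : mx (a - b) -> mx (b - a).
Proof. by rewrite -(vgtN hv) opprB. Qed.

Lemma algint_frobenius_fixed a : a \in algint ->
  exists2 f, (0 < f)%N & mx (a ^+ (r ^ f) - a).
Proof.
move=> Aa; have [i [j [R [lt_ij DR]]]] := frobenius_recurrence (val_prime hv) Aa.
have oa : ox a by apply: (vint_algint hv).
exists (j - i)%N; first by rewrite subn_gt0.
apply: (@frobenius_sub_iter _ _ i) => //; first exact: (vint_X hv).
rewrite -exprM -expnD subnK ?(ltnW lt_ij) //; apply: vmax_congr_sym; rewrite DR.
apply: (vmax_Mr hv); first exact: (vmax_char hv).
apply/(vint_algint hv)/rpred_horner => //; apply/polyOverP=> l.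
by rewrite coef_map algint_int.
Qed.

Lemma frobenius_fixed_iter a f n : ox a -> mx (a ^+ (r ^ f) - a) ->
  mx (a ^+ (r ^ (f * n)) - a).
Proof.
move=> oa ma; elim: n => [|n IHn]; first by rewrite muln0 expr1 subrr vgt0.
rewrite mulnS expnD exprM; apply: vmax_congr_trans IHn.
by apply: vmax_congrX => //; apply: (vint_X hv).
Qed.

(* Residue fields are finite, hence perfect. *)
Lemma residue_root u p1 p2 :
    p1 \in algint -> p2 \in algint -> p1 != 0 -> v p1 = 0 -> u = p2 / p1 -> ox u ->
  exists n, mx ((u ^+ n) ^+ r - u).
Proof.
move=> A1 A2 nz1 v1 Du ou.
have [f1 f1_gt0 m1] := algint_frobenius_fixed A1.
have [f2 f2_gt0 m2] := algint_frobenius_fixed A2.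
have o1 := vint_algint hv A1; have o2 := vint_algint hv A2.
have {}m1 := frobenius_fixed_iter f2 o1 m1.
have {}m2 := frobenius_fixed_iter f1 o2 m2.
rewrite mulnC in m2; pose q := (r ^ (f1 * f2))%N.
have Dq : q = (r ^ (f1 * f2).-1 * r)%N.
  by rewrite /q -expnSr prednK // muln_gt0 f1_gt0.
exists (r ^ (f1 * f2).-1)%N; rewrite -exprM -Dq.
rewrite -(vmax_M_unit hv _ (expf_neq0 q nz1)); last by rewrite (valX hv) // v1 mul0r.
have -> : p1 ^+ q * (u ^+ q - u) = (p2 ^+ q - p2) - (p1 ^+ q - p1) * u.
  by rewrite Du expr_div_n; field; rewrite nz1 expf_neq0.
by apply: (vgtB hv) => //; apply: (vmax_Mr hv).
Qed.

End FrobeniusCongruence.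

Section Inertia.
Variables (v : algC -> rat) (r : nat).
Hypothesis hv : valuation v r.
Local Notation mx x := (vgt v 0 x).
Local Notation ox x := (vge v 0 x).
Variables (N : splittingFieldType rat) (iota : {rmorphism N -> algC}).
Variables (K L : {subfield N}) (t : N) (e : nat).
Hypotheses (galKL : galois K L) (abKL : abelian 'Gal(L / K)%g).
Hypotheses (Lt : t \in L) (nzt : t != 0) (vt : 0 < v (iota t)).
Local Notation g := (v (iota t)).
Hypothesis t_gen :
  forall x, x \in L -> x != 0 -> exists i : int, v (iota x) = g * i%:~R.
Hypothesis e_gen :
  forall x, x \in K -> x != 0 -> exists i : int, v (iota x) = g * e%:R * i%:~R.
Variable a : N.
Hypotheses (Ka : a \in K) (nza : a != 0) (va : v (iota a) = g * e%:R).
Hypothesis tame_e : ~~ (r %| e)%N.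
Local Notation G := (subg_of 'Gal(L / K)).
Implicit Types (s : G) (x : N).

Definition gact s x : N := (sgval s : gal_of L) x.

Let KL : (K <= L)%VS. Proof. by case/and3P: galKL. Qed.

Let nzi x : x != 0 -> iota x != 0. Proof. by rewrite fmorph_eq0. Qed.

Lemma gact_mem s x : x \in L -> gact s x \in L.
Proof. by move=> Lx; apply: memv_gal. Qed.

Lemma gact1 x : x \in L -> gact 1%g x = x.
Proof. by move=> Lx; rewrite /gact /= gal_id. Qed.

Lemma gactM s s' x : x \in L -> gact (s * s')%g x = gact s' (gact s x).
Proof. by move=> Lx; rewrite /gact /= galM. Qed.

Lemma gact_base s x : x \in K -> gact s x = x.
Proof. by move=> Kx; apply: (fixed_gal KL (subgP s)). Qed.

Lemma gactC s s' x : x \in L -> gact s (gact s' x) = gact s' (gact s x).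
Proof.
move=> Lx; rewrite -!gactM //; congr (gact _ x); apply: val_inj => /=.
exact: (centsP abKL _ (subgP _) _ (subgP _)).
Qed.

Lemma gact_faithful s : (forall x, x \in L -> gact s x = x) -> s = 1%g.
Proof.
move=> sx; apply: val_inj => /=; apply/eqP/gal_eqP => x Lx.
by rewrite gal_id; apply: sx.
Qed.

Let gM s : {morph gact s : x y / x * y}. Proof. exact: rmorphM. Qed.
Let gB s : {morph gact s : x y / x - y}. Proof. exact: rmorphB. Qed.
Let gV s : {morph gact s : x / x^-1}. Proof. exact: fmorphV. Qed.
Let gX s n : {morph gact s : x / x ^+ n}. Proof. exact: rmorphXn. Qed.
Let gXz s (n : int) : {morph gact s : x / x ^ n}. Proof. exact: fmorphXz. Qed.
Let g_eq0 s x : (gact s x == 0) = (x == 0). Proof. exact: fmorph_eq0. Qed.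

Let O_gact s x : int_ring L x -> int_ring L (gact s x).
Proof.
move=> /int_ringP[Lx Ax]; apply/int_ringP; split; first exact: gact_mem.
by rewrite algint_rmorph.
Qed.

Definition inertia : {set G} :=
  finset (fun s => `[< forall x, int_ring L x -> mx (iota (gact s x) - iota x) >]).
Local Notation T := inertia.

Lemma inertiaP s :
  reflect (forall x, int_ring L x -> mx (iota (gact s x) - iota x)) (s \in T).
Proof. by rewrite inE; apply: asboolP. Qed.

Fact inertia_group_set : group_set T.
Proof.
apply/group_setP; split=> [|s s' /inertiaP Ts /inertiaP Ts'].
  by apply/inertiaP => x [Lx _]; rewrite gact1 // subrr vgt0.
apply/inertiaP => x Ox; have [Lx _] := Ox; rewrite gactM //.
by apply: (vmax_congr_trans hv) (Ts x Ox); apply/Ts'/O_gact.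
Qed.

Canonical inertia_group := Group inertia_group_set.

Let nu_ex s : exists nu : {rmorphism algC -> algC},
  forall x, nu (iota x) = iota (gact s x).
Proof. exact: extend_gal. Qed.

Let Top : set algC := iota @` [set` L].

Let hTop : is_subfield Top.
Proof.
split=> [|_ _ [x Lx <-] [y Ly <-]|_ _ [x Lx <-] [y Ly <-]].
- by exists 1; rewrite /= ?rpred1 ?rmorph1.
- by exists (x - y); rewrite /= ?rpredB ?rmorphB.
- by exists (x / y); rewrite /= ?rpred_div ?fmorph_div.
Qed.

Let TopO y : (Top `&` [set` algint]) y -> exists2 x, int_ring L x & y = iota x.
Proof.
move=> [[x Lx <-]]; rewrite /= algint_rmorph => Ax.
by exists x => //; apply/int_ringP.
Qed.

Lemma inertia_val s x : s \in T -> x \in L -> v (iota (gact s x)) = v (iota x).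
Proof.
move=> /inertiaP Ts Lx; have [nu nuE] := nu_ex s.
have [->|nzx] := eqVneq x 0; first by rewrite /gact rmorph0.
rewrite -nuE; apply: (rmorph_place_eq hv hTop); [|by exists x | exact: nzi].
move=> _ /TopO[y Oy ->]; rewrite nuE => my.
by rewrite -[iota y](subKr (iota (gact s y))); apply: (vgtB hv) => //; apply: Ts.
Qed.

Lemma inertia_congr s x :
  s \in T -> x \in L -> ox (iota x) -> mx (iota (gact s x) - iota x).
Proof.
move=> Ts Lx o_x; have [b [Ob Obx nzb vb]] := val_fraction_subfield hv Lx o_x.
have [Lb _] := Ob.
have nzsb : iota (gact s b) != 0 by rewrite fmorph_eq0 g_eq0.
have vsb : v (iota (gact s b)) = 0 by rewrite inertia_val.
rewrite -(vmax_M_unit hv _ nzsb vsb).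
have -> : iota (gact s b) * (iota (gact s x) - iota x) =
    (iota (gact s (b * x)) - iota (b * x)) - (iota (gact s b) - iota b) * iota x.
  by rewrite gM !rmorphM; ring.
apply: (vgtB hv); first by move/inertiaP: Ts; apply.
by apply: (vmax_Mr hv) => //; move/inertiaP: Ts; apply.
Qed.

(** The tame character is the residue of this number. Keeping the number itself makes it
    multiplicative only up to congruence. *)
Definition tame_char s : algC := iota (gact s t / t).
Local Notation tau := tame_char.

Let Lst s : gact s t / t \in L. Proof. by rewrite rpred_div ?gact_mem. Qed.
Let tau_neq0 s : tau s != 0.
Proof. by rewrite fmorph_eq0 mulf_neq0 ?invr_eq0 ?g_eq0. Qed.
Let tau_unit s : s \in T -> v (tau s) = 0.
Proof.
move=> Ts; rewrite /tau fmorph_div (valM hv) ?invr_eq0 ?fmorph_eq0 ?g_eq0 //.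
by rewrite (valV hv) ?fmorph_eq0 // inertia_val // subrr.
Qed.
Let o_tau s : s \in T -> ox (tau s). Proof. by move=> /tau_unit; apply: vint_unit. Qed.

Let tau1 : tau 1%g = 1.
Proof. by rewrite /tau gact1 // mulfV ?rmorph1. Qed.

Lemma tame_charM s s' : s \in T -> s' \in T -> mx (tau (s * s')%g - tau s * tau s').
Proof.
move=> Ts Ts'; have -> : tau (s * s')%g = iota (gact s' (gact s t / t)) * tau s'.
  rewrite /tau gactM // -rmorphM gM gV; congr (iota _).
  by field; rewrite nzt g_eq0.
rewrite -mulrBl; apply: (vmax_Mr hv); last exact: o_tau.
by apply: inertia_congr => //; apply: o_tau.
Qed.

Lemma tame_charX s n : s \in T -> mx (tau (s ^+ n)%g - tau s ^+ n).
Proof.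
move=> Ts; elim: n => [|n IHn]; first by rewrite expg0 expr0 tau1 subrr vgt0.
rewrite expgS exprS; apply: (vmax_congr_trans hv); first exact: tame_charM (groupX n Ts).
by rewrite -mulrBr; apply: (vmax_Ml hv) => //; apply: o_tau.
Qed.

(** The principal units of the valuation. *)
Definition one_unit (b : algC) := [/\ b != 0, v b = 0 & mx (b - 1)].

Lemma one_unitM b c : one_unit b -> one_unit c -> one_unit (b * c).
Proof.
move=> [nzb vb mb] [nzc vc mc]; split; first by rewrite mulf_neq0.
  by rewrite (valM hv) // vb vc addr0.
rewrite -[1]mulr1; apply: (vmax_congrM hv) => //; first exact: vint_unit.
exact: (vint_1 hv).
Qed.

Lemma one_unitV b : one_unit b -> one_unit b^-1.
Proof.
move=> [nzb vb mb]; have vb' : v b^-1 = 0 by rewrite (valV hv) // vb oppr0.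
split; rewrite ?invr_eq0 //; rewrite -(vmax_M_unit hv _ nzb vb).
by rewrite mulrBr mulfV // mulr1; apply: (vmax_congr_sym hv).
Qed.

Lemma one_unit1 : one_unit 1.
Proof. by split; rewrite ?oner_neq0 ?(val1 hv) // subrr vgt0. Qed.

Lemma one_unitX b n : one_unit b -> one_unit (b ^+ n).
Proof.
move=> ub; elim: n => [|n IHn]; first by rewrite expr0; apply: one_unit1.
by rewrite exprS; apply: one_unitM.
Qed.

Lemma one_unitXz b (n : int) : one_unit b -> one_unit (b ^ n).
Proof.
move=> ub; case: n => n; first by rewrite -exprnP; apply: one_unitX.
by rewrite NegzE -invr_expz; apply: one_unitV; rewrite -exprnP; apply: one_unitX.
Qed.

Lemma inertia_one_unit s x : s \in T -> x \in L -> x != 0 ->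
  v (iota x) = 0 -> one_unit (iota (gact s x / x)).
Proof.
move=> Ts Lx nzx vx; have vsx : v (iota (gact s x)) = 0 by rewrite inertia_val.
have nzix := nzi nzx; have nzsx : iota (gact s x) != 0 by rewrite fmorph_eq0 g_eq0.
rewrite fmorph_div; split; first by rewrite mulf_neq0 ?invr_eq0.
  by rewrite (valM hv) ?invr_eq0 // (valV hv) // vsx vx subrr.
rewrite -(vmax_M_unit hv _ nzix vx).
have -> : iota x * (iota (gact s x) / iota x - 1) = iota (gact s x) - iota x by field.
by apply: inertia_congr => //; apply: vint_unit.
Qed.

(** With x = u t^i, inertia moves the unit u by a principal unit, and t by [tau s], which is
    principal by assumption. *)
Lemma wild_one_unit s x : s \in T -> mx (tau s - 1) -> x \in L -> x != 0 ->
  one_unit (iota (gact s x / x)).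
Proof.
move=> Ts m1 Lx nzx; have [i Di] := t_gen Lx nzx.
pose u := x / t ^ i; have nzti : t ^ i != 0 by rewrite expfz_neq0.
have nzu : u != 0 by rewrite mulf_neq0 ?invr_eq0.
have Lu : u \in L by rewrite rpred_div // rpredXz.
have vu : v (iota u) = 0.
  rewrite /u fmorph_div fmorphXz (valM hv) ?invr_eq0 ?expfz_neq0 ?nzi //.
  by rewrite (valV hv) ?expfz_neq0 ?nzi // (valXz hv) ?nzi // Di subrr.
have -> : iota (gact s x / x) = iota (gact s u / u) * tau s ^ i.
  rewrite /tau -fmorphXz -rmorphM; congr (iota _).
  have -> : (gact s t / t) ^ i = gact s (t ^ i) / t ^ i.
    by rewrite gXz expfzMl expfV.
  rewrite /u gM gV; field.
  by rewrite nzx nzti g_eq0.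
apply: one_unitM; first exact: inertia_one_unit.
by apply: one_unitXz; split=> //; apply: tau_unit.
Qed.

Lemma wild_pow_one_unit s i x : s \in T -> mx (tau s - 1) -> x \in L -> x != 0 ->
  one_unit (iota (gact (s ^+ i)%g x / x)).
Proof.
move=> Ts m1; apply: wild_one_unit; first exact: groupX.
apply: (vmax_congr_trans hv) (tame_charX i Ts) _; rewrite -[1](expr1n _ i).
by apply: (vmax_congrX hv) => //; [exact: o_tau | exact: (vint_1 hv)].
Qed.

(** For d = s(x) - x the sum of the s^i(d), i < n, telescopes to 0. If d is nonzero, all quotients
    s^i(d) / d are congruent to 1, so n is congruent to 0. *)
Lemma wild_order s n : s \in T -> mx (tau s - 1) -> (s ^+ n = 1)%g ->
  ~~ (r %| n)%N -> s = 1%g.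
Proof.
move=> Ts m1 sn r_n; apply: gact_faithful => x Lx; apply: contrapT => nsx.
pose d := gact s x - x; have nzd : d != 0 by rewrite subr_eq0; apply/eqP.
have Ld : d \in L by rewrite rpredB ?gact_mem.
have sum0 : \sum_(i < n) iota (gact (s ^+ i)%g d / d) = 0.
  rewrite -rmorph_sum -mulr_suml -(big_mkord predT (fun i => gact (s ^+ i)%g d)).
  under eq_bigr => i _ do rewrite gB -gactM // -expgS.
  by rewrite telescope_sumr // sn expg0 gact1 // subrr mul0r rmorph0.
move: r_n; rewrite -(vmax_nat hv); case/negP.
have -> : n%:R = \sum_(i < n) (1 - iota (gact (s ^+ i)%g d / d)).
  by rewrite sumrB sum0 subr0 sumr_const card_ord.
apply: (vgt_sum hv) => i _; apply: (vmax_congr_sym hv).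
by case: (wild_pow_one_unit i Ts m1 Ld nzd).
Qed.

(* An automorphism of order r in the inertia group has a fixed field with the
   same value group, since r is prime to e, and the same residue field, which is
   perfect; hence it approximates, and so fixes, every element of L. *)
Lemma no_wild_inertia s : s \in T -> (s ^+ r = 1)%g -> s = 1%g.
Proof.
move=> Ts sr; have pr_r := val_prime hv.
have m1 : mx (tau s - 1).
  apply: (frobenius_sub hv); rewrite ?o_tau ?(vint_1 hv) //.
  by apply: (vmax_congr_sym hv); have := tame_charX r Ts; rewrite sr tau1 expr1n.
(* The norm of the subgroup generated by s. It differs from x^r by a principal unit, since s is
   wild. *)
pose nm x := \prod_(i < r) gact (s ^+ i)%g x.
have nm_mem x : x \in L -> nm x \in L.
  by move=> Lx; apply: rpred_prod => i _; apply: gact_mem.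
have nm_fix x : x \in L -> gact s (nm x) = nm x.
  move=> Lx; rewrite /nm /gact rmorph_prod /=.
  rewrite -(big_mkord predT (fun i => gact s (gact (s ^+ i)%g x))).
  under eq_bigr => i _ do rewrite -gactM // -expgSr.
  rewrite -(big_mkord predT (fun i => gact (s ^+ i)%g x)).
  case: r pr_r sr => // r' _ sr; rewrite big_nat_recr //= big_nat_recl //= mulrC.
  by rewrite sr expg0.
have nm_neq0 x : x != 0 -> nm x != 0.
  by move=> nzx; apply/prodf_neq0 => i _; rewrite g_eq0.
have nm_unit x : x \in L -> x != 0 -> one_unit (iota (nm x / x ^+ r)).
  move=> Lx nzx; rewrite -[r in _ ^+ r]card_ord -prodr_const -prodfV -big_split /=.
  rewrite rmorph_prod; elim/big_ind: _ => [|b c|i _]; [exact: one_unit1 | exact: one_unitM |].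
  exact: wild_pow_one_unit.
have nm_val x : x \in L -> x != 0 -> v (iota (nm x)) = v (iota x) * r%:R.
  move=> Lx nzx; have [_ + _] := nm_unit x Lx nzx.
  rewrite fmorph_div rmorphXn (valM hv) ?invr_eq0 ?expf_neq0 ?nzi ?nm_neq0 //.
  rewrite (valV hv) ?expf_neq0 ?nzi // (valX hv) ?nzi // => /eqP.
  by rewrite subr_eq0 => /eqP.
have [u [w Duw]] : exists u w, u * e%:Z + w * r%:Z = 1 by apply: prime_bezout.
have La : a \in L by apply: (subvP KL).
have nznt := nm_neq0 t nzt.
(* A uniformiser fixed by s: a has value g e, the norm of t has value g r, and u e + w r = 1. *)
pose t' := a ^ u * nm t ^ w.
have Lt' : t' \in L by rewrite rpredM ?rpredXz ?nm_mem.
have nzt' : t' != 0 by rewrite mulf_neq0 ?expfz_neq0.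
have vt' : v (iota t') = g.
  rewrite /t' rmorphM !fmorphXz (valM hv) ?expfz_neq0 ?nzi // !(valXz hv) ?nzi //.
  rewrite va nm_val // -!mulrA -mulrDr [e%:R * _]mulrC [r%:R * _]mulrC !pmulrn.
  by rewrite -!intrM -intrD Duw mulr1.
have st' : gact s t' = t' by rewrite /t' gM !gXz nm_fix // gact_base.
have approx x : x \in L -> x != 0 ->
    exists y, [/\ y \in L, gact s y = y & vgt v (v (iota x)) (iota (x - y))].
  move=> Lx nzx; have [i Di] := t_gen Lx nzx.
  pose q := x / t' ^ i; have nzti : t' ^ i != 0 by rewrite expfz_neq0.
  have nzq : q != 0 by rewrite mulf_neq0 ?invr_eq0.
  have Lq : q \in L by rewrite rpred_div // rpredXz.
  have vti : v (iota (t' ^ i)) = v (iota x) by rewrite fmorphXz (valXz hv) ?nzi // vt' Di.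
  have vq : v (iota q) = 0.
    rewrite /q fmorph_div (valM hv) ?invr_eq0 ?nzi //.
    by rewrite (valV hv) ?nzi // vti subrr.
  have oq := vint_unit vq.
  have [b [Ob Obq nzb vb]] := val_fraction_subfield hv Lq oq.
  have [|n mn] := residue_root hv (int_ring_algint iota Ob) (int_ring_algint iota Obq)
     (nzi nzb) vb _ oq.
    by rewrite [iota (b * q)]rmorphM mulrC mulKf ?nzi.
  (* z is an r-th root of q modulo the maximal ideal, so its norm, congruent to z^r, is congruent to
     q and fixed by s. *)
  pose z := q ^+ n; have nzz : z != 0 by rewrite expf_neq0.
  have Lz : z \in L by rewrite rpredX.
  have vz : v (iota (z ^+ r)) = 0.
    by rewrite !rmorphXn !(valX hv) ?expf_neq0 ?nzi // vq !mul0r.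
  exists (t' ^ i * nm z); split.
  - by rewrite rpredM ?nm_mem ?rpredXz.
  - by rewrite gM gXz st' nm_fix.
  have -> : x - t' ^ i * nm z = t' ^ i * (q - nm z) by rewrite /q; field.
  rewrite rmorphM -[v (iota x)]addr0 addrC; rewrite mulrC; apply: (vgtM hv); last first.
    by rewrite /vge vti lexx orbT.
  rewrite rmorphB; apply: (vmax_congr_trans hv (b := iota (z ^+ r))).
    by apply: (vmax_congr_sym hv); rewrite !rmorphXn.
  apply: (vmax_congr_sym hv); have [_ _ mz] := nm_unit z Lz nzz.
  have -> : iota (nm z) - iota (z ^+ r) = iota (z ^+ r) * (iota (nm z / z ^+ r) - 1).
    rewrite fmorph_div; field.
    by rewrite fmorph_eq0 expf_neq0.
  by apply: (vmax_Ml hv) => //; apply: vint_unit.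
have approxn x n : x \in L -> x != 0 -> exists y,
    [/\ y \in L, gact s y = y & vge v (v (iota x) + g * n%:R) (iota (x - y))].
  move=> Lx nzx; elim: n => [|n [y [Ly sy vy]]].
    by exists 0; rewrite rpred0 /gact rmorph0 subr0 mulr0 addr0 /vge lexx orbT.
  have [xy|nzxy] := eqVneq (x - y) 0; first by exists y; split=> //; rewrite xy rmorph0 vge0.
  have Lxy : x - y \in L by rewrite rpredB.
  have [y' [Ly' sy' vy']] := approx _ Lxy nzxy.
  exists (y + y'); split; [exact: rpredD | by rewrite /gact rmorphD /=; congr (_ + _) |].
  rewrite opprD addrA.
  have [->|nzd] := eqVneq (x - y - y') 0; first by rewrite rmorph0 vge0.
  have [i Di] := t_gen Lxy nzxy.
  have [j Dj] : exists j : int, v (iota (x - y - y')) = g * j%:~R.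
    by apply: t_gen; rewrite // rpredB.
  have [l Dl] := t_gen Lx nzx.
  move: vy vy'; rewrite /vge /vgt !fmorph_eq0 (negPf nzxy) (negPf nzd) /=.
  rewrite Di Dj Dl -!mulrDr ler_pM2l // ltr_pM2l // ler_pM2l // !pmulrn -!intrD ler_int ltr_int.
  by rewrite ler_int -addn1 PoszD => h1 h2; clear -h1 h2; lia.
apply: gact_faithful => x Lx; have [->|nzx] := eqVneq x 0; first by rewrite /gact rmorph0.
apply: contrapT => nsx; pose d := gact s x - x.
have nzd : d != 0 by rewrite subr_eq0; apply/eqP.
have [i Di] : exists i : int, v (iota d) = g * i%:~R.
  by apply: t_gen; rewrite // rpredB ?gact_mem.
have [l Dl] := t_gen Lx nzx.
(* The precision exceeds the value of d = s(x) - x, which is also s(x - y) - (x - y) because s fixes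
   y. *)
have [y [Ly sy vy]] := approxn x (absz (i - l + 1)) Lx nzx.
have : vge v (v (iota x) + g * (absz (i - l + 1))%:R) (iota d).
  have -> : d = gact s (x - y) - (x - y) by rewrite gB sy /d; ring.
  rewrite rmorphB; apply: (vgeB hv) => //.
  have [xy|nzxy] := eqVneq (x - y) 0; first by rewrite xy /gact rmorph0 rmorph0 vge0.
  move: vy; rewrite /vge !fmorph_eq0 ?g_eq0 (negPf nzxy) /= inertia_val //.
  by rewrite rpredB.
rewrite /vge fmorph_eq0 (negPf nzd) /= Di Dl -mulrDr ler_pM2l // pmulrn -intrD ler_int.
by move=> h; clear -h; lia.
Qed.

(** The kernel of the tame character is closed under powers, so by Cauchy's theorem it would contain
    an element of prime order n. [wild_order] excludes n different from r, and [no_wild_inertia]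
    excludes n = r. *)
Lemma tame_char_inj s : s \in T -> mx (tau s - 1) -> s = 1%g.
Proof.
move=> Ts m1; apply/eqP; rewrite -order_eq1; apply: contraT => ns1.
have o_gt1 : (1 < #[s]%g)%N by rewrite ltn_neqAle eq_sym ns1 order_gt0.
pose n := pdiv #[s]%g; have pr_n : prime n by apply: pdiv_prime.
have [s' /cycleP[i Ds'] os'] := Cauchy pr_n (pdiv_dvd #[s]%g).
have Ts' : s' \in T by rewrite Ds'; apply: groupX.
have m1' : mx (tau s' - 1).
  rewrite Ds'; apply: (vmax_congr_trans hv) (tame_charX _ Ts) _.
  rewrite -[1](expr1n _ i).
  by apply: (vmax_congrX hv) => //; [exact: o_tau | exact: (vint_1 hv)].
have s'n : (s' ^+ n = 1)%g by rewrite -os' expg_order.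
have : s' = 1%g.
  have [r_n|] := boolP (r %| n)%N; last exact: wild_order Ts' m1' s'n.
  apply: no_wild_inertia Ts' _.
  by move: r_n; rewrite dvdn_prime2 ?(val_prime hv) // => /eqP ->.
by move/eqP; rewrite -order_eq1 os' => /eqP n1; rewrite n1 in pr_n.
Qed.

Lemma inertia_card_tame : ~~ (r %| #|T|)%N.
Proof.
apply/negP => /(Cauchy (val_prime hv))[s Ts os].
have := no_wild_inertia Ts; rewrite -os expg_order => /(_ erefl) s1.
by have := val_prime hv; rewrite -os s1 order1.
Qed.

Definition resolvent (c : G -> algC) x : algC := \sum_s c s * iota (gact s x).

Hypothesis Ot : int_ring L t.

(** Take w = t^j y with y a unit making the conjugates of w no less divisible than w. On inertia
    s(w) / w is congruent to [tau s ^+ j], so by independence some z makes the resolvent of w z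
    equal to w times a unit. *)
Lemma resolvent_val (c : G -> algC) (j : nat) : (forall s, ox (c s)) ->
    ~~ mx (\sum_(s in T) c s * tau s ^+ j) ->
  exists x, [/\ int_ring L x, resolvent c x != 0 & v (resolvent c x) = g * j%:R].
Proof.
move=> oc nmS; have [nu nuE] := choice nu_ex.
have nzw0 : iota (t ^+ j) != 0 by rewrite nzi ?expf_neq0.
have Tw0 : Top (iota (t ^+ j)) by exists (t ^+ j) => //=; rewrite rpredX.
have nuTop s y : Top y -> Top (nu s y).
  by move=> [x Lx <-]; exists (gact s x) => //=; apply: gact_mem.
have [_ [/TopO[y Oy ->] nzy vy dom]] := exists_dominated_multiple hv hTop nu Tw0 nzw0.
rewrite fmorph_eq0 in nzy.
pose w := t ^+ j * y; have nzw : w != 0 by rewrite mulf_neq0 ?expf_neq0.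
have [Ly _] := Oy; have Lw : w \in L by rewrite rpredM ?rpredX.
have vw : v (iota w) = g * j%:R.
  by rewrite rmorphM rmorphXn (valM hv) ?expf_neq0 ?nzi // (valX hv) ?nzi // vy addr0.
have {}dom s : vge v (v (iota w)) (iota (gact s w)).
  by rewrite vw -(valX hv) ?nzi // -rmorphXn -nuE rmorphM; apply: dom.
have o_div s : ox (iota (gact s w) / iota w).
  rewrite -(subrr (v (iota w))) -(valV hv) ?nzi //.
  by apply: (vgeM hv) => //; rewrite /vge lexx orbT.
pose d s := c s * (iota (gact s w) / iota w).
have od s : ox (d s) by apply: (vint_M hv).
have [z Oz nmz] : exists2 z, int_ring L z & ~~ mx (\sum_s d s * iota (gact s z)).
  apply: contrapT => no; case/negP: nmS.
  have dT : mx (\sum_(s in T) d s).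
    apply: (residue_independence hv hTop (nu := nu) nuTop (T := fun s => s \in T)) => //.
    - by move=> s _ Ts /TopO[x Ox ->]; rewrite nuE; move/inertiaP: Ts; apply.
    - move=> s nTs; apply: contrapT => ns; case/negP: nTs; apply/inertiaP => x Ox.
      apply: contrapT => /negP mx_; apply: ns; exists (iota x); last by rewrite nuE.
      by split; [exists x => //; case: Ox | apply: int_ring_algint Ox].
    move=> _ /TopO[x Ox ->]; apply: contrapT => /negP mx_; apply: no; exists x => //.
    by under eq_bigr do rewrite -nuE.
  have -> : \sum_(s in T) c s * tau s ^+ j =
      \sum_(s in T) d s - \sum_(s in T) c s * (iota (gact s w) / iota w - tau s ^+ j).
    by rewrite -sumrB; apply: eq_bigr => s _; rewrite /d; ring.
  apply: (vgtB hv) => //; apply: (vgt_sum hv) => s Ts; apply: (vmax_Ml hv) => //.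
  have -> : iota (gact s w) / iota w - tau s ^+ j = tau s ^+ j * (iota (gact s y / y) - 1).
    rewrite /tau -!fmorph_div -!rmorphXn mulrBr mulr1 -rmorphM; congr (iota _ - _).
    rewrite /w gM gX expr_div_n; field.
    by rewrite nzy expf_neq0.
  apply: (vmax_Ml hv); first by apply: (vint_X hv); apply: o_tau.
  by have [_ _] := inertia_one_unit Ts Ly nzy vy.
have oS : ox (\sum_s d s * iota (gact s z)).
  by apply: (vge_sum hv) => s _; apply: (vint_M hv) => //;
    exact: (int_ring_vint hv iota (O_gact s Oz)).
have [nzS vS] := vunitP oS nmz.
have DS : resolvent c (w * z) = iota w * \sum_s d s * iota (gact s z).
  rewrite mulr_sumr; apply: eq_bigr => s _; rewrite gM rmorphM /d.
  by field; rewrite nzi.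
exists (w * z); rewrite DS; split.
- apply: int_ringM => //; apply: int_ringM => //; have [_ At] := (int_ringP L t).1 Ot.
  by apply/int_ringP; rewrite !rpredX.
- by rewrite mulf_neq0 ?nzi.
- by rewrite (valM hv) ?nzi // vS addr0.
Qed.

(** For c = 1 and j = #|T| the sum over inertia is congruent to #|T|, a unit. The resolvent is then
    a trace of value g #|T|; as it lies in K, its value is a multiple of g e. *)
Lemma ramification_dvd_inertia : (e %| #|T|)%N.
Proof.
have [|x [Ox nzS vS]] := @resolvent_val (fun=> 1) #|T| (fun=> vint_1 hv).
  move: inertia_card_tame; rewrite -(vmax_nat hv); apply: contra => mS.
  have -> : #|T|%:R = \sum_(s in T) 1 * tau s ^+ #|T| +
      \sum_(s in T) (tau (s ^+ #|T|)%g - tau s ^+ #|T|).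
    rewrite sumrB; under [X in _ = X + _]eq_bigr do rewrite mul1r.
    rewrite addrC subrK -sumr_const; apply: eq_bigr => s Ts.
    by rewrite expg_cardG ?tau1.
  by apply: (vgtD hv) => //; apply: (vgt_sum hv) => s Ts; apply: tame_charX.
have [Lx _] := Ox.
have Dtr : resolvent (fun=> 1) x = iota (galTrace K L x).
  rewrite /resolvent /galTrace rmorph_sum.
  under eq_bigr do rewrite mul1r.
  rewrite (reindex_onto (fun s : G => sgval s) (subg _)) /=; last exact: subgK.
  by apply: eq_bigl => s; rewrite subgP sgvalK eqxx.
have Ktr : galTrace K L x \in K by apply: mem_galTrace.
rewrite Dtr in nzS vS; rewrite fmorph_eq0 in nzS.
have [i] := e_gen Ktr nzS; rewrite vS -mulrA => /(mulfI (lt0r_neq0 vt)) /eqP.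
rewrite !pmulrn -intrM eqr_int => /eqP Di.
by have : (e%:Z %| #|T|%:Z)%Z by rewrite Di dvdz_mulr.
Qed.

(* A geometric sum in j: only s = 1 contributes modulo the maximal ideal. *)
Lemma resolvent_upper (c : G -> algC) : (0 < e)%N -> (forall s, ox (c s)) -> c 1%g = 1 ->
  exists x, [/\ int_ring L x, resolvent c x != 0 & v (resolvent c x) < g * e%:R].
Proof.
move=> e_gt0 oc c1; suff [j nm] : exists j : 'I_e, ~~ mx (\sum_(s in T) c s * tau s ^+ j).
  have [x [Ox nzS vS]] := resolvent_val oc nm; exists x; split=> //.
  by rewrite vS ltr_pM2l // ltr_nat.
apply: contrapT => no; move: tame_e; rewrite -(vmax_nat hv); case/negP.
have -> : e%:R = \sum_(j < e) \sum_(s in T) c s * tau s ^+ j -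
    \sum_(s in T | s != 1%g) c s * \sum_(j < e) tau s ^+ j.
  rewrite exchange_big /= (bigD1 1%g) ?group1 //= -addrA.
  under [X in _ = _ + (X - _)]eq_bigr do rewrite -mulr_sumr.
  rewrite subrr addr0 c1 tau1; under eq_bigr do rewrite expr1n mulr1.
  by rewrite sumr_const card_ord.
apply: (vgtB hv).
  by apply: (vgt_sum hv) => j _; apply: contrapT => /negP nm; apply: no; exists j.
apply: (vgt_sum hv) => s /andP[Ts ns1]; apply: (vmax_Ml hv) => //.
have me : mx (tau s ^+ e - 1).
  pose u := t ^+ e / a; have nzu : u != 0 by rewrite mulf_neq0 ?invr_eq0 ?expf_neq0.
  have La : a \in L by apply: (subvP KL).
  have Lu : u \in L by rewrite rpred_div ?rpredX.
  have vu : v (iota u) = 0.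
    rewrite fmorph_div rmorphXn (valM hv) ?invr_eq0 ?expf_neq0 ?nzi //.
    by rewrite (valV hv) ?nzi // (valX hv) ?nzi // va subrr.
  have -> : tau s ^+ e = iota (gact s u / u).
    rewrite /tau -rmorphXn expr_div_n /u gM gV gX (gact_base s Ka); congr (iota _).
    by field; rewrite nza expf_neq0.
  by case: (inertia_one_unit Ts Lu nzu vu).
move: me; rewrite subrX1 => /(vmax_prod hv)[| |m1|//].
- by apply: (vgeB hv); [exact: o_tau | exact: (vint_1 hv)].
- by apply: (vge_sum hv) => j _; apply: (vint_X hv); apply: o_tau.
by rewrite (tame_char_inj Ts m1) eqxx in ns1.
Qed.

(** Replacing x by s0(x) divides the resolvent by [c s0] but does not change it modulo the maximal
    ideal, and [c s0 - 1] is a unit. *)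
Lemma resolvent_ramified (c : G -> algC) s0 n :
    (forall s s', c (s * s')%g = c s * c s') -> (forall s, ox (c s)) ->
    s0 \in T -> c s0 != 1 -> c s0 ^+ n = 1 -> ~~ (r %| n)%N ->
  forall x, int_ring L x -> mx (resolvent c x).
Proof.
move=> cM oc Ts0 ns0 c_n r_n x Ox; have [Lx _] := Ox.
have m_unit := unity_root_neq1 hv r_n c_n ns0.
have [||nzu vu] := vunitP (x := c s0 - 1) (v := v); [|by rewrite m_unit|].
  by apply: (vgeB hv) => //; exact: (vint_1 hv).
rewrite -(vmax_M_unit hv _ nzu vu).
have -> : (c s0 - 1) * resolvent c x =
    \sum_s c s0 * c s * (iota (gact s x) - iota (gact s0 (gact s x))).
  rewrite mulrBl mul1r {2}/resolvent (reindex_inj (mulgI s0)) /= mulr_sumr -sumrB.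
  apply: eq_bigr => s _; rewrite cM gactM // gactC //; ring.
apply: (vgt_sum hv) => s _; apply: (vmax_Ml hv); first exact: (vint_M hv).
by apply: (vmax_congr_sym hv); move/inertiaP: Ts0; apply; apply: O_gact.
Qed.

End Inertia.

(** * Orders of the group algebra *)

Section GroupAlgebraTheory.
Variables (R : comNzRingType) (gT : finGroupType).
Local Notation A := (group_algebra R gT).
Implicit Types x y : A.

Lemma ga_coefD x y s : ga_coef (x + y) s = ga_coef x s + ga_coef y s.
Proof. by rewrite /ga_coef ffunE. Qed.

Lemma ga_coefZ c x s : ga_coef (c *: x) s = c * ga_coef x s.
Proof. by rewrite /ga_coef ffunE. Qed.

Lemma ga_coef1 s : ga_coef (1 : A) s = (s == 1%g)%:R.
Proof. by rewrite /ga_coef ffunE. Qed.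

Lemma ga_coefM x y s :
  ga_coef (x * y) s = \sum_h ga_coef x h * ga_coef y (h^-1 * s)%g.
Proof. by rewrite /ga_coef ffunE. Qed.

Lemma ga_coefP x y : (forall s, ga_coef x s = ga_coef y s) -> x = y.
Proof. by move=> eq_xy; apply/ffunP => s; apply: eq_xy. Qed.

Lemma ga_mulC x y : (forall g h : gT, (g * h = h * g)%g) -> x * y = y * x.
Proof.
move=> mulC; apply: ga_coefP => s; rewrite !ga_coefM.
rewrite (reindex_inj (inj_comp (mulgI s) invg_inj)) /=; apply: eq_bigr => h _.
by rewrite mulrC invMg invgK mulgKV mulC.
Qed.

Lemma ga_scaleAr c x y : (forall g h : gT, (g * h = h * g)%g) -> c *: (x * y) = x * (c *: y).
Proof. by move=> ab; rewrite [x * y]ga_mulC // scalerAl ga_mulC. Qed.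

End GroupAlgebraTheory.

Section LinCombAlgebra.
Variables (K : comNzRingType) (A : lmodType K) (O : set K).
Hypotheses (O0 : O 0) (OD : forall a b, O a -> O b -> O (a + b)).

Lemma lincomb_seqP (s : seq A) x : lincomb *:%R O [set` s] x ->
  exists a : 'I_(size s) -> K, (forall i, O (a i)) /\ x = \sum_i a i *: s`_i.
Proof.
move: x; apply: lincomb_ind.
- exists (fun=> 0); split=> //; rewrite big1 // => i _; exact: scale0r.
- move=> _ _ [a [Oa ->]] [b [Ob ->]]; exists (fun i => a i + b i); split=> [i|].
    exact: OD.
  by rewrite -big_split; apply: eq_bigr => i _; rewrite scalerDl.
move=> a y Oa /= sy; have lt_i : (index y s < size s)%N by rewrite index_mem.
exists (fun i => if i == Ordinal lt_i then a else 0); split=> [i|].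
  by case: ifP.
rewrite (bigD1 (Ordinal lt_i)) //= eqxx nth_index // big1 ?addr0 // => i /negPf ->.
exact: scale0r.
Qed.

End LinCombAlgebra.

Section Orders.
Variables (N : splittingFieldType rat) (K L : {subfield N}).
Hypothesis galKL : galois K L.
Hypothesis abKL : abelian 'Gal(L / K)%g.
Local Notation G := (subg_of 'Gal(L / K)).
Local Notation KG := (group_algebra (subvs_of K) G).
Local Notation OK := (@OK N K).

Lemma subg_mulC (s s' : G) : (s * s' = s' * s)%g.
Proof. by apply: val_inj => /=; exact: (centsP abKL _ (subgP _) _ (subgP _)). Qed.

Let KGC (x y : KG) : x * y = y * x. Proof. exact: ga_mulC subg_mulC. Qed.

Let OKP c : OK c <-> vsval c \in algint.
Proof. by rewrite /OK /=; split=> [/int_ringP[]//|Ac]; apply/int_ringP; rewrite subvsP. Qed.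

Let OK0 : OK 0. Proof. by apply/OKP; rewrite rmorph0 rpred0. Qed.
Let OK1 : OK 1. Proof. by apply/OKP; rewrite rmorph1 rpred1. Qed.
Let OKD a b : OK a -> OK b -> OK (a + b).
Proof. by move=> /OKP Aa /OKP Ab; apply/OKP; rewrite rmorphD rpredD. Qed.
Let OKM a b : OK a -> OK b -> OK (a * b).
Proof. by move=> /OKP Aa /OKP Ab; apply/OKP; rewrite rpredM. Qed.

Section OneOrder.
Variable M : set KG.
Hypothesis hM : is_order M.

Lemma order1 : M 1. Proof. by case: hM. Qed.

Lemma orderB x y : M x -> M y -> M (x - y). Proof. by case: hM => _ h _ _ _; apply: h. Qed.

Lemma orderM x y : M x -> M y -> M (x * y). Proof. by case: hM => _ _ h _ _; apply: h. Qed.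

Lemma order0 : M 0. Proof. by rewrite -(subrr 1); apply: orderB; apply: order1. Qed.

Lemma orderD x y : M x -> M y -> M (x + y).
Proof.
move=> Mx My; rewrite -[y]opprK; apply: orderB => //.
by rewrite -sub0r; apply: orderB => //; apply: order0.
Qed.

Lemma orderZ c x : OK c -> M x -> M (c *: x).
Proof.
case: hM => _ _ _ [s ->] _ Oc [n [a [b [Oa sb ->]]]]; rewrite scaler_sumr.
under eq_bigr do rewrite scalerA.
by apply: lincombP_sum => // i; apply: OKM.
Qed.

Lemma order_multiple (x : KG) : exists2 n : nat, (0 < n)%N & M (n%:R *: x).
Proof.
have [_ _ _ _ span] := hM.
have natO n : OK n%:R by apply/OKP; rewrite rmorph_nat rpred_nat.
have : lincomb *:%R setT M x by rewrite span.
move: x; apply: lincomb_ind.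
- by exists 1%N => //; rewrite scaler0; apply: order0.
- move=> x y [n n_gt0 Mx] [m m_gt0 My]; exists (n * m)%N; first by rewrite muln_gt0 n_gt0.
  rewrite scalerDr natrM [X in X *: x + _]mulrC -!scalerA.
  by apply: orderD; apply: orderZ => //; apply: natO.
move=> c x _ Mx; have [q [cq _ qx]] := numfield_primitive (vsval c).
have nzq : q != 0 by rewrite -zcontents_eq0 cq.
have [m Dm] : exists m, size q = m.+2.
  have nzqN : map_poly intr q != 0 :> {poly N}.
    rewrite -size_poly_eq0 size_map_inj_poly ?size_poly_eq0 // => c1 c2 eq_c.
    apply: (@intr_inj rat); apply: (fmorph_inj (in_alg N)).
    by rewrite !rmorph_int.
  have := root_size_gt1 nzqN qx; move/leq_trans/(_ (size_poly _ _)).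
  by case: (size q) => [|[|m]] // _; exists m.
have Dl : lead_coef q = q`_m.+1 by rewrite lead_coefE Dm.
(* The size of q is m + 2, so this tail is the leading coefficient times c plus an integer; hence
   that multiple of c is integral. *)
have := algint_drop_poly m qx.
have -> : drop_poly m q = (q`_m.+1)%:P * 'X + (q`_m)%:P.
  apply/polyP => -[|[|i]]; rewrite coef_drop_poly coefD coefMX !coefC /= ?add0r ?addr0 //.
  by rewrite nth_default // Dm; clear; lia.
rewrite rmorphD rmorphM /= map_polyX !map_polyC hornerMXaddC hornerC /= => Ac.
have {}Ac : (lead_coef q)%:~R * vsval c \in algint.
  by rewrite Dl -[_ * _](addrK (q`_m)%:~R) rpredB // algint_int.
exists `|lead_coef q|%N; first by rewrite absz_gt0 lead_coef_eq0.
rewrite scalerA; apply: orderZ => //; apply/OKP.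
rewrite rmorphM rmorph_nat /=.
have [le0|lt0] := leP 0 (lead_coef q).
  by rewrite pmulrn gez0_abs.
rewrite pmulrn ltz0_abs // mulrNz mulNr rpredN //.
Qed.

Variable iota : {rmorphism N -> algC}.
Variable chi : G -> algC.
Hypothesis chiM : forall s s', chi (s * s')%g = chi s * chi s'.
Hypothesis chi1 : chi 1%g = 1.

Let vsvalD (c d : subvs_of K) : vsval (c + d) = vsval c + vsval d.
Proof. exact: linearD. Qed.
Let vsvalM (c d : subvs_of K) : vsval (c * d) = vsval c * vsval d.
Proof. exact: rmorphM. Qed.
Let vsval_sum (I : finType) (F : I -> subvs_of K) :
  vsval (\sum_i F i) = \sum_i vsval (F i).
Proof. exact: linear_sum. Qed.

Definition ga_eval (x : KG) : algC := \sum_s iota (vsval (ga_coef x s)) * chi s.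

Lemma ga_evalD x y : ga_eval (x + y) = ga_eval x + ga_eval y.
Proof.
rewrite -big_split; apply: eq_bigr => s _.
by rewrite ga_coefD vsvalD rmorphD mulrDl.
Qed.

Lemma ga_evalZ c x : ga_eval (c *: x) = iota (vsval c) * ga_eval x.
Proof.
rewrite mulr_sumr; apply: eq_bigr => s _.
by rewrite ga_coefZ vsvalM rmorphM mulrA.
Qed.

Lemma ga_eval1 : ga_eval 1 = 1.
Proof.
rewrite /ga_eval (bigD1 1%g) //= ga_coef1 eqxx chi1 mulr1 rmorph1 rmorph1.
by rewrite big1 ?addr0 // => s /negPf ns;
  rewrite ga_coef1 ns mulr0n (linear0 (vsval : subvs_of K -> N)) rmorph0 mul0r.
Qed.

Lemma ga_evalM x y : ga_eval (x * y) = ga_eval x * ga_eval y.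
Proof.
rewrite /ga_eval mulr_suml.
under eq_bigr => s _ do rewrite ga_coefM vsval_sum rmorph_sum mulr_suml.
rewrite exchange_big; apply: eq_bigr => h _; rewrite mulr_sumr.
rewrite (reindex_inj (mulgI h)) /=; apply: eq_bigr => s _.
by rewrite mulKg rmorphM chiM mulrACA.
Qed.

(** Multiplication by x preserves the finitely generated module M, so the values of chi at its
    generators form an eigenvector for the value at x; it is nonzero because M contains 1. *)
Lemma ga_eval_algint x : M x -> ga_eval x \in algint.
Proof.
move=> Mx; have [_ _ _ [s DM] _] := hM.
have Ms i : (i < size s)%N -> M s`_i.
  move=> lt_i; rewrite DM -[s`_i]scale1r; apply: lincomb_mem => //=.
  exact: mem_nth.
have /fin_all_exists[a aP] : forall i : 'I_(size s), exists a : 'I_(size s) -> subvs_of K,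
    (forall j, OK (a j)) /\ x * s`_i = \sum_j a j *: s`_j.
  move=> i; apply: (lincomb_seqP OK0 OKD); rewrite -DM; apply: orderM => //.
  exact: Ms.
have evs n (F : 'I_n -> KG) : ga_eval (\sum_i F i) = \sum_i ga_eval (F i).
  apply: (big_morph ga_eval ga_evalD); rewrite /ga_eval big1 // => g _.
  by rewrite /ga_coef ffunE (linear0 (vsval : subvs_of K -> N)) rmorph0 mul0r.
apply: (@algint_eigen _ _ (fun i : 'I_(size s) => ga_eval s`_i)
  (\matrix_(i, j) iota (vsval (a i j)))) => [|i j|i].
- apply: contrapT => no; have [b [_ D1]] : exists b : 'I_(size s) -> subvs_of K,
      (forall j, OK (b j)) /\ 1 = \sum_j b j *: s`_j.
    by apply: (lincomb_seqP OK0 OKD); rewrite -DM; apply: order1.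
  have := ga_eval1; rewrite {1}D1 evs big1 => [|j _].
    by move/esym/eqP; rewrite oner_eq0.
  rewrite ga_evalZ; suff -> : ga_eval s`_j = 0 by rewrite mulr0.
  by apply: contrapT => /eqP nz; apply: no; exists j.
- by rewrite mxE algint_rmorph; apply/OKP; case: (aP i).
rewrite -ga_evalM; have [_ ->] := aP i; rewrite evs; apply: eq_bigr => j _.
by rewrite ga_evalZ mxE.
Qed.

End OneOrder.

(** The algebra is commutative, so two orders generate a common larger order, their product. Hence a
    maximal order contains all orders and is stable under every automorphism of the situation. *)
Lemma order_mul (M M' : set KG) : is_order M -> is_order M' ->
  is_order (lincomb *%R M M').
Proof.
move=> hM hM'; have [_ _ _ [s DM] span] := hM; have [_ _ _ [s' DM'] _] := hM'.
have mulN x y : lincomb *%R M M' x -> lincomb *%R M M' y -> lincomb *%R M M' (x - y).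
  move=> Mx [n [a [b [Ma Mb ->]]]]; apply: lincombD => //; rewrite -sumrN.
  under eq_bigr do rewrite -mulNr.
  apply: lincombP_sum => // i; rewrite -sub0r.
  by apply: (orderB hM) => //; apply: (order0 hM).
split=> //.
- by rewrite -[1]mulr1; apply: lincomb_mem; apply: order1.
- move=> x y Mx [n [c [d [Mc Md ->]]]]; rewrite mulr_sumr.
  elim/big_ind: _ => [||i _]; [exact: lincomb0 | by move=> *; apply: lincombD |].
  case: Mx => m [a [b [Ma Mb ->]]]; rewrite mulr_suml.
  elim/big_ind: _ => [||j _]; [exact: lincomb0 | by move=> *; apply: lincombD |].
  have -> : a j * b j * (c i * d i) = (a j * c i) * (b j * d i).
    by rewrite mulrA -[a j * b j * c i]mulrA [b j * c i]KGC !mulrA.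
  by apply: lincomb_mem; [apply: (orderM hM) | apply: (orderM hM')].
- exists [seq x * y | x <- s, y <- s']; apply/seteqP; split.
    apply: lincomb_ind => [|x y|x y]; [exact: lincomb0 | exact: lincombD |].
    rewrite DM DM' => -[n [a [b [Oa sb ->]]]] [m [c [d [Oc sd ->]]]]; rewrite mulr_suml.
    elim/big_ind: _ => [||i _]; [exact: lincomb0 | by move=> *; apply: lincombD |].
    rewrite mulr_sumr.
    elim/big_ind: _ => [||j _]; [exact: lincomb0 | by move=> *; apply: lincombD |].
    rewrite -scalerAl -(ga_scaleAr _ _ _ subg_mulC) scalerA.
    apply: lincomb_mem; first exact: OKM.
    by apply/allpairsP; exists (b i, d j); split=> //; [apply: sb | apply: sd].
  apply: lincomb_ind => [|x y|c x Oc /= /allpairsP[[y z] /= [sy sz ->]]].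
  - exact: lincomb0.
  - exact: lincombD.
  rewrite scalerAl; apply: lincomb_mem.
    apply: (orderZ hM) => //; rewrite DM -[y]scale1r; exact: lincomb_mem.
  by rewrite DM' -[z]scale1r; apply: lincomb_mem.
apply/seteqP; split=> // x _; have : lincomb *:%R setT M x by rewrite span.
move: x; apply: lincomb_ind => [|x y|c x _ Mx]; [exact: lincomb0 | exact: lincombD |].
apply: lincomb_mem => //; rewrite -[x]mulr1; apply: lincomb_mem => //.
exact: order1.
Qed.

Lemma maximal_order_contains (M M' : set KG) :
  is_maximal_order M -> is_order M' -> M' `<=` M.
Proof.
move=> [hM maxM] hM'; have hP := order_mul hM hM'.
rewrite -(maxM _ hP) => [x Mx|x Mx].
  by rewrite -[x]mul1r; apply: lincomb_mem => //; apply: (order1 hM).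
by rewrite -[x]mulr1; apply: lincomb_mem => //; apply: (order1 hM').
Qed.

End Orders.

(** * Galois action on the group algebra and freeness of lattices *)

Section Action.
Variables (N : splittingFieldType rat) (k K L : {subfield N}).
Hypotheses (galkL : galois k L) (abkL : abelian 'Gal(L / k)%g).
Hypotheses (kK : (k <= K)%VS) (KL : (K <= L)%VS).
Local Notation G := (subg_of 'Gal(L / K)).
Local Notation KG := (group_algebra (subvs_of K) G).
Implicit Types (x y : KG) (s : G) (b : N).

Lemma gal_tower : galois K L.
Proof. by apply: galoisS galkL; rewrite kK. Qed.

Lemma gal_sub_tower : ('Gal(L / K) \subset 'Gal(L / k))%g.
Proof. exact: galS. Qed.

Lemma abelian_tower : abelian 'Gal(L / K)%g.
Proof. exact: abelianS gal_sub_tower abkL. Qed.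

Lemma gal_lower : galois k K.
Proof.
have /galois_fixedField <- := gal_tower.
apply: (normal_fixedField_galois galkL); rewrite /normal gal_sub_tower.
by apply: sub_abelian_norm => //; apply: gal_sub_tower.
Qed.

Let galKL := gal_tower.
Let abKL := abelian_tower.

Lemma gal_commute (h h' : gal_of L) b : h \in 'Gal(L / k)%g -> h' \in 'Gal(L / k)%g ->
  b \in L -> h (h' b) = h' (h b).
Proof.
by move=> gh gh' Lb; rewrite -!galM //; congr ((_ : gal_of L) b); apply: (centsP abkL).
Qed.

Lemma gal_gact (h : gal_of L) s b : h \in 'Gal(L / k)%g -> b \in L ->
  h (gact s b) = gact s (h b).
Proof.
move=> gh Lb; apply: gal_commute => //.
by apply: (fintype.subsetP gal_sub_tower); apply: subgP.
Qed.

Lemma gal_stable (h : gal_of L) b : h \in 'Gal(L / k)%g -> b \in K -> h b \in K.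
Proof.
move=> gh Kb; have Lb := subvP KL _ Kb.
have /galois_fixedField <- := galKL.
apply/fixedFieldP => [|h' gh']; first exact: memv_gal.
rewrite gal_commute // ?(fixed_gal KL gh') //.
exact: (fintype.subsetP gal_sub_tower).
Qed.

Lemma ga_actE x b : ga_act x b = \sum_s vsval (ga_coef x s) * gact s b.
Proof. by []. Qed.

Lemma ga_act_mem x b : b \in L -> ga_act x b \in L.
Proof.
move=> Lb; apply: rpred_sum => s _; apply: rpredM; last exact: memv_gal.
by apply: (subvP KL); apply: subvsP.
Qed.

Lemma ga_actD x y b : ga_act (x + y) b = ga_act x b + ga_act y b.
Proof.
rewrite !ga_actE -big_split; apply: eq_bigr => s _.
by rewrite ga_coefD (linearD (vsval : subvs_of K -> N)) mulrDl.
Qed.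

Lemma ga_act_sum n (x : 'I_n -> KG) b :
  ga_act (\sum_i x i) b = \sum_i ga_act (x i) b.
Proof.
apply: (big_morph (fun x => ga_act x b)) => [x1 x2|]; first exact: ga_actD.
rewrite ga_actE big1 // => s _.
by rewrite /ga_coef ffunE (linear0 (vsval : subvs_of K -> N)) mul0r.
Qed.

Lemma ga_actZ c x b : ga_act (c *: x) b = vsval c * ga_act x b.
Proof.
rewrite !ga_actE mulr_sumr; apply: eq_bigr => s _.
by rewrite ga_coefZ mulrA.
Qed.

Lemma ga_act1 b : b \in L -> ga_act (1 : KG) b = b.
Proof.
move=> Lb; rewrite ga_actE (bigD1 1%g) //= ga_coef1 eqxx gact1 // mulr1n rmorph1 mul1r.
rewrite big1 ?addr0 // => s /negPf ns.
by rewrite ga_coef1 ns mulr0n (linear0 (vsval : subvs_of K -> N)) mul0r.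
Qed.

Lemma ga_actM x y b : b \in L -> ga_act (x * y) b = ga_act x (ga_act y b).
Proof.
move=> Lb; rewrite !ga_actE.
under eq_bigr => s _ do
  rewrite ga_coefM (linear_sum (vsval : {linear subvs_of K -> N})) mulr_suml.
rewrite exchange_big; apply: eq_bigr => h _.
rewrite /gact rmorph_sum mulr_sumr (reindex_inj (mulgI h)) /=.
apply: eq_bigr => s _; rewrite mulKg.
have -> : sgval h (vsval (ga_coef y s) * sgval s b) =
    vsval (ga_coef y s) * gact h (gact s b).
  by rewrite rmorphM; congr (_ * _); apply: (gact_base galKL h (subvsP _)).
rewrite mulrA; congr (_ * _).
by rewrite (gactC abKL h s Lb) -(gactM h s Lb).
Qed.

Variable iota : {rmorphism N -> algC}.

Lemma resolvent_act (chi : G -> algC) x b :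
    (forall s s', chi (s * s')%g = chi s * chi s') -> (forall s, chi s != 0) ->
    b \in L ->
  resolvent iota (fun s => (chi s)^-1) (ga_act x b) =
    ga_eval iota chi x * resolvent iota (fun s => (chi s)^-1) b.
Proof.
move=> chiM nzchi Lb; rewrite /resolvent /ga_eval mulr_suml.
under eq_bigr => s _ do rewrite ga_actE /gact rmorph_sum rmorph_sum mulr_sumr.
rewrite exchange_big; apply: eq_bigr => h _.
rewrite [RHS]mulr_sumr [RHS](reindex_inj (mulgI h)) /=; apply: eq_bigr => s _.
have -> : sgval s (vsval (ga_coef x h) * gact h b) =
    vsval (ga_coef x h) * gact s (gact h b).
  by rewrite rmorphM; congr (_ * _); apply: (gact_base galKL s (subvsP _)).
rewrite rmorphM -(gactM h s Lb) chiM invfM.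
by field; rewrite !nzchi.
Qed.

Lemma OK_1 : @OK N K 1.
Proof.
have E : vsval (1 : subvs_of K) = 1 by rewrite rmorph1.
by have := int_ring_int K 1; rewrite -[1%:~R]E.
Qed.

Section Conjugation.
Variable h : gal_of L.
Hypothesis gh : h \in 'Gal(L / k)%g.

Definition base_conj (c : subvs_of K) : subvs_of K := vsproj K (h (vsval c)).

Lemma base_conjE c : vsval (base_conj c) = h (vsval c).
Proof. by rewrite vsprojK ?gal_stable ?subvsP. Qed.

(** Only the coefficients are conjugated: h acts trivially on G by conjugation, because Gal(L / k)
    is abelian. *)
Definition ga_conj x : KG := [ffun s => base_conj (ga_coef x s)].

Lemma ga_coef_conj x s : vsval (ga_coef (ga_conj x) s) = h (vsval (ga_coef x s)).
Proof. by rewrite /ga_coef ffunE base_conjE. Qed.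

Lemma ga_conjD x y : ga_conj (x + y) = ga_conj x + ga_conj y.
Proof.
apply: ga_coefP => s; apply: val_inj; rewrite /= ga_coef_conj !ga_coefD.
rewrite !(linearD (vsval : subvs_of K -> N)) rmorphD.
by congr (_ + _); apply/esym/ga_coef_conj.
Qed.

Lemma ga_conj0 : ga_conj 0 = 0.
Proof.
apply: ga_coefP => s; apply: val_inj; rewrite /= ga_coef_conj /ga_coef ffunE.
by rewrite (linear0 (vsval : subvs_of K -> N)) rmorph0.
Qed.

Lemma ga_conj_sum n (x : 'I_n -> KG) : ga_conj (\sum_i x i) = \sum_i ga_conj (x i).
Proof. exact: (big_morph ga_conj ga_conjD ga_conj0). Qed.

Lemma ga_conjZ c x : ga_conj (c *: x) = base_conj c *: ga_conj x.
Proof.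
apply: ga_coefP => s; apply: val_inj; rewrite /= ga_coef_conj !ga_coefZ /=.
by rewrite rmorphM base_conjE ga_coef_conj.
Qed.

Lemma ga_conj1 : ga_conj 1 = 1.
Proof.
apply: ga_coefP => s; apply: (@val_inj _ _ (subvs_of K)).
rewrite [LHS]ga_coef_conj ga_coef1; case: (s == 1%g).
  have E : vsval (1 : subvs_of K) = 1 by rewrite rmorph1.
  by rewrite mulr1n E rmorph1.
by rewrite mulr0n (linear0 (vsval : subvs_of K -> N)) rmorph0.
Qed.

Lemma ga_conjM x y : ga_conj (x * y) = ga_conj x * ga_conj y.
Proof.
apply: ga_coefP => s; apply: val_inj; rewrite /= ga_coef_conj !ga_coefM.
rewrite !(linear_sum (vsval : {linear subvs_of K -> N})) rmorph_sum.
by apply: eq_bigr => s' _; rewrite /= rmorphM !ga_coef_conj.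
Qed.

Lemma ga_conj_act x b : b \in L -> h (ga_act x b) = ga_act (ga_conj x) (h b).
Proof.
move=> Lb; rewrite !ga_actE rmorph_sum; apply: eq_bigr => s _.
by rewrite rmorphM ga_coef_conj; congr (_ * _); apply: gal_gact.
Qed.

Lemma OK_conj c : OK c -> OK (base_conj c).
Proof.
move=> /int_ringP[Kc Ac]; apply/int_ringP; rewrite subvsP; split=> //.
by rewrite base_conjE algint_rmorph.
Qed.

End Conjugation.

Lemma base_conjK (h : gal_of L) c : h \in 'Gal(L / k)%g ->
  base_conj h (base_conj h^-1%g c) = c.
Proof.
move=> gh; have gV : (h^-1)%g \in 'Gal(L / k)%g by rewrite groupV.
have Lc : vsval c \in L by apply: (subvP KL); apply: subvsP.
by apply: val_inj; rewrite /= !base_conjE // -galM // mulVg gal_id.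
Qed.

Lemma ga_conjK (h : gal_of L) x : h \in 'Gal(L / k)%g ->
  ga_conj h (ga_conj h^-1%g x) = x.
Proof.
by move=> gh; apply: ga_coefP => s; rewrite /ga_coef !ffunE /ga_coef ffunE base_conjK.
Qed.

Lemma order_conj (h : gal_of L) (M : set KG) : h \in 'Gal(L / k)%g ->
  is_order M -> is_order (ga_conj h @` M).
Proof.
move=> gh hM; have [_ _ _ [s DM] span] := hM.
have gV : (h^-1)%g \in 'Gal(L / k)%g by rewrite groupV.
split.
- by exists 1; [apply: (order1 hM) | apply: ga_conj1].
- move=> _ _ [x Mx <-] [y My <-]; exists (x - y); first exact: (orderB hM).
  apply: (canRL (addrK _)); rewrite -ga_conjD //; congr (ga_conj h _).
  by rewrite subrK.
- move=> _ _ [x Mx <-] [y My <-]; exists (x * y); first exact: (orderM hM).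
  exact: ga_conjM.
- exists [seq ga_conj h x | x <- s]; apply/seteqP; split.
    move=> _ [x Mx <-]; move: Mx; rewrite DM => -[n [a [b [Oa sb ->]]]].
    rewrite (ga_conj_sum gh); under eq_bigr do rewrite (ga_conjZ gh).
    apply: lincombP_sum => i; first exact: OK_conj.
    by apply/mapP; exists (b i) => //; apply: sb.
  apply: lincomb_ind => [|_ _ [x Mx <-] [y My <-]|c _ Oc /= /mapP[x sx ->]].
  - by exists 0; [apply: (order0 hM) | apply: ga_conj0].
  - by exists (x + y); [apply: (orderD hM) | apply: ga_conjD].
  exists (base_conj h^-1%g c *: x); last by rewrite (ga_conjZ gh) (base_conjK c gh).
  apply: (orderZ hM); first exact: OK_conj.
  by rewrite DM -[x]scale1r; apply: lincomb_mem => //; apply: OK_1.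
apply/seteqP; split=> // x _.
have : lincomb *:%R setT M (ga_conj h^-1%g x) by rewrite span.
move=> [n [a [b [_ Mb Dx]]]]; rewrite -(ga_conjK x gh) Dx (ga_conj_sum gh).
under eq_bigr do rewrite (ga_conjZ gh).
by apply: lincombP_sum => // i; exists (b i).
Qed.

Lemma maximal_order_conj (h : gal_of L) (M : set KG) x : h \in 'Gal(L / k)%g ->
  is_maximal_order M -> M x -> M (ga_conj h x).
Proof.
move=> gh hM Mx; apply: (maximal_order_contains abKL hM (order_conj gh hM.1)).
by exists x.
Qed.

(* The group ring has dimension [L : K], so two elements of L satisfy a nontrivial
   relation over it. *)
Lemma ga_dependent b1 b2 : b1 \in L -> b2 \in L -> exists x y : KG,
  (x != 0) || (y != 0) /\ ga_act x b1 + ga_act y b2 = 0.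
Proof.
move=> Lb1 Lb2; pose I : finType := (G + G)%type.
pose f (i : I) : fieldOver K := match i with inl s => gact s b1 | inr s => gact s b2 end.
pose X := [tuple f (enum_val i) | i < #|I|].
have cardG : #|G| = \dim_K L.
  by rewrite (galois_dim galKL) card_sub; apply: eq_card => s; rewrite !inE.
have nfree : ~~ free X.
  apply/negP => fX; have := fX; rewrite /free size_tuple => /eqP dX.
  have : (<<X>> <= vspaceOver K L)%VS.
    apply/span_subvP => y /mapP[i _ ->]; rewrite (mem_aspaceOver KL) /f.
    by case: (enum_val i) => s; apply: gact_mem.
  move/dimvS; rewrite dX (dim_aspaceOver KL) -cardG card_sum.
  by rewrite leqNgt -{1}[#|G|]addn0 ltn_add2l; case/negP; apply/card_gt0P; exists 1%g.
have [c [i0 ci0] Dc] : exists2 c : 'I_#|I| -> subvs_of K, exists i, c i != 0 &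
    \sum_i c i *: X`_i = 0.
  apply: contrapT => no; case/negP: nfree; apply/freeP => c Dc i.
  by apply: contrapT => /eqP ci; apply: no; exists c => //; exists i.
pose x : KG := [ffun s => c (enum_rank (inl s : I))].
pose y : KG := [ffun s => c (enum_rank (inr s : I))].
exists x, y; split.
  rewrite -negb_and; apply/negP => /andP[/eqP x0 /eqP y0]; case/eqP: ci0.
  rewrite -(enum_valK i0); case: (enum_val i0) => s.
    by move/ffunP/(_ s): x0; rewrite !ffunE.
  by move/ffunP/(_ s): y0; rewrite !ffunE.
rewrite -[RHS]Dc; transitivity (\sum_(i : I) vsval (c (enum_rank i)) * f i).
  rewrite big_sumType /= !ga_actE; congr (_ + _).
    by apply: eq_bigr => s _; rewrite /ga_coef ffunE.
  by apply: eq_bigr => s _; rewrite /ga_coef ffunE.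
rewrite (reindex (@enum_val I predT)) /=; last first.
  by apply: onW_bij; exists enum_rank; [exact: enum_valK | exact: enum_rankK].
apply: eq_bigr => i _; rewrite enum_valK (nth_map i) ?size_enum_ord //.
by rewrite nth_ord_enum fieldOver_scaleE.
Qed.

(** Two basis elements would satisfy a relation by [ga_dependent], which can be multiplied into M;
    the empty basis is excluded by the nonzero element of X. *)
Lemma free_lattice_generator (M : set KG) (X : set N) : is_order M ->
    X `<=` [set` L] -> (exists2 b, X b & b != 0) -> is_free M X ->
  exists2 al, al \in L & X = [set ga_act m al | m in M].
Proof.
move=> hM XL [b0 Xb0 nzb0] [B [BX DX ind]].
have [b Bb] : exists b, B b.
  move: Xb0; rewrite DX => -[n [m [b [_ Bb Db0]]]].
  case: n m b Bb Db0 => [|n] m b Bb Db0; last by exists (b ord0).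
  by rewrite Db0 big_ord0 eqxx in nzb0.
have Lb : b \in L by apply/XL/BX.
exists b => //; have Bsub b' : B b' -> b' = b.
  move=> Bb'; apply: contrapT => neq.
  have Lb' : b' \in L by apply/XL/BX.
  have [x [y [nz Dxy]]] := ga_dependent Lb Lb'.
  have [n n_gt0 Mx] := order_multiple hM x; have [m m_gt0 My] := order_multiple hM y.
  have vsval_nat (j : nat) : vsval (j%:R : subvs_of K) = j%:R by rewrite rmorph_nat.
  have natO (j : nat) : @OK N K j%:R.
    by rewrite /OK /= vsval_nat; apply: (int_ring_int K j).
  have nzKG (j : nat) (z : KG) : (0 < j)%N -> j%:R *: z = 0 -> z = 0.
    move=> j_gt0 /ffunP jz; apply/ffunP => s; have := jz s; rewrite !ffunE.
    move=> /eqP; rewrite mulf_eq0 => /orP[/eqP|/eqP//].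
    move/(congr1 (vsval : subvs_of K -> N)).
    rewrite rmorph_nat (linear0 (vsval : subvs_of K -> N)) => /eqP.
    by rewrite numfield_natr_eq0 => /eqP j0; rewrite j0 in j_gt0.
  pose bb (i : 'I_2) := if i == ord0 then b else b'.
  pose mm (i : 'I_2) : KG := if i == ord0 then m%:R *: (n%:R *: x) else n%:R *: (m%:R *: y).
  have bb_inj : injective bb.
    move=> i j; rewrite /bb; case: (unliftP ord0 i) => [i' ->|->];
      case: (unliftP ord0 j) => [j' ->|->] //=; first by rewrite (ord1 i') (ord1 j').
      by move=> e; case: neq; rewrite e.
  have Bbb i : B (bb i) by rewrite /bb; case: ifP.
  have Mmm i : M (mm i).
    by rewrite /mm; case: ifP => _; apply: (orderZ hM (natO _)).
  have sum0 : \sum_i ga_act (mm i) (bb i) = 0.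
    have n1 : (lift ord0 ord0 == ord0 :> 'I_2) = false by [].
    rewrite big_ord_recl big_ord1 /bb /mm eqxx n1.
    have actZ j w c : ga_act (j%:R *: w : KG) c = j%:R * ga_act w c.
      by rewrite ga_actZ vsval_nat.
    have actZ2 i j w c : ga_act (i%:R *: (j%:R *: w) : KG) c = i%:R * (j%:R * ga_act w c).
      exact: etrans (actZ i _ c) (congr1 _ (actZ j w c)).
    apply: etrans (congr2 +%R (actZ2 m n x b) (actZ2 n m y b')) _.
    by rewrite [X in X + _]mulrCA -!mulrDr Dxy !mulr0.
  have H := ind 2%N bb bb_inj Bbb mm Mmm sum0.
  case/orP: nz => /eqP; case.
    by apply: (nzKG n) => //; apply: (nzKG m) => //; apply: (H ord0).
  by apply: (nzKG m) => //; apply: (nzKG n) => //; apply: (H (lift ord0 ord0)).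
rewrite DX; apply/seteqP; split=> [_ [n [m [b' [Mm Bb' ->]]]]|_ [m Mm <-]].
  exists (\sum_i m i); last first.
    by rewrite ga_act_sum; apply: eq_bigr => i _; rewrite (Bsub _ (Bb' i)).
  by elim/big_ind: _ => // [|x y]; [apply: (order0 hM) | apply: (orderD hM)].
exact: lincomb_mem.
Qed.

(** The generator lies in M O_L and may fail to be an integer, so an expression by integers is kept
    along with it. *)
Lemma weak_nib_generator : weak_normal_integral_basis K L ->
  exists M al, [/\ is_maximal_order M, al \in L,
    forall b, int_ring L b -> exists2 m : KG, M m & b = ga_act m al &
    exists n (m : 'I_n -> KG) (b : 'I_n -> N), [/\ forall i, M (m i),
      forall i, int_ring L (b i) & al = \sum_i ga_act (m i) (b i)]].
Proof.
move=> [M [hM]]; set X := lincomb _ _ _ => freeX.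
have XO b : int_ring L b -> X b.
  move=> Ob; have [Lb _] := Ob; rewrite -(ga_act1 Lb).
  by apply: lincomb_mem => //; apply: (order1 hM.1).
have XL : X `<=` [set` L].
  by move=> _ [n [m [b [_ Ob ->]]]] /=; apply: rpred_sum => i _; apply/ga_act_mem; case: (Ob i).
have [|al Lal DX] := free_lattice_generator hM.1 XL _ freeX.
  by exists 1; [apply: XO; exact: (int_ring_int L 1) | exact: oner_neq0].
exists M, al; split=> //.
  by move=> b /XO; rewrite DX => -[m Mm <-]; exists m.
have : X al.
  by rewrite DX; exists 1; [apply: (order1 hM.1) | exact: ga_act1].
by move=> [n [m [b [Mm Ob Dal]]]]; exists n, m, b.
Qed.

End Action.

(** * Resolvents of a generator *)

Section WeakNormalBasis.
Variables (N : splittingFieldType rat) (iota : {rmorphism N -> algC}).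
Variables (k K L : {subfield N}).
Hypotheses (galkL : galois k L) (abkL : abelian 'Gal(L / k)%g).
Hypotheses (kK : (k <= K)%VS) (KL : (K <= L)%VS).
Local Notation G := (subg_of 'Gal(L / K)).
Local Notation KG := (group_algebra (subvs_of K) G).
Variables (n : nat) (z : algC).
Hypothesis prim_z : n.-primitive_root z.
Implicit Types (chi psi : G -> algC) (s : G) (x : N).
Implicit Types (nu : {rmorphism algC -> algC}) (h : gal_of L).

Definition unity_char chi : Prop :=
  {morph chi : s s' / (s * s')%g >-> s * s'} /\ forall s, chi s ^+ n = 1.

Definition char_exp chi (i : int) s : algC := chi s ^ i.

Definition eigen_resolvent chi x : algC :=
  resolvent iota (fun s => (chi s)^-1) x.
Local Notation R := eigen_resolvent.

Let n_gt0 : (0 < n)%N. Proof. exact: prim_order_gt0 prim_z. Qed.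

Lemma unity_char_neq0 chi s : unity_char chi -> chi s != 0.
Proof.
move=> [_ chin]; apply/eqP => chi0; have := chin s.
by rewrite chi0 expr0n gtn_eqF // => /eqP; rewrite eq_sym oner_eq0.
Qed.

Lemma unity_char1 chi : unity_char chi -> chi 1%g = 1.
Proof.
move=> hchi; have [chiM _] := hchi.
by apply: (mulfI (unity_char_neq0 1%g hchi)); rewrite -chiM mulg1 mulr1.
Qed.

Lemma unity_char_exp chi i : unity_char chi -> unity_char (char_exp chi i).
Proof.
move=> hchi; have [chiM chin] := hchi; split=> [s s'|s].
  by rewrite /char_exp chiM; apply: expfzMl.
by rewrite /char_exp exprnP exprz_exp mulrC -exprz_exp -exprnP chin exp1rz.
Qed.

Lemma char_expD chi i j s : unity_char chi ->
  char_exp chi (i + j) s = char_exp chi i s * char_exp chi j s.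
Proof. by move=> hchi; apply: expfzDr (unity_char_neq0 s hchi). Qed.

Lemma char_exp_exp chi i j : char_exp (char_exp chi i) j = char_exp chi (i * j).
Proof. by apply/funext => s; rewrite /char_exp exprz_exp. Qed.

Lemma rmorph_unity_char nu a chi s : unity_char chi -> nu z = z ^+ a ->
  nu (chi s) = chi s ^+ a.
Proof.
move=> [_ chin] nuz; have [b ->] := prim_rootP prim_z (chin s).
by rewrite rmorphXn nuz exprAC.
Qed.

Definition induces nu h (a : nat) : Prop :=
  (forall x, x \in L -> nu (iota x) = iota (h x)) /\ nu z = z ^+ a.

Lemma rmorph_resolvent nu h a chi x : induces nu h a -> unity_char chi ->
    h \in 'Gal(L / k)%g -> x \in L ->
  nu (R chi x) = R (char_exp chi a) (h x).
Proof.
move=> [nuh nuz] hchi gh Lx; rewrite /R /resolvent rmorph_sum; apply: eq_bigr => s _.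
rewrite rmorphM fmorphV (rmorph_unity_char s hchi nuz) nuh ?gact_mem //.
by rewrite (gal_gact abkL kK).
Qed.

Lemma resolvent_gal chi x (h : G) : unity_char chi -> x \in L ->
  R chi (gact h x) = chi h * R chi x.
Proof.
move=> hchi Lx; have [chiM _] := hchi; rewrite /R /resolvent mulr_sumr.
rewrite [RHS](reindex_inj (mulgI h)) /=; apply: eq_bigr => s _.
rewrite -(gactM h s Lx) chiM invfM.
by field; rewrite !unity_char_neq0.
Qed.

(** An automorphism over K(z) restricts to some h in Gal(L / K) and multiplies each resolvent by the
    value of its character at h; these values cancel in the quotient. *)
Lemma resolvent_cocycle chi psi x : unity_char chi -> unity_char psi -> x \in L ->
  adjoin_root iota K z (R chi x * R psi x / R (fun s => chi s * psi s) x).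
Proof.
move=> hchi hpsi Lx nu fixK nuz.
have [//|h gh nuh] := @restrict_aut _ iota K L nu KL _ fixK.
  by case/and3P: (gal_tower galkL kK KL).
have ind : induces nu h 1 by split=> //; rewrite expr1.
have gkh : h \in 'Gal(L / k)%g by apply: (fintype.subsetP (gal_sub_tower L kK)).
pose hG : G := subg _ h; have DhG : sgval hG = h by apply: subgK.
have E c : unity_char c -> nu (R c x) = c hG * R c x.
  move=> hc; rewrite (rmorph_resolvent ind) //.
  have -> : char_exp c 1 = c by apply/funext => s; rewrite /char_exp expr1z.
  by rewrite -(resolvent_gal hG hc Lx) /gact DhG.
have hcp : unity_char (fun s => chi s * psi s).
  split=> [s s'|s]; first by rewrite hchi.1 hpsi.1; ring.
  by rewrite exprMn hchi.2 hpsi.2 mulr1.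
rewrite fmorph_div rmorphM !E // mulrACA -mulf_div divff ?mul1r //.
by rewrite mulf_neq0 ?unity_char_neq0.
Qed.

Variables (M : set KG) (al : N).
Hypotheses (hM : is_maximal_order M) (Lal : al \in L).
Hypothesis al_gen : forall b, int_ring L b -> exists2 m : KG, M m & b = ga_act m al.
Hypothesis al_comb : exists q (m : 'I_q -> KG) (b : 'I_q -> N),
  [/\ forall i, M (m i), forall i, int_ring L (b i) & al = \sum_i ga_act (m i) (b i)].
Hypothesis nz_res : forall chi, unity_char chi -> R chi al != 0.
Hypothesis realK : totally_real K.

Lemma resolventM chi m x : unity_char chi -> x \in L ->
  R chi (ga_act m x) = ga_eval iota chi m * R chi x.
Proof.
move=> hchi Lx; apply: (resolvent_act galkL kK KL) => //; first exact: hchi.1.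
by move=> s; apply: unity_char_neq0.
Qed.

(** h preserves M O_L, because it preserves O_L and the maximal order M. *)
Lemma generator_conj h : h \in 'Gal(L / k)%g -> exists2 m, M m & h al = ga_act m al.
Proof.
move=> gh; have [q [m [b [Mm Ob Dal]]]] := al_comb.
have Lb i : b i \in L by case: (Ob i).
have /fin_all_exists[m' m'P] : forall i, exists m' : KG, M m' /\ h (b i) = ga_act m' al.
  move=> i; have [|m' Mm' Dm'] := al_gen (b := h (b i)); last by exists m'.
  move/int_ringP: (Ob i) => [Lbi Abi]; apply/int_ringP.
  by rewrite memv_gal // algint_rmorph.
exists (\sum_i ga_conj h (m i) * m' i).
  elim/big_ind: _ => [|x y|i _]; [exact: (order0 hM.1) | exact: (orderD hM.1) |].
  apply: (orderM hM.1); last by case: (m'P i).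
  exact: (maximal_order_conj galkL abkL kK KL gh hM).
rewrite {1}Dal rmorph_sum ga_act_sum; apply: eq_bigr => i _.
rewrite (ga_actM galkL abkL kK KL) // -(m'P i).2.
exact: (ga_conj_act galkL abkL kK KL).
Qed.

Lemma generator_unit h : h \in 'Gal(L / k)%g -> exists m, [/\ M m, h al = ga_act m al &
  forall chi, unity_char chi ->
    ga_eval iota chi m != 0 /\ (ga_eval iota chi m)^-1 \in algint].
Proof.
move=> gh; have [m Mm Dm] := generator_conj gh; exists m; split=> // chi hchi.
have gV : (h^-1)%g \in 'Gal(L / k)%g by rewrite groupV.
have [m' Mm' Dm'] := generator_conj gV.
(* The element attached to h^-1, conjugated by h, is an inverse of m under every character. *)
have Mc := maximal_order_conj galkL abkL kK KL gh hM Mm'.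
have Dal : al = ga_act (ga_conj h m') (h al).
  rewrite -(ga_conj_act galkL abkL kK KL) // -Dm' -galM // mulVg gal_id //.
have Lhal : h al \in L by apply: memv_gal.
have := resolventM (ga_conj h m') hchi Lhal.
rewrite -Dal Dm resolventM // mulrA -{1}[R chi al]mul1r => /(mulIf (nz_res hchi)) D1.
have nzm : ga_eval iota chi m != 0.
  by apply/eqP => m0; move/eqP: D1; rewrite m0 mulr0 oner_eq0.
split=> //; have -> : (ga_eval iota chi m)^-1 = ga_eval iota chi (ga_conj h m').
  by rewrite -[RHS]mulr1 -(mulfV nzm) mulrA -D1 mul1r.
apply: (ga_eval_algint hM.1) => //; [exact: hchi.1 | exact: unity_char1].
Qed.

(** Complex conjugation is trivial on every embedding of K and inverts roots of unity. All mu are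
    considered, because Kronecker's theorem asks for the absolute value of every conjugate. *)
Lemma rmorph_eval_inv (mu : {rmorphism algC -> algC}) chi (m : KG) : unity_char chi ->
  mu (ga_eval iota (char_exp chi (-1)) m) = (mu (ga_eval iota chi m))^*.
Proof.
move=> hchi; rewrite /ga_eval !rmorph_sum; apply: eq_bigr => s _.
rewrite !rmorphM; congr (_ * _).
  have := realK (mu \o iota \o (vsval : {rmorphism subvs_of K -> N})) (ga_coef m s).
  by move/CrealP => /= ->.
rewrite /char_exp exprN1 fmorphV invC_norm (_ : `|mu (chi s)| = 1) ?expr1n ?invr1 ?mul1r //.
by apply/eqP; rewrite -(@pexpr_eq1 _ _ n) // -normrX -rmorphXn hchi.2 rmorph1 normr1.
Qed.

(* Replacing al by m al, with m a unit of M, multiplies d by u / u^* for a unit u of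
   algebraic integers; since K is totally real, u / u^* is a root of unity. *)
Definition gauss_jacobi chi i : algC :=
  let c j := R (char_exp chi j) al ^+ 2 / R (char_exp chi (2 * j)) al in
  c i / c (- i).
Local Notation d := gauss_jacobi.

(** The field F is arbitrary, so that for l = 3 it can be taken infinite, generated by L and all
    roots of unity of 3-power order. *)
Lemma gauss_jacobi_conj chi h i : unity_char chi -> h \in 'Gal(L / k)%g ->
  exists rho, [/\ exists2 b, (0 < b)%N & rho ^+ b = 1,
    forall F : set algC, is_subfield F -> iota @` [set` L] `<=` F -> F z -> F rho &
    forall nu, induces nu h 1 -> nu (d chi i) = rho * d chi i].
Proof.
move=> hchi gh; have [m [Mm Dm mV]] := generator_unit gh.
have he j := unity_char_exp j hchi.
pose w j := ga_eval iota (char_exp chi j) m.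
have Aw j : w j \in algint.
  by apply: (ga_eval_algint hM.1) => //; [exact: (he j).1 | exact: unity_char1].
have nzw j : w j != 0 by apply: (mV _ (he j)).1.
have AwV j : (w j)^-1 \in algint by apply: (mV _ (he j)).2.
pose U j := w j ^+ 2 / w (2 * j).
have nzU j : U j != 0 by rewrite mulf_neq0 ?invr_eq0 ?expf_neq0.
exists (U i / U (- i)); split.
- apply: kronecker_unity_root => [|mu].
    by rewrite /U invfM invrK -exprVn !rpredM ?rpredX.
  have wN j : mu (w (- j)) = (mu (w j))^*.
    rewrite -(rmorph_eval_inv mu m (he j)) char_exp_exp.
    congr (mu (ga_eval iota (char_exp chi _) m)).
    by rewrite mulrN1.
  have muUN : mu (U (- i)) = (mu (U i))^*.
    by rewrite /U mulrN !fmorph_div !rmorphXn /= !wN.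
  by rewrite fmorph_div /= muUN normf_div norm_conjC divff // normr_eq0 fmorph_eq0.
- move=> F hF LF Fz.
  have Fw j : F (w j).
    apply: (subfield_sum hF) => s _; apply: (subfieldM hF).
      by apply: LF; exists (vsval (ga_coef m s)) => //=; apply: (subvP KL); apply: subvsP.
    have [b ->] := prim_rootP prim_z ((he j).2 s).
    exact: (subfieldX hF).
  have FU j : F (U j) by apply: (subfield_div hF) => //; apply: (subfieldX hF).
  exact: (subfield_div hF).
move=> nu ind.
have nuR j : nu (R (char_exp chi j) al) = w j * R (char_exp chi j) al.
  rewrite (rmorph_resolvent ind) // char_exp_exp mulr1 Dm.
  exact: resolventM.
rewrite /gauss_jacobi !(fmorph_div, rmorphM, rmorphXn) /= !nuR.
by rewrite /U; field; rewrite !nzw !nz_res.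
Qed.

Lemma gauss_jacobi_unity chi i : unity_char chi -> exists2 b, (0 < b)%N &
  forall nu, fixes iota k nu -> nu z = z -> nu (d chi i) ^+ b = d chi i ^+ b.
Proof.
move=> hchi.
have /boolp.choice[b bP] : forall h : gal_of L, exists b,
    (0 < b)%N /\ (h \in 'Gal(L / k)%g ->
      forall nu, induces nu h 1 -> nu (d chi i) ^+ b = d chi i ^+ b).
  move=> h; have [gh|_] := boolP (h \in 'Gal(L / k)%g); last by exists 1%N.
  have [rho [[b b_gt0 rhob] _ nurho]] := gauss_jacobi_conj i hchi gh.
  by exists b; split=> // _ nu /nurho ->; rewrite exprMn rhob mul1r.
(* The order of the root of unity depends on h; the product is a common multiple over the finitely
   many restrictions to L. *)
exists (\prod_h b h)%N; first by apply: prodn_gt0 => h; case: (bP h).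
move=> nu fixk nuz.
have [||h gh nuh] := @restrict_aut _ iota k L nu _ _ fixk.
- exact: subv_trans kK KL.
- by case/and3P: galkL.
have /dvdnP[c ->] : (b h %| \prod_h b h)%N by rewrite (bigD1 h) //= dvdn_mulr.
by rewrite mulnC !exprM (bP h).2 //; split=> //; rewrite expr1.
Qed.

(* The values of chi at h cancel in the quotients defining d. *)
Lemma gauss_jacobi_twist chi i (j : nat) nu h : unity_char chi -> induces nu h j ->
  h \in 'Gal(L / K)%g -> nu (d chi i) = d chi (j%:Z * i).
Proof.
move=> hchi ind gh; have he l := unity_char_exp l hchi.
have gkh : h \in 'Gal(L / k)%g by apply: (fintype.subsetP (gal_sub_tower L kK)).
pose hG : G := subg _ h; have DhG : sgval hG = h by apply: subgK.
have nuR l : nu (R (char_exp chi l) al) =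
    char_exp chi (j%:Z * l) hG * R (char_exp chi (j%:Z * l)) al.
  rewrite (rmorph_resolvent ind) // char_exp_exp mulrC.
  by rewrite -(resolvent_gal hG (he _) Lal) /gact DhG.
rewrite /gauss_jacobi !(fmorph_div, rmorphM, rmorphXn) /= !nuR.
have nzc l : char_exp chi l hG != 0 by rewrite unity_char_neq0.
have E l : char_exp chi (2 * l) hG = char_exp chi l hG ^+ 2.
  by rewrite mulr_natl mulr2n char_expD // expr2.
rewrite !(mulrCA _ 2) !E !mulrN.
by field; rewrite !nzc !nz_res.
Qed.

Lemma gauss_jacobi_commute chi i nu h (j : nat) mu h' : unity_char chi ->
    induces nu h j -> h \in 'Gal(L / k)%g -> induces mu h' 1 -> h' \in 'Gal(L / k)%g ->
  mu (nu (d chi i)) = nu (mu (d chi i)).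
Proof.
move=> hchi ind1 gh ind2 gh'; have he l := unity_char_exp l hchi.
have E l : mu (nu (R (char_exp chi l) al)) = nu (mu (R (char_exp chi l) al)).
  rewrite (rmorph_resolvent ind1) // [mu (R _ al)](rmorph_resolvent ind2) //.
  rewrite (rmorph_resolvent ind1) ?memv_gal //; last by do 2 apply: unity_char_exp.
  rewrite (rmorph_resolvent ind2) ?memv_gal //; last by do 2 apply: unity_char_exp.
  by rewrite (gal_commute abkL gh gh' Lal) !char_exp_exp mulr1 mul1r.
by rewrite /gauss_jacobi !(fmorph_div, rmorphM, rmorphXn) /= !E.
Qed.

End WeakNormalBasis.

(** * Functions additive modulo E with values in [0, E) *)

Section FractionalParts.
Variables (F : int -> rat) (E : rat).
Hypotheses (E_gt0 : 0 < E) (F_bound : forall i, 0 <= F i < E).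
Hypothesis F_add : forall i j, exists m : int, F i + F j = F (i + j) + E * m%:~R.

Lemma fractional_unique x y (m : int) :
  0 <= x < E -> 0 <= y < E -> x = y + E * m%:~R -> x = y.
Proof.
move=> /andP[x0 xE] /andP[y0 yE] Dx.
have m_lt1 : E * m%:~R < E * 1 by rewrite mulr1; lra.
have m_gtN1 : E * (-1) < E * m%:~R by lra.
move: m_lt1 m_gtN1; rewrite !ltr_pM2l // (ltrz1 _ m) -[-1](rmorphN1 intr) ltr_int => m1 m2.
by have m0 : m = 0 by [lia]; rewrite Dx m0 mulr0 addr0.
Qed.

Lemma fractional_linear i : exists m : int, F 1 * i%:~R = F i + E * m%:~R.
Proof.
have [m0 Dm0] := F_add 0 0.
have F0 : F 0 = 0.
  apply: (@fractional_unique _ _ m0) => //; rewrite ?lexx //.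
  by move: Dm0; rewrite (addr0 (0 : int)) => h; clear -h; lra.
elim/int_rect: i => [|i [m Dm]|i [m Dm]]; first by exists 0; rewrite F0 !mulr0 addr0.
  have [m1 Dm1] := F_add i%:Z 1; exists (m + m1).
  by rewrite -addn1 PoszD !rmorphD /= mulrDr mulrDr mulr1 Dm; lra.
have [m1 Dm1] := F_add (- i.+1%:Z) 1; exists (m - m1).
have DS : - i.+1%:Z + 1 = - i%:Z by lia.
have Di : (- i.+1%:Z)%:~R = (- i%:Z)%:~R - 1 :> rat by rewrite -DS rmorphD /= addrK.
by rewrite DS in Dm1; rewrite Di mulrBr Dm mulr1 rmorphB /= mulrBr; lra.
Qed.

Lemma fractional_mod (l : nat) i : (1 < l)%N -> F 1 = E / l%:R ->
  F i = E / l%:R * (i %% l)%Z%:~R.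
Proof.
move=> l_gt1 F1; have [m Dm] := fractional_linear i.
have nzl : l%:R != 0 :> rat by rewrite pnatr_eq0; case: (l) l_gt1.
have l_gt0 : 0 < l%:R :> rat by rewrite ltr0n; case: (l) l_gt1.
apply: (@fractional_unique _ _ ((i %/ l)%Z - m)) => //.
  have r0 : (0 <= (i %% l)%Z) by rewrite modz_ge0 // -lt0n; case: (l) l_gt1.
  have rl : ((i %% l)%Z < l) by rewrite ltz_pmod //; case: (l) l_gt1.
  rewrite mulr_ge0 ?divr_ge0 ?ler0z ?(ltW E_gt0) ?(ltW l_gt0) //=.
  by rewrite mulrAC ltr_pdivrMr // ltr_pM2l // [ltRHS]pmulrn ltr_int.
have -> : ((i %/ l)%Z - m)%:~R = (i %/ l)%Z%:~R - m%:~R :> rat by rewrite rmorphB.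
have Di : i%:~R = (i %/ l)%Z%:~R * l%:R + (i %% l)%Z%:~R :> rat.
  by rewrite {1}(divz_eq i l) rmorphD rmorphM.
have -> : F i = F 1 * i%:~R - E * m%:~R by rewrite Dm addrK.
by rewrite F1 Di; field.
Qed.

(** F 1 = E u / l^M with 0 < u < l^M. Writing u = u' l^a with u' prime to l, the index l^(M - a - 1)
    times an inverse of u' modulo l gives E / l modulo E. *)
Lemma fractional_generator (l M : nat) : prime l -> 0 < F 1 ->
    F (l ^ M)%N = F 0 -> exists j, F j = E / l%:R.
Proof.
move=> pr_l F1_gt0 Fn; have l_gt1 := prime_gt1 pr_l.
have l_gt0 : 0 < l%:R :> rat by rewrite ltr0n; case: (l) l_gt1.
have [m0 Dm0] := fractional_linear 0; have [u Du] := fractional_linear (l ^ M)%N.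
have {m0 Dm0} F0 : F 0 = 0.
  apply: (@fractional_unique _ _ (- m0)) => //; rewrite ?lexx //.
  by rewrite (rmorphN (intr : int -> rat)) mulrN; move: Dm0; rewrite mulr0 => h; clear -h; lra.
rewrite Fn F0 add0r in Du.
have lM_gt0 : 0 < (l ^ M)%:R :> rat by rewrite ltr0n expn_gt0 ltnW.
have u_gt0 : 0 < u.
  by rewrite -(ltr0z rat) -(pmulr_rgt0 _ E_gt0) -Du mulr_gt0.
have u_lt : u < (l ^ M)%N.
  rewrite -(ltr_int rat) -(ltr_pM2l E_gt0) -Du ltr_pM2r //.
  by case/andP: (F_bound 1).
case: u Du u_gt0 u_lt => // u Du u_gt0; rewrite ltz_nat => u_lt.
have {}u_gt0 : (0 < u)%N by [].
have [u' co_u Du'] := pfactor_coprime pr_l u_gt0; set a := logn l u in Du'.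
have lt_aM : (a < M)%N.
  rewrite -(ltn_exp2l _ _ l_gt1); apply: leq_ltn_trans u_lt.
  by rewrite Du' leq_pmull //; case: (u') Du' u_gt0 => // ->.
have [i Di] : exists i : nat, u' * i = 1 %[mod l].
  have u'_gt0 : (0 < u')%N by case: (u') Du' u_gt0 => // ->.
  have [i c Dic _] := egcdnP l u'_gt0; exists i.
  rewrite mulnC Dic; move: co_u; rewrite coprime_sym /coprime gcdnC => /eqP ->.
  by rewrite modnMDl.
exists (l ^ (M - a.+1) * i)%N%:Z.
have [m Dm] := fractional_linear (l ^ (M - a.+1) * i)%N.
have DM : (M = a + (M - a.+1) + 1)%N by clear -lt_aM; lia.
have nzl : l%:R != 0 :> rat by rewrite gt_eqF.
apply: (@fractional_unique _ _ ((u' * i %/ l)%N%:Z - m)) => //.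
  rewrite divr_ge0 ?(ltW E_gt0) ?(ltW l_gt0) //=.
  by rewrite ltr_pdivrMr // ltr_pMr // ltr1n.
have -> : ((u' * i %/ l)%N%:Z - m)%:~R = (u' * i %/ l)%:R - m%:~R :> rat.
  by rewrite rmorphB.
have -> : F (l ^ (M - a.+1) * i)%N = F 1 * (l ^ (M - a.+1) * i)%:R - E * m%:~R.
  by rewrite Dm addrK.
have -> : F 1 = E * u%:R / (l ^ M)%:R.
  by apply: (canRL (mulfK _)); rewrite ?gt_eqF.
have Dui : (u' * i)%:R = (u' * i %/ l)%:R * l%:R + 1 :> rat.
  rewrite {1}(divn_eq (u' * i) l) Di natrD natrM modn_small //.
rewrite mulrBr addrA; congr (_ - _).
have -> : E / l%:R + E * (u' * i %/ l)%:R = E * (u' * i)%:R / l%:R.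
  by rewrite Dui; move: (u' * i %/ l)%:R => c; field.
have -> : (l ^ M = l ^ a * l ^ (M - a.+1) * l)%N by rewrite {1}DM !expnD expn1.
rewrite Du' !natrM; field.
have nzl0 : l != 0%N by case: (l) l_gt1.
by rewrite nzl !pnatr_eq0 !expn_eq0 (negPf nzl0).
Qed.

End FractionalParts.

Lemma modz_eq (x c y d : int) : x = c * d + y -> 0 <= y < d -> (x %% d)%Z = y.
Proof. by move=> -> yd; rewrite modzMDl modz_small. Qed.

(** Twice the residue of i minus the residue of 2 i is 0 below l / 2 and l above it; the expression
    subtracts this quantity at - i from the one at i. *)
Lemma modz_sum_small (i l : nat) : (0 < i)%N -> (2 * i < l)%N ->
  2 * (i%:Z %% l)%Z - (2 * i%:Z %% l)%Z - (2 * (- i%:Z %% l)%Z - (- (2 * i%:Z) %% l)%Z)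
    = - l%:Z.
Proof.
move=> i_gt0 lt_il.
rewrite [(- (2 * i%:Z) %% l)%Z](modz_eq (c := -1) (y := l%:Z - 2 * i%:Z)); [|lia|lia].
rewrite [(- i%:Z %% l)%Z](modz_eq (c := -1) (y := l%:Z - i%:Z)); [|lia|lia].
by rewrite !modz_small; lia.
Qed.

Lemma modz_sum_large (i l : nat) : (i < l)%N -> (l < 2 * i)%N ->
  2 * (i%:Z %% l)%Z - (2 * i%:Z %% l)%Z - (2 * (- i%:Z %% l)%Z - (- (2 * i%:Z) %% l)%Z)
    = l%:Z.
Proof.
move=> lt_il gt_il.
rewrite [(- (2 * i%:Z) %% l)%Z](modz_eq (c := -2) (y := 2 * l%:Z - 2 * i%:Z)); [|lia|lia].
rewrite [(- i%:Z %% l)%Z](modz_eq (c := -1) (y := l%:Z - i%:Z)); [|lia|lia].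
rewrite [(2 * i%:Z %% l)%Z](modz_eq (c := 1) (y := 2 * i%:Z - l%:Z)); [|lia|lia].
by rewrite modz_small; lia.
Qed.

(** * Values of the resolvents of a generator *)

Section ResolventValuation.
Variables (v : algC -> rat) (r : nat).
Hypothesis hv : valuation v r.
Variables (N : splittingFieldType rat) (iota : {rmorphism N -> algC}).
Variables (k K L : {subfield N}) (t : N) (e : nat).
Hypotheses (galkL : galois k L) (abkL : abelian 'Gal(L / k)%g).
Hypotheses (kK : (k <= K)%VS) (KL : (K <= L)%VS).
Hypotheses (nzt : t != 0) (vt : 0 < v (iota t)) (Ot : int_ring L t).
Hypothesis t_gen :
  forall x, x \in L -> x != 0 -> exists i : int, v (iota x) = v (iota t) * i%:~R.
Local Notation E := (v (iota t) * e%:R).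
Hypothesis e_gen :
  forall x, x \in K -> x != 0 -> exists i : int, v (iota x) = E * i%:~R.
Variable a : N.
Hypotheses (Ka : a \in K) (nza : a != 0) (va : v (iota a) = E).
Hypotheses (tame_e : ~~ (r %| e)%N) (e_gt0 : (0 < e)%N).
Local Notation G := (subg_of 'Gal(L / K)).
Local Notation KG := (group_algebra (subvs_of K) G).
Variables (n : nat) (z : algC).
Hypotheses (prim_z : n.-primitive_root z) (r_n : ~~ (r %| n)%N).
Variables (M : set KG) (al : N).
Hypotheses (hM : is_maximal_order M) (Lal : al \in L).
Hypothesis al_gen : forall b, int_ring L b -> exists2 m : KG, M m & b = ga_act m al.
Hypothesis al_comb : exists q (m : 'I_q -> KG) (b : 'I_q -> N),
  [/\ forall i, M (m i), forall i, int_ring L (b i) & al = \sum_i ga_act (m i) (b i)].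
Hypothesis realK : totally_real K.
Implicit Types (chi psi : G -> algC) (s : G).
Local Notation R := (eigen_resolvent iota).
Local Notation ox x := (vge v 0 x).
Local Notation mx x := (vgt v 0 x).

Let galKL := gal_tower galkL kK KL.
Let abKL := abelian_tower abkL kK.

Let Lt : t \in L. Proof. by case/int_ringP: Ot. Qed.

Let E_gt0 : 0 < E. Proof. by rewrite mulr_gt0 // ltr0n. Qed.

Lemma val_unity_root (x : algC) : x ^+ n = 1 -> v x = 0.
Proof.
move=> xn; have n_gt0 := prim_order_gt0 prim_z.
have nzx : x != 0.
  by apply: contraTneq (oner_neq0 algC) => x0; rewrite -xn x0 expr0n gtn_eqF ?eqxx.
have /eqP := valX hv n nzx; rewrite xn (val1 hv) eq_sym mulf_eq0 pnatr_eq0 gtn_eqF // orbF.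
by move/eqP.
Qed.

Lemma val_unity_char chi s : unity_char n chi -> ox (chi s)^-1.
Proof.
by move=> [_ chin]; apply/vint_unit/val_unity_root; rewrite exprVn chin invr1.
Qed.

Lemma val_ga_eval chi m : unity_char n chi -> M m -> ox (ga_eval iota chi m).
Proof.
move=> hchi Mm; apply: (vint_algint hv); apply: (ga_eval_algint hM.1) => //.
  exact: hchi.1.
exact: (unity_char1 prim_z hchi).
Qed.

Lemma eigen_resolvent_comb chi q (m : 'I_q -> KG) (b : 'I_q -> N) :
    unity_char n chi -> (forall i, int_ring L (b i)) ->
  R chi (\sum_i ga_act (m i) (b i)) = \sum_i ga_eval iota chi (m i) * R chi (b i).
Proof.
move=> hchi Ob.
under [RHS]eq_bigr => i _ do
  rewrite -(resolventM iota galkL kK KL prim_z (m i) hchi (proj1 (Ob i))).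
rewrite /R /resolvent [RHS]exchange_big; apply: eq_bigr => s _.
by rewrite -mulr_sumr; congr (_ * _); rewrite /gact !rmorph_sum.
Qed.

(** The generator is a combination of integers over M, which gives the lower bound. Conversely each
    integer is a multiple of it by an element of M, whose character value is integral, so the small
    resolvent from [resolvent_upper] gives the upper bound. *)
Lemma resolvent_bound chi : unity_char n chi ->
  R chi al != 0 /\ 0 <= v (R chi al) < E.
Proof.
move=> hchi; have ochi s : ox (chi s)^-1 by apply: val_unity_char.
have chi1 : (chi 1%g)^-1 = 1 by rewrite (unity_char1 prim_z hchi) invr1.
have [x [Ox nzx ltx]] := resolvent_upper hv galKL Lt nzt vt t_gen Ka nza va tame_e Ot
  e_gt0 ochi chi1.
have [m Mm Dx] := al_gen Ox.
have Lx : x \in L by case: Ox.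
have Dr := resolventM iota galkL kK KL prim_z m hchi Lal.
rewrite -/(R chi x) {}Dx Dr mulf_eq0 negb_or in nzx ltx; case/andP: nzx => nzm nzal.
split=> //; apply/andP; split.
  have [q [m' [b [Mm' Ob Dal]]]] := al_comb.
  have : ox (R chi al).
    rewrite Dal eigen_resolvent_comb //; apply: (vge_sum hv) => i _; apply: (vint_M hv).
      exact: val_ga_eval.
    apply: (vge_sum hv) => s _; apply: (vint_M hv) => //.
    apply/(vint_algint hv); rewrite algint_rmorph.
    by case/int_ringP: (Ob i) => _ ?; rewrite /gact algint_rmorph.
  by rewrite /vge (negPf nzal).
apply: le_lt_trans ltx; rewrite (valM hv) // lerDr.
by have := val_ga_eval hchi Mm; rewrite /vge (negPf nzm).
Qed.

Lemma resolvent_pos chi s0 : unity_char n chi -> s0 \in inertia v iota K L ->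
  chi s0 != 1 -> 0 < v (R chi al).
Proof.
move=> hchi Ts0 chi_s0; have [chiM chin] := hchi.
have [nzal _] := resolvent_bound hchi.
have pos x : int_ring L x -> mx (R chi x).
  apply: (resolvent_ramified hv abKL _ _ Ts0 (n := n)) => // [s s'|s||].
  - by rewrite chiM invfM.
  - exact: val_unity_char.
  - by rewrite invr_eq1.
  by rewrite exprVn chin invr1.
have [q [m' [b [Mm' Ob Dal]]]] := al_comb.
have : mx (R chi al).
  rewrite Dal eigen_resolvent_comb //; apply: (vgt_sum hv) => i _; apply: (vmax_Ml hv).
    exact: val_ga_eval.
  exact: pos.
by rewrite /vgt (negPf nzal).
Qed.

(** The quotient from [resolvent_cocycle] lies in K(z), which has the same values as K, namely
    multiples of E. *)
Lemma resolvent_val_add chi psi : unity_char n chi -> unity_char n psi ->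
  exists m : int, v (R chi al) + v (R psi al) = v (R (fun s => chi s * psi s) al) + E * m%:~R.
Proof.
move=> hchi hpsi; have hcp : unity_char n (fun s => chi s * psi s).
  split=> [s s'|s]; first by rewrite hchi.1 hpsi.1; ring.
  by rewrite exprMn hchi.2 hpsi.2 mulr1.
have [nz1 _] := resolvent_bound hchi; have [nz2 _] := resolvent_bound hpsi.
have [nz3 _] := resolvent_bound hcp.
have Fx := @resolvent_cocycle _ iota _ _ _ galkL abkL kK KL _ _ prim_z _ _ _ hchi hpsi Lal.
have [|y [Ky nzy vy]] := val_adjoin_root prim_z hv r_n Fx.
  by rewrite !mulf_neq0 ?invr_eq0.
have [m Dm] := e_gen Ky nzy; exists m; rewrite -Dm vy (valM hv) ?(valM hv) ?(valV hv) //.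
- by ring.
- by rewrite mulf_neq0.
by rewrite invr_eq0.
Qed.

Let nz_res chi : unity_char n chi -> R chi al != 0.
Proof. by case/resolvent_bound. Qed.

Let char_val chi (i : int) := v (R (char_exp chi i) al).

Let char_val_bound chi i : unity_char n chi -> 0 <= char_val chi i < E.
Proof. by move=> hchi; case: (resolvent_bound (unity_char_exp i hchi)). Qed.

Let char_val_add chi i j : unity_char n chi ->
  exists m : int, char_val chi i + char_val chi j = char_val chi (i + j) + E * m%:~R.
Proof.
move=> hchi.
have [m Dm] := resolvent_val_add (unity_char_exp i hchi) (unity_char_exp j hchi).
exists m; rewrite /char_val Dm; congr (v (R _ al) + _); apply/funext => s.
by rewrite (char_expD prim_z).
Qed.

Lemma exists_small_character (l m : nat) chi s0 : prime l -> n = (l ^ m)%N ->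
    unity_char n chi -> s0 \in inertia v iota K L -> chi s0 != 1 ->
  exists2 psi : G -> algC, unity_char n psi &
    forall i : int, v (R (char_exp psi i) al) = E / l%:R * (i %% l)%Z%:~R.
Proof.
move=> pr_l Dn hchi Ts0 chi_s0; have [chiM chin] := hchi.
have [j Dj] : exists j, char_val chi j = E / l%:R.
  apply: (@fractional_generator (char_val chi) E E_gt0 _ _ l m) => //.
  - by move=> i; apply: char_val_bound.
  - by move=> i j; apply: char_val_add.
  - rewrite /char_val; have -> : char_exp chi 1 = chi.
      by apply/funext => s; rewrite /char_exp expr1z.
    exact: (resolvent_pos _ Ts0).
  rewrite /char_val; congr (v (R _ al)); apply/funext => s.
  by rewrite /char_exp -Dn -exprnP chin expr0z.
have hpsi := unity_char_exp j hchi.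
exists (char_exp chi j) => // i.
apply: (@fractional_mod (char_val (char_exp chi j)) E) => //.
- by move=> i'; apply: char_val_bound.
- by move=> i' j'; apply: char_val_add.
- exact: prime_gt1.
Qed.

Variables (l : nat) (chi : G -> algC).
Hypotheses (l_gt0 : (0 < l)%N) (hchi : unity_char n chi).
Hypothesis chi_val :
  forall i : int, v (R (char_exp chi i) al) = E / l%:R * (i %% l)%Z%:~R.
Local Notation d := (gauss_jacobi iota al chi).

Lemma val_gauss_jacobi i : v (d i) =
  E / l%:R * (2 * (i %% l)%Z - (2 * i %% l)%Z - (2 * (- i %% l)%Z - (- (2 * i) %% l)%Z))%:~R.
Proof.
have nz j := nz_res (unity_char_exp j hchi).
rewrite /gauss_jacobi !(valM hv, valV hv) ?mulf_neq0 ?invr_eq0 ?mulf_neq0 ?invr_eq0 ?expf_neq0 //.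
rewrite ?(valX hv) // !chi_val mulrN.
move: (i %% l)%Z (2 * i %% l)%Z (- i %% l)%Z (- (2 * i) %% l)%Z => i1 i2 i3 i4.
by rewrite !rmorphB !rmorphM /=; ring.
Qed.

Lemma val_gauss_jacobi_small (i : nat) : (0 < i)%N -> (2 * i < l)%N -> v (d i) = - E.
Proof.
move=> i_gt0 lt_il; have nzl : l%:R != 0 :> rat by rewrite pnatr_eq0 gtn_eqF.
rewrite val_gauss_jacobi.
by rewrite modz_sum_small // rmorphN /= -pmulrn; field; rewrite ?nzl.
Qed.

Lemma val_gauss_jacobi_large (i : nat) : (i < l)%N -> (l < 2 * i)%N -> v (d i) = E.
Proof.
move=> lt_il gt_il; have nzl : l%:R != 0 :> rat by rewrite pnatr_eq0 gtn_eqF.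
rewrite val_gauss_jacobi.
by rewrite modz_sum_large // -pmulrn; field; rewrite ?nzl.
Qed.

Lemma val_gauss_jacobi_mod i i' : (i = i' %[mod l])%Z -> v (d i) = v (d i').
Proof.
move=> Dii'; rewrite !val_gauss_jacobi -!mulrN Dii'.
have DN : (- i = - i' %[mod l])%Z by rewrite -modzNm Dii' modzNm.
by rewrite -(modzMmr 2 i) Dii' modzMmr -(modzMmr 2 (- i)) DN modzMmr.
Qed.

End ResolventValuation.

(** * The contradiction *)

Section Contradiction.
Variables (v : algC -> rat) (r : nat).
Hypothesis hv : valuation v r.
Variables (N : splittingFieldType rat) (iota : {rmorphism N -> algC}).
Variables (k K L : {subfield N}).
Hypotheses (galkL : galois k L) (abkL : abelian 'Gal(L / k)%g).
Hypotheses (kK : (k <= K)%VS) (KL : (K <= L)%VS).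
Local Notation G := (subg_of 'Gal(L / K)).
Local Notation KG := (group_algebra (subvs_of K) G).
Variables (n : nat) (z : algC).
Hypotheses (prim_z : n.-primitive_root z) (r_n : ~~ (r %| n)%N).
Variables (M : set KG) (al : N).
Hypotheses (hM : is_maximal_order M) (Lal : al \in L).
Hypothesis al_gen : forall b, int_ring L b -> exists2 m : KG, M m & b = ga_act m al.
Hypothesis al_comb : exists q (m : 'I_q -> KG) (b : 'I_q -> N),
  [/\ forall i, M (m i), forall i, int_ring L (b i) & al = \sum_i ga_act (m i) (b i)].
Hypothesis realK : totally_real K.
Hypothesis nz_res :
  forall chi : G -> algC, unity_char n chi -> eigen_resolvent iota chi al != 0.
Variable chi : G -> algC.
Hypothesis hchi : unity_char n chi.
Local Notation d := (gauss_jacobi iota al chi).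
Variables (E : rat) (e q : nat).
Hypotheses (E_gt0 : 0 < E) (pr_q : prime q) (q_e : (q %| e)%N).
Hypothesis k_gen :
  forall x, x \in k -> x != 0 -> exists i : int, v (iota x) = E * e%:R * i%:~R.

Let nzd i : d i != 0.
Proof.
have nz j := nz_res (unity_char_exp j hchi).
by rewrite !mulf_neq0 ?invr_eq0 ?mulf_neq0 ?invr_eq0 ?expf_neq0.
Qed.

Lemma val_fixed_dvd (x : algC) (c : int) :
  adjoin_root iota k z x -> x != 0 -> v x = E * c%:~R -> (q %| c)%Z.
Proof.
move=> Fx nzx vx; have [y [ky nzy vy]] := val_adjoin_root prim_z hv r_n Fx nzx.
have [i] := k_gen ky nzy; rewrite vy vx -mulrA => /(mulfI (lt0r_neq0 E_gt0)).
rewrite [e%:R]pmulrn -intrM => /intr_inj ->.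
by apply: dvdz_mulr.
Qed.

Lemma restrict_fixed (nu : {rmorphism algC -> algC}) : fixes iota k nu -> nu z = z ->
  exists2 h, h \in 'Gal(L / k)%g & induces iota z nu h 1.
Proof.
move=> fixk nuz; have [||h gh nuh] := @restrict_aut _ iota k L nu _ _ fixk.
- exact: subv_trans kK KL.
- by case/and3P: galkL.
by exists h => //; split=> //; rewrite expr1.
Qed.

Lemma coprime_split b : (0 < b)%N -> exists n0 s, coprime q n0 /\ b = (n0 * q ^ s)%N.
Proof. by move/(pfactor_coprime pr_q) => [n0 co Db]; exists n0, (logn q b). Qed.

Lemma contradiction_fixed (F : set algC) y : is_subfield F -> iota @` [set` L] `<=` F ->
  F z -> q.-primitive_root y -> ~ F y -> v (d 1) = - E -> False.
Proof.
move=> hF LF Fz prim_y nFy vd.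
have [b b_gt0 db] :=
  gauss_jacobi_unity galkL abkL kK KL prim_z hM Lal al_gen al_comb nz_res realK 1 hchi.
have [n0 [s [co_n0 Db]]] := coprime_split b_gt0.
suff : (q %| - n0%:Z)%Z.
  by rewrite dvdzE abszN /=; apply/negP; rewrite -prime_coprime.
apply: (@val_fixed_dvd (d 1 ^+ n0)); last 1 first.
- by rewrite (valX hv) // vd mulNr rmorphN mulrN.
- 2: exact: expf_neq0.
move=> nu fixk nuz; have [h gh ind] := restrict_fixed fixk nuz.
have [rho [_ rhoF nurho]] :=
  gauss_jacobi_conj galkL abkL kK KL prim_z hM Lal al_gen al_comb nz_res realK 1 hchi gh.
have {}nurho := nurho nu ind.
suff rho1 : rho ^+ n0 = 1 by rewrite rmorphXn /= nurho exprMn rho1 mul1r.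
have Frho : F (rho ^+ n0) by apply: (subfieldX hF); apply: rhoF.
have rhob : (rho ^+ n0) ^+ (q ^ s) = 1.
  rewrite -exprM -Db; apply: (mulIf (expf_neq0 b (nzd 1))).
  by rewrite mul1r -exprMn -nurho db.
have qs_gt0 : (0 < q ^ s)%N by rewrite expn_gt0 prime_gt0.
have [m prim_m] := prim_order_exists qs_gt0 rhob.
case/(dvdn_pfactor _ _ pr_q) => j _ Dm; rewrite Dm in prim_m.
(* Order q^0 means that rho^n0 is 1. Otherwise one of its powers has order q, and y, a power of that
   one, would lie in F. *)
case: j => [|j] in Dm prim_m; first by have := prim_expr_order prim_m; rewrite expn0 expr1.
have prim_q : q.-primitive_root (rho ^+ n0 ^+ (q ^ j.+1 %/ q)).
  by apply: (dvdn_prim_root prim_m); rewrite expnS dvdn_mulr.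
case: nFy; have [i ->] := prim_rootP prim_q (prim_expr_order prim_y).
by do 2 apply: (subfieldX hF).
Qed.

Lemma contradiction_twist (nu : {rmorphism algC -> algC}) (j i : nat) : fixes iota K nu ->
  nu z = z ^+ j -> odd q -> v (d 1) = - E -> v (d j) = - E ->
  v (d i) = - E -> v (d (j%:Z * i)) = E -> False.
Proof.
move=> fixK nuz odd_q v1 vj vi vji.
have unity i := gauss_jacobi_unity galkL abkL kK KL prim_z hM Lal al_gen al_comb nz_res
  realK i hchi.
have [b1 b1_gt0 db1] := unity 1; have [b2 b2_gt0 db2] := unity i.
(* One exponent for both indices, so that n0, s and w are the same in the two congruences. *)
have b_gt0 : (0 < b1 * b2)%N by rewrite muln_gt0 b1_gt0.
have [n0 [s [co_n0 Db]]] := coprime_split b_gt0.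
have qs_gt0 : (0 < q ^ s)%N by rewrite expn_gt0 prime_gt0.
have [xi prim_xi] := C_prim_root_exists qs_gt0.
have [w nuxi] := rmorph_prim_root prim_xi nu.
have [//|h ghK nuh] := @restrict_aut _ iota K L nu KL _ fixK.
  by case/and3P: (gal_tower galkL kK KL).
have gh : h \in 'Gal(L / k)%g by apply: (fintype.subsetP (gal_sub_tower L kK)).
have ind : induces iota z nu h j by [].
have twist l : d l ^+ (b1 * b2) != 0 -> (forall mu, fixes iota k mu -> mu z = z ->
    mu (d l) ^+ (b1 * b2) = d l ^+ (b1 * b2)) ->
    forall c1 c2 : int, v (d (j%:Z * l)) = E * c1%:~R -> v (d l) = E * c2%:~R ->
  (q %| c1 - c2 * w%:Z)%Z.
  move=> nzdl fixd c1 c2 v1' v2'.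
  have nud : nu (d l) = d (j%:Z * l).
    exact: (gauss_jacobi_twist abkL kK prim_z Lal nz_res l hchi ind ghK).
  have cz : coprimez q n0 by rewrite coprimezE.
  rewrite -(Gauss_dvdzr _ cz).
  apply: (@val_fixed_dvd (nu (d l) ^+ n0 / d l ^+ (n0 * w))).
  - move=> mu fixk muz; have [h' gh' ind'] := restrict_fixed fixk muz.
    (* If mu multiplies d by rho, it multiplies nu(d) by nu(rho), as mu and nu commute on d. Since
       rho^n0 has order dividing q^s, nu raises it to the power w, and the factors cancel. *)
    have comm := gauss_jacobi_commute abkL kK prim_z Lal l hchi ind gh ind' gh'.
    have [rho Dmu] : exists rho, mu (d l) = rho * d l.
      by exists (mu (d l) / d l); rewrite divfK.
    have rhoq : (rho ^+ n0) ^+ (q ^ s) = 1.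
      rewrite -exprM -Db; apply: (mulIf (expf_neq0 (b1 * b2) (nzd l))).
      by rewrite mul1r -exprMn -Dmu fixd.
    have nurho : nu rho ^+ n0 = rho ^+ (n0 * w).
      have [c Dc] := prim_rootP prim_xi rhoq.
      by rewrite -rmorphXn exprM Dc rmorphXn /= nuxi exprAC.
    have nzrho : rho != 0.
      by apply: contraTneq (nzd l) => rho0; rewrite -(fmorph_eq0 mu) Dmu rho0 mul0r eqxx.
    rewrite fmorph_div !rmorphXn /= comm Dmu rmorphM !exprMn nurho.
    by rewrite -mulf_div divff ?mul1r // expf_neq0.
  - by rewrite mulf_neq0 ?invr_eq0 ?expf_neq0 // fmorph_eq0.
  rewrite (valM hv) ?invr_eq0 ?expf_neq0 ?fmorph_eq0 // (valV hv) ?expf_neq0 //.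
  rewrite !(valX hv) ?fmorph_eq0 // nud v1' v2' natrM rmorphM rmorphB rmorphM /=.
  by rewrite -!pmulrn; ring.
have dvd1 : (q %| -1 + w%:Z)%Z.
  have := @twist 1 _ _ (-1) (-1); rewrite mulN1r opprK; apply.
  - exact: expf_neq0.
  - by move=> mu fixk muz; rewrite !exprM db1.
  - by rewrite mulr1 vj rmorphN mulrN1.
  by rewrite v1 rmorphN mulrN1.
have dvd2 : (q %| 1 + w%:Z)%Z.
  have := @twist i _ _ 1 (-1); rewrite mulN1r opprK; apply.
  - exact: expf_neq0.
  - by move=> mu fixk muz; rewrite mulnC !exprM db2.
  - by rewrite vji mulr1.
  by rewrite vi rmorphN mulrN1.
have : (q %| 2)%Z.
  have -> : 2 = (1 + w%:Z) - (-1 + w%:Z) :> int by ring.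
  exact: rpredB.
rewrite dvdzE /= dvdn_prime2 // => /eqP q2; by rewrite q2 in odd_q.
Qed.

End Contradiction.

(** Some linear character is nontrivial at s0. Raised to the prime-to-l part c of the order of the
    group, it has l-power order, and it stays nontrivial at s0, whose order l is prime to c. *)
Lemma exists_prime_power_character (gT : finGroupType) (l : nat) (s0 : gT) :
    (forall s s' : gT, s * s' = s' * s)%g -> prime l -> #[s0]%g = l ->
  exists2 chi : gT -> algC, {morph chi : s s' / (s * s')%g >-> s * s'} &
    (forall s, chi s ^+ (l ^ logn l #|gT|) = 1) /\ chi s0 != 1.
Proof.
move=> mulC pr_l ord_s0; pose G := setT_group gT.
have abG : abelian G by apply/centsP => s _ s' _; apply: mulC.
have Gs s : s \in G by rewrite inE.
have lin i : 'chi[G]_i \is a linear_char by apply/char_abelianP.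
have [i chi_s0] : exists i, 'chi[G]_i s0 != 1.
  apply: contrapT => no; have : s0 \in (1%g : {set gT}).
    rewrite -(TI_cfker_irr G); apply/finset.bigcapP => i _; rewrite cfkerEirr inE lin_char1 //.
    by apply/negPn/negP => ne; apply: no; exists i.
  by move=> /set1gP s01; move: ord_s0 pr_l; rewrite s01 fingroup.order1 => <-.
have cardG : #|G| = #|gT| by rewrite cardsT.
have [c co_c Dc] := pfactor_coprime pr_l (cardG_gt0 G).
have chiX s : 'chi_i s ^+ #|G| = 1.
  have /dvdnP[b ->] := order_dvdG (Gs s).
  by rewrite mulnC exprM lin_char_unity_root // expr1n.
exists (fun s => 'chi_i s ^+ c) => [s s'|]; first by rewrite lin_charM // exprMn.
rewrite -cardG; split=> [s|]; first by rewrite -exprM -Dc chiX.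
apply: contraNneq chi_s0 => c1.
have l1 : 'chi_i s0 ^+ l = 1 by rewrite -ord_s0 lin_char_unity_root.
have c_gt0 : (0 < c)%N by case: (c) Dc (cardG_gt0 G) => // ->.
have [u w Duw _] := egcdnP l c_gt0.
move: co_c; rewrite coprime_sym /coprime => /eqP gcd1; rewrite gcd1 in Duw.
have : 'chi_i s0 ^+ (u * c) = 'chi_i s0 ^+ (w * l + 1) by rewrite Duw.
by rewrite mulnC exprM c1 expr1n exprD mulnC exprM l1 expr1n mul1r expr1 => <-.
Qed.

Section Centers.
Variables (N : splittingFieldType rat) (iota : {rmorphism N -> algC}).
Implicit Types (K L : {subfield N}) (Q : set N).

Lemma prime_center L Q : prime_of L Q ->
  exists v r, valuation v r /\ Q = center v iota L.
Proof.
move=> hQ; have [[QO Q0 QD QM] _ Q1 _] := hQ.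
have [r [pr_r Qr]] := prime_ideal_char hQ.
have [J [[JA JD JM QJ JQ] Jprime]] := exists_prime_above iota hQ.
have J1 : ~ J 1 by rewrite -(rmorph1 iota) => /JQ J1; apply/Q1/J1/(int_ring_int L 1).
have J0 : J 0 by apply: QJ; exists 0; rewrite // rmorph0.
have Jr : J r%:R by apply: QJ; exists r%:R; rewrite // rmorph_nat.
have [v [hv Jv]] := exists_valuation pr_r Jr J1 J0 JD JM Jprime.
exists v, r; split=> //; apply/seteqP; split=> x.
  move=> Qx; have Ox := QO _ Qx; split=> //.
  have /int_ringP[_ Ax] := Ox; apply/Jv; first by rewrite algint_rmorph.
  by apply: QJ; exists x.
move=> [Ox mx]; have /int_ringP[_ Ax] := Ox; apply: JQ => //.
by apply/Jv; rewrite ?algint_rmorph.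
Qed.

Lemma center_lies_over v K L : (K <= L)%VS ->
  lies_over K (center v iota L) (center v iota K).
Proof.
move=> KL; apply/seteqP; split=> x.
  by move=> [[/int_ringP[_ Ax] mx] /= Kx]; split=> //; apply/int_ringP.
move=> [/int_ringP[Kx Ax] mx]; split=> //; split=> //; apply/int_ringP.
by rewrite (subvP KL).
Qed.

End Centers.

(** The exponent is given at some prime above p, which by [prime_conjugate] is the center of v o s
    on K. There s^-1(a) is a uniformiser, and s fixes k. *)
Lemma val_ramification_index (v : algC -> rat) (r : nat) (N : splittingFieldType rat)
    (iota : {rmorphism N -> algC}) (k K : {subfield N}) (a : N) (p : set N) (e : nat) :
    valuation v r -> galois k K -> a \in K -> a != 0 -> 0 < v (iota a) ->
    (forall x, x \in K -> x != 0 -> exists i : int, v (iota x) = v (iota a) * i%:~R) ->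
    lies_over k (center v iota K) p -> ramification_index k K p e ->
  forall x, x \in k -> x != 0 -> exists i : int, v (iota x) = v (iota a) * e%:R * i%:~R.
Proof.
move=> hv galkK Ka nza va a_gen over [P [hP overP ramP]] x kx nzx.
have kK : (k <= K)%VS by case/and3P: galkK.
have [s gs DP] := prime_conjugate hv galkK hP overP over.
have gsV : (s^-1)%g \in 'Gal(K / k)%g by rewrite groupV.
pose b := (s^-1)%g a; have Kb : b \in K by apply: memv_gal.
have sb : s b = a by rewrite /b -galM // mulVg gal_id.
rewrite DP in overP ramP.
have [||y Ky nzy|_ gen] := ram_exponent_val hv Kb _ _ _ kK overP ramP.
- by rewrite fmorph_eq0.
- by rewrite /= sb.
- rewrite /= sb; apply: a_gen; first exact: memv_gal.
  by rewrite fmorph_eq0.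
have [i] := gen x kx nzx; rewrite /= sb (fixed_gal kK gs kx).
by exists i.
Qed.

Theorem theorem4p2
  (N : splittingFieldType rat) (k K L : {subfield N})
  (iota : {rmorphism N -> algC})
  (zeta : nat -> algC)
  (hzeta : forall n : nat, (0 < n)%N -> n.-primitive_root (zeta n))
  (hkK : (k <= K)%VS) (hKL : (K <= L)%VS)
  (habel : abelian_ext k L)
  (htame : tame K L)
  (hreal : totally_real K)
  (p : set N) (hp : prime_of k p)
  (e1 e2 : nat)
  (he1 : ramification_index k K p e1)
  (he2 : ramification_index_above k K L p e2)
  (hodd : exists d : nat, [/\ odd d, (1 < d)%N & (d %| e1)%N])
  (l : nat) (hlprime : prime l) (hlodd : odd l) (hl : (l %| e2)%N)
  (ha : lin_disjoint rat_field (iota @` [set` K]) (field_gen [set zeta l]))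
  (hb : l = 3%N ->
    exists q : nat, [/\ prime q, odd q, (q %| e1)%N &
      ~ field_gen ((iota @` [set` L])
                   `|` [set zeta (3 ^ n)%N | n in [set: nat]]) (zeta q)]) :
  ~ weak_normal_integral_basis K L.
Proof.
have [galkL abkL] := habel.
move=> /(weak_nib_generator galkL hkK hKL)[M [al [hM Lal al_gen al_comb]]].
have galKL := gal_tower galkL hkK hKL; have abKL := abelian_tower abkL hkK.
(* The valuation is taken at the prime of L given by [he2], so that e2 is directly the exponent at
   v. The prime behind e1 may be another one above p, which [val_ramification_index] handles by
   conjugation. *)
have [P2 [hP2 overP2 [Q [hQ overQ ramQ]]]] := he2.
have [v [r [hv DQ]]] := prime_center iota hQ.
have DP2 : P2 = center v iota K by rewrite -overQ DQ; apply: center_lies_over.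
rewrite DQ in overQ ramQ hQ; rewrite DP2 in overP2 overQ ramQ hP2; clear P2 Q DP2 DQ.
have pr_r := val_prime hv.
have tame_e : ~~ (r %| e2)%N.
  exact: (htame _ _ _ hP2 hQ overQ ramQ r pr_r (center_char hv iota K)).
have [t [Ot nzt vt t_gen]] : exists t, [/\ int_ring L t, t != 0, 0 < v (iota t) &
    forall x, x \in L -> x != 0 -> exists i : int, v (iota x) = v (iota t) * i%:~R].
  have [t0 [Lt0 nzt0 vt0 t0_gen]] := val_uniformizer hv iota L.
  have [t [Ot nzt Dt]] := integral_representative hv Lt0 nzt0 (ltW vt0).
  by exists t; rewrite Dt; split.
have Lt : t \in L by case/int_ringP: Ot.
have [[a [Ka nza va]] e_gen] := ram_exponent_val hv Lt nzt vt t_gen hKL overQ ramQ.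
have e2_gt0 : (0 < e2)%N.
  have [tK [KtK nztK vtK _]] := val_uniformizer hv iota K.
  have [i Di] := e_gen _ KtK nztK; rewrite lt0n; apply: contraTneq vtK => e0.
  by rewrite Di e0 mulr0 mul0r ltxx.
have E_gt0 : 0 < v (iota t) * e2%:R by rewrite mulr_gt0 // ltr0n.
have k_gen : forall x, x \in k -> x != 0 ->
    exists i : int, v (iota x) = v (iota t) * e2%:R * e1%:R * i%:~R.
  rewrite -va; apply: (val_ramification_index hv _ Ka nza _ _ overP2 he1).
  - exact: (gal_lower galkL abkL hkK hKL).
  - by rewrite va.
  by rewrite va.
have [s0 Ts0 ord_s0] : {s0 | s0 \in inertia v iota K L & #[s0]%g = l}.
  apply: (@Cauchy _ l (inertia_group hv iota K L)) => //.
  apply: dvdn_trans hl _.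
  exact: (ramification_dvd_inertia hv galKL Lt nzt vt t_gen e_gen Ka nza va tame_e Ot).
have [chi0 chi0M [chi0n chi0_s0]] :=
  exists_prime_power_character (subg_mulC abKL) hlprime ord_s0.
(* n is the l-part of the order of Gal(L / K); for l = 3 this puts z among the roots of unity
   adjoined in (b). *)
set m := logn l _ in chi0n; set n := (l ^ m)%N in chi0n.
have l_gt0 := prime_gt0 hlprime.
have n_gt0 : (0 < n)%N by rewrite expn_gt0 l_gt0.
have prim_z := hzeta n n_gt0; set z := zeta n in prim_z.
have hchi0 : unity_char n chi0 by [].
have r_n : ~~ (r %| n)%N.
  (* If r divided n, it would be l, which divides e2, against tameness. *)
  apply: contra tame_e; rewrite Euclid_dvdX // => /andP[]; rewrite dvdn_prime2 //.
  by move=> /eqP ->.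
have nz_res (chi : subg_of 'Gal(L / K)%g -> algC) : unity_char n chi ->
    eigen_resolvent iota chi al != 0.
  by case/(resolvent_bound hv galkL hkK hKL nzt vt Ot t_gen Ka nza va tame_e e2_gt0 prim_z
    hM Lal al_gen al_comb).
have [chi hchi chi_val] := exists_small_character hv galkL abkL hkK hKL nzt vt Ot t_gen
  e_gen Ka nza va tame_e e2_gt0 prim_z r_n hM Lal al_gen al_comb hlprime (erefl n) hchi0
  Ts0 chi0_s0.
have small := val_gauss_jacobi_small hv galkL hkK hKL nzt vt Ot t_gen Ka nza va tame_e
  e2_gt0 prim_z hM Lal al_gen al_comb l_gt0 hchi chi_val.
have large := val_gauss_jacobi_large hv galkL hkK hKL nzt vt Ot t_gen Ka nza va tame_e
  e2_gt0 prim_z hM Lal al_gen al_comb l_gt0 hchi chi_val.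
have modl := val_gauss_jacobi_mod hv galkL hkK hKL nzt vt Ot t_gen Ka nza va tame_e
  e2_gt0 prim_z hM Lal al_gen al_comb hchi chi_val.
have l_gt1 := prime_gt1 hlprime.
have [l3|l_neq3] := eqVneq l 3%N.
  have [q [pr_q odd_q q_e1 nFq]] := hb l3.
  apply: (contradiction_fixed hv galkL abkL hkK hKL prim_z r_n hM Lal al_gen al_comb hreal
    nz_res hchi E_gt0 pr_q q_e1 k_gen (field_gen_subfield _) _ _ _ nFq).
  - by move=> x Lx; apply: field_gen_sub; left.
  - by apply: field_gen_sub; right; exists m => //; rewrite /z /n l3.
  - exact/hzeta/prime_gt0.
  by apply: (small 1%N); rewrite // l3.
(* This puts 2, the image of the index 1 under doubling, below l / 2. *)
have l_gt4 : (4 < l)%N.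
  by case: (l) hlodd l_gt1 l_neq3 => [|[|[|[|[|]]]]].
have [d [odd_d d_gt1 d_e1]] := hodd.
have pr_q := pdiv_prime d_gt1; set q := pdiv d in pr_q.
have q_e1 : (q %| e1)%N := dvdn_trans (pdiv_dvd d) d_e1.
have odd_q : odd q := dvdn_odd (pdiv_dvd d) odd_d.
have prim_l := hzeta l l_gt0.
have [nu fixK nuzl] : exists2 nu : {rmorphism algC -> algC},
    fixes iota K nu & nu (zeta l) = zeta l ^+ 2.
  by apply: (lin_disjoint_conjugate prim_l ha); rewrite coprime2n.
have [j nuz] := rmorph_prim_root prim_z nu.
have m_gt0 : (0 < m)%N.
  rewrite lt0n; apply: contraNneq chi0_s0 => m0.
  by have := chi0n s0; rewrite /n m0 expn0 expr1 => ->.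
(* The exponent j of nu on z is only known modulo n; [zeta l] is a power of z, so modulo l it agrees
   with the prescribed 2. *)
have Dj : j = 2 %[mod l].
  have [|b Db] := prim_rootP prim_z (_ : zeta l ^+ n = 1).
    have /dvdnP[c ->] : (l %| n)%N by rewrite dvdn_exp.
    by rewrite mulnC exprM (prim_expr_order prim_l) expr1n.
  have nuzlj : nu (zeta l) = zeta l ^+ j by rewrite Db rmorphXn /= nuz exprAC.
  by apply/eqP; rewrite -(eq_prim_root_expr prim_l) -nuzl nuzlj.
have Dl : l = (2 * l./2).+1.
  by rewrite -{1}(odd_double_half l) hlodd add1n -mul2n.
have Djz : (j%:Z = 2 %[mod l])%Z by rewrite (modz_nat 2 l) modz_nat Dj.
have h_gt0 : (0 < l./2)%N by rewrite half_gt0.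
(* The second index, [l./2] = (l - 1) / 2, is the largest below l / 2; its double l - 1 is above
   it. *)
apply: (contradiction_twist hv galkL abkL hkK hKL prim_z r_n hM Lal al_gen al_comb hreal
    nz_res hchi E_gt0 pr_q q_e1 k_gen fixK nuz odd_q _ _ (small l./2 h_gt0 _)).
- by apply: (small 1%N) => //; apply: leq_trans l_gt4.
- by rewrite (modl _ _ Djz); apply: (small 2%N).
- by rewrite [X in (_ < X)%N]Dl.
have -> : v (gauss_jacobi iota al chi (j%:Z * l./2)) =
    v (gauss_jacobi iota al chi (2 * l./2)%N).
  by apply: modl; rewrite -modzMml Djz modzMml PoszM.
apply: large; first by rewrite [X in (_ < X)%N]Dl.
clear -Dl l_gt4; lia.
Qed.
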